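(* Consider the CES skill formation model described in the context and suppose that conditions (a)--(h) listed there hold. (a) The identified set of the parameters $\{\mu_{\theta,t,m},\lambda_{\theta,t,m}\}_{t=0,\ldots,T,m=1,2}$, $\{\mu_{I,t,m},\lambda_{I,t,m}\}_{t=0,\ldots,T-1,m=1,2}$, $(\rho_0,\rho_1)$, $\{ \beta_{0t}, \beta_{1t}, \beta_{2t}\}^{T-1}_{t=0}$, $\{ \gamma_{1t},\gamma_{2t}, \sigma_{t}, \psi_t\}^{T-1}_{t=0}$ consists of all vectors that yield the same values of $\{\tilde{\mu}_{\theta,t,m},\tilde{\lambda}_{\theta,t,m}\}_{t=0,\ldots,T,m=1,2}$, $\{\tilde{\mu}_{I,t,m},\tilde{\lambda}_{I,t,m}\}_{t=0,\ldots,T-1,m=1,2}$, $(\tilde{\rho}_0,\tilde{\rho}_1)$, $\left\{ \tilde{\gamma}_{1t},\tilde{\gamma}_{2t}, \frac{\sigma_{t} }{\lambda_{\theta,t,1}},\frac{\sigma_{t} }{\lambda_{I,t,1}} \right\}^{T-1}_{t=0}$, $\left\{\frac{\lambda_{\theta,t+1,1}\psi_t}{\sigma_{t}}\right\}^{T-1}_{t=0}$, and $\{ \tilde{\beta}_{0t}, \tilde{\beta}_{1t}, \tilde{\beta}_{2t}\}^{T-1}_{t=0}$ (the functions of the parameters defined in the context) as the true parameter vector. (b) Let $\{\bar{\mu}_{\theta,t,1} \}_{t=0}^{T}$, $\{\bar{\mu}_{I,t,1} \}_{t=0}^{T-1}$, and $\{\bar{\lambda}_{\theta,t,1} \}_{t=0}^{T}$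 be fixed constants with $\bar{\lambda}_{\theta,t,1} \neq 0$ for all $t$. Under the additional restrictions $\{\mu_{\theta,t,1} \}_{t=0}^{T} = \{\bar{\mu}_{\theta,t,1} \}_{t=0}^{T}$, $\{\mu_{I,t,1} \}_{t=0}^{T-1} = \{\bar{\mu}_{I,t,1} \}_{t=0}^{T-1}$ and $\{\lambda_{\theta,t,1} \}_{t=0}^{T} = \{\bar{\lambda}_{\theta,t,1} \}_{t=0}^{T}$, the identified set is a singleton.
   Context: Model. $\theta_t$ (skills, $t=0,\dots,T$) and $I_t$ (investment, $t=0,\dots,T-1$) are unobserved positive random variables satisfying $$\theta_{t+1} = \left(\gamma_{1t} \theta_{t}^{\sigma_t} + \gamma_{2t} I_t^{\sigma_t}\right)^{\psi_t/\sigma_t}\exp(\eta_{\theta,t}),\quad t=0,\dots,T-1,$$ $$Z_{\theta,t,m} = \mu_{\theta,t,m} + \lambda_{\theta,t,m} \ln \theta_{t} + \varepsilon_{\theta,t,m},\quad t=0,\dots,T,\ m=1,2,$$ $$Z_{I,t,m} = \mu_{I,t,m} + \lambda_{I,t,m} \ln I_{t} + \varepsilon_{I,t,m},\quad t=0,\dots,T-1,\ m=1,2,$$ $$\ln I_t = \beta_{0t} + \beta_{1t} \ln \theta_{t} + \beta_{2t} \ln Y_{t} + \eta_{I,t},\quad t=0,\dots,T-1,$$ $$Q = \rho_{0} + \rho_{1} \ln \theta_{T} + \eta_Q,$$ where $\sigma_t\neq0$, $\gamma_{1t}\neq0$, $\gamma_{2t}\neq 0$ and $\psi_t\neq0$ for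 all $t$. Observed variables: $\{Y_t\}_{t=0}^{T-1}$ (income, or another exogenous variable that affects investment, i.e. $\beta_{2t}\neq 0$), all $Z_{\theta,t,m}$, all $Z_{I,t,m}$, and $Q$. The errors/shocks $\varepsilon_{\theta,t,m},\varepsilon_{I,t,m},\eta_{\theta,t},\eta_{I,t},\eta_Q$ are unobserved. Conditions. (a) $\{\{\varepsilon_{\theta,t,m}\}_{t=0,\ldots,T, m= 1,2}, \{\varepsilon_{I,t,m} \}_{t=0,\ldots,T-1, m= 1,2}, \eta_Q\}$ are jointly independent and independent of $\{\{\theta_{t}\}^{T}_{t=0},\{I_t\}_{t=0}^{T-1}\}$ conditional on $\{Y_t\}_{t=0}^{T-1}$. (b) All random variables have bounded first and second moments. (c) $E[\varepsilon_{\theta,t,m}] = E[\varepsilon_{I,t,m}] = E[\eta_Q] = 0$ for all $t$ and $m$. (d) $\lambda_{\theta,t,m}, \lambda_{I,t,m} \neq 0$ for all $t$ and $m$. (e) For all $t \in \{0,\ldots,T\}$, $cov(\ln \theta_t,\ln I_s) \neq 0$ for some $s \in \{0,\ldots, T-1\}$ or $cov(\ln \theta_t,\ln \theta_s) \neq 0$ for some $s \in \{0, \ldots, T\} \setminus \{t\}$. For all $t \in \{0,\ldots,T-1\}$, $cov(\ln I_t,\ln \theta_s) \neq 0$ for some $s \in \{0, \ldots, T\}$ or $cov(\ln I_t,\ln I_s) \neq 0$ for some $s \in \{0, \ldots, T-1\} \setminus \{t\}$. (f) For all $t$ and $m$ the real zeros of the characteristic function of $\varepsilon_{\theta,t,m}$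 are isolated and are distinct from those of its derivatives. Identical conditions hold for the characteristic functions of $\varepsilon_{I,t,m}$ and $\eta_{Q}$. (g) The support of $(\theta_{t},I_{t},Y_t)$ includes an open ball in $\mathbb{R}^3$ for all $t$. (h) $E[\eta_{I,t} \mid \theta_{t}, Y_t] = 0$ and $E[\eta_{\theta,t} \mid \theta_{t},\eta_{I,t} , Y_t] = \kappa_t \eta_{I,t}$ for all $t$, for some constants $\kappa_t$. Transformed parameters (functions of the primitive parameters): $$\tilde{\gamma}_{1t} = \gamma_{1t} \exp\left( \sigma_{t} \left( \frac{ \mu_{\theta,t+1,1} }{ \lambda_{\theta,t+1,1}\psi_t } - \frac{\mu_{\theta,t,1}}{\lambda_{\theta,t,1}} \right) \right),\quad \tilde{\gamma}_{2t} = \gamma_{2t} \exp\left( \sigma_{t} \left( \frac{ \mu_{\theta,t+1,1} }{ \lambda_{\theta,t+1,1}\psi_t } - \frac{\mu_{I,t,1}}{\lambda_{I,t,1}} \right) \right),$$ $$\tilde{\lambda}_{\theta,t,m} = \frac{\lambda_{\theta,t,m}}{\lambda_{\theta,t,1}},\quad \tilde{\mu}_{\theta,t,m} = \mu_{\theta,t,m} - \frac{\lambda_{\theta,t,m}}{\lambda_{\theta,t,1}} \mu_{\theta,t,1},\quad \tilde{\lambda}_{I,t,m} = \frac{\lambda_{I,t,m}}{\lambda_{I,t,1}},\quad \tilde{\mu}_{I,t,m} = \mu_{I,t,m} - \frac{\lambda_{I,t,m}}{\lambda_{I,t,1}} \mu_{I,t,1},$$ $$\tilde{\beta}_{0t}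 = \lambda_{I,t,1} \beta_{0t} + \mu_{I,t,1} - \frac{\lambda_{I,t,1}}{\lambda_{\theta,t,1}} \mu_{\theta,t,1} \beta_{1t},\quad \tilde{\beta}_{1t} = \frac{\lambda_{I,t,1}}{\lambda_{\theta,t,1}} \beta_{1t},\quad \tilde{\beta}_{2t} = \lambda_{I,t,1} \beta_{2t},$$ $$\tilde{\rho}_0 = \rho_0 - \frac{\rho_1 \mu_{\theta,T,1}}{\lambda_{\theta,T,1}},\quad \tilde{\rho}_1 = \frac{ \rho_1}{\lambda_{\theta,T,1}}.$$ Identification. A structure is a parameter vector together with a joint distribution of all (observed and unobserved) random variables satisfying the model and the stated conditions. Two structures are observationally equivalent if they generate the same joint distribution of the observed variables. The identified set of the parameters is the set of all parameter vectors belonging to some structure that is observationally equivalent to the true structure; with additional restrictions, it is the subset of those vectors that satisfy the restrictions.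
   Formalization: Added: the vector of all errors ε and η_Q is independent of {Y_t} (with (a) only conditional on Y the claim fails); and (b) is imposed on ln θ_t and ln I_t, not on the levels θ_t, I_t, whose moments are not preserved when λ_{θ,t,1} or λ_{I,t,1} changes. *)

(* Defs.v *)
From HB Require Import structures.
From mathcomp Require Import all_boot all_order all_algebra.
From mathcomp Require Import complex.
From mathcomp Require Import all_classical all_reals all_analysis.

Set Implicit Arguments.
Unset Strict Implicit.
Unset Printing Implicit Defensive.

Import Order.TTheory GRing.Theory Num.Theory.
Import numFieldNormedType.Exports.

Local Open Scope classical_set_scope.
Local Open Scope ring_scope.

(** * Probabilistic notions *)

(* sigma-algebra generated by a set of real-valued functions *)
Definition sigma_of (R : realType) (Om : Type) (S : set (Om -> R)) :
    set (set Om) :=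
  <<s \bigcup_(X in S) preimage_set_system setT X measurable >>.

(* product (cylinder) sigma-algebra on families of reals *)
Definition cylinder_sigma (R : realType) (J : Type) : set (set (J -> R)) :=
  sigma_of (range (fun (j : J) (x : J -> R) => x j)).

Definition same_joint_law (R : realType) (J : Type)
    (d1 : measure_display) (Om1 : measurableType d1) (P1 : probability Om1 R)
    (X1 : J -> Om1 -> R)
    (d2 : measure_display) (Om2 : measurableType d2) (P2 : probability Om2 R)
    (X2 : J -> Om2 -> R) : Prop :=
  forall C : set (J -> R), @cylinder_sigma R J C ->
    P1 [set w | C (X1 ^~ w)] = P2 [set w | C (X2 ^~ w)].

Section Probability.
Context (R : realType) (d : measure_display) (Om : measurableType d).
Variable P : probability Om R.

(* f is a version of E[X | G] *)
Definition is_cond_exp (X : Om -> R) (G : set (set Om)) (f : Om -> R) : Prop :=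
  [/\ P.-integrable setT (EFin \o X),
      P.-integrable setT (EFin \o f),
      forall B : set R, measurable B -> G (f @^-1` B) &
      forall A, G A ->
        (\int[P]_(w in A) (f w)%:E = \int[P]_(w in A) (X w)%:E)%E].

Definition is_cond_prob (A : set Om) (G : set (set Om)) (f : Om -> R) : Prop :=
  is_cond_exp (\1_A) G f.

(* Mutual independence of the sigma-algebras F j conditional on G.  Taking
   some A j := setT covers the subfamilies of J. *)
Definition cond_indep (J : finType) (F : J -> set (set Om))
    (G : set (set Om)) : Prop :=
  forall (A : J -> set Om) (p : J -> Om -> R),
    (forall j, F j (A j)) ->
    (forall j, is_cond_prob (A j) G (p j)) ->
    is_cond_prob (\bigcap_(j in [set: J]) A j) G (fun w => \prod_j p j w).

Definition cond_indep2 (F1 F2 G : set (set Om)) : Prop :=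
  cond_indep (fun b : bool => if b then F1 else F2) G.

Definition indep2 (F1 F2 : set (set Om)) : Prop :=
  forall A B, F1 A -> F2 B -> (P (A `&` B) = P A * P B)%E.

Definition finite_moments (X : Om -> R) : Prop :=
  X \in Lfun P 1%E /\ X \in Lfun P 2%:E.

(* E[exp(i t X)] *)
Definition char_fun (X : Om -> R) (t : R) : R[i] :=
  (fine 'E_P[fun w => cos (t * X w)%R] +i*
   fine 'E_P[fun w => sin (t * X w)%R])%C.

(* support of the law of a random vector in R^3 *)
Definition support3 (X Y Z : Om -> R) : set (R * R * R) :=
  [set x | forall U : set (R * R * R), open U -> U x ->
     (0 < P [set w | U (X w, Y w, Z w)])%E].

End Probability.

Definition eball3 (R : realType) (c : R * R * R) (r : R) : set (R * R * R) :=
  [set x | (x.1.1 - c.1.1) ^+ 2 + (x.1.2 - c.1.2) ^+ 2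
           + (x.2 - c.2) ^+ 2 < r ^+ 2].

(** Derivatives of a function from the reals to the complex numbers, taken on
    real and imaginary parts. *)
Section ComplexDerivatives.
Context (R : realType).
Implicit Type phi : R -> R[i].

Definition re_part phi : R -> R := fun t => complex.Re (phi t).
Definition im_part phi : R -> R := fun t => complex.Im (phi t).

Definition times_derivable (k : nat) phi : Prop :=
  forall j : nat, (j < k)%N -> forall t : R,
    derivable ((re_part phi)^`(j)%classic) t 1 /\ derivable ((im_part phi)^`(j)%classic) t 1.

Definition cderive (k : nat) phi : R -> R[i] :=
  fun t => ((re_part phi)^`(k)%classic t +i* (im_part phi)^`(k)%classic t)%C.

(* The last clause ranges over the derivatives that exist: higher-order ones
   need not, as only second moments are assumed finite. *)
Definition regular_zeros phi : Prop :=
  (forall t, phi t = 0 -> isolated [set s | phi s = 0] t) /\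
  (forall k : nat, (0 < k)%N -> times_derivable k phi ->
     forall t, phi t = 0 -> cderive k phi t != 0).

End ComplexDerivatives.

(** * The CES skill formation model *)

(* Periods 0..T are 'I_T.+1 and periods 0..T-1 are 'I_T; for t : 'I_T, the
   periods t and t+1 in 'I_T.+1 are [cur t] and [nxt t].  The measurement
   index m = 1, 2 is 'I_2, with m = 1 being ord0. *)
Definition cur (T : nat) (t : 'I_T) : 'I_T.+1 := widen_ord (leqnSn T) t.
Definition nxt (T : nat) (t : 'I_T) : 'I_T.+1 := lift ord0 t.

Record params (R : realType) (T : nat) := Params {
  mu_th : 'I_T.+1 -> 'I_2 -> R;
  la_th : 'I_T.+1 -> 'I_2 -> R;
  mu_I : 'I_T -> 'I_2 -> R;
  la_I : 'I_T -> 'I_2 -> R;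
  rho0 : R;
  rho1 : R;
  beta0 : 'I_T -> R;
  beta1 : 'I_T -> R;
  beta2 : 'I_T -> R;
  gamma1 : 'I_T -> R;
  gamma2 : 'I_T -> R;
  sigma : 'I_T -> R;
  psi : 'I_T -> R }.

Record variables (R : realType) (T : nat) (d : measure_display)
    (Om : measurableType d) := Variables {
  theta : 'I_T.+1 -> {mfun Om >-> R};
  invest : 'I_T -> {mfun Om >-> R};
  Y : 'I_T -> {mfun Om >-> R};
  Z_th : 'I_T.+1 -> 'I_2 -> {mfun Om >-> R};
  Z_I : 'I_T -> 'I_2 -> {mfun Om >-> R};
  Q : {mfun Om >-> R};
  eps_th : 'I_T.+1 -> 'I_2 -> {mfun Om >-> R};
  eps_I : 'I_T -> 'I_2 -> {mfun Om >-> R};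
  eta_th : 'I_T -> {mfun Om >-> R};
  eta_I : 'I_T -> {mfun Om >-> R};
  eta_Q : {mfun Om >-> R} }.

(* A parameter vector with a joint distribution of all random variables, the
   latter presented by random variables on some probability space. *)
Record structure (R : realType) (T : nat) := Structure {
  par : params R T;
  disp : measure_display;
  space : measurableType disp;
  prob : probability space R;
  vars : variables R T space }.

Section Model.
Context (R : realType) (T : nat).

Definition admissible (p : params R T) : Prop :=
  [/\ forall t m, la_th p t m != 0,
      forall t m, la_I p t m != 0,
      forall t, beta2 p t != 0,
      forall t, gamma1 p t != 0 /\ gamma2 p t != 0 &
      forall t, sigma p t != 0 /\ psi p t != 0].

Section Conditions.
Context (d : measure_display) (Om : measurableType d).
Variables (P : probability Om R) (p : params R T) (v : variables R T Om).

Definition ln_th (t : 'I_T.+1) : Om -> R := fun w => ln (theta v t w).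
Definition ln_I (t : 'I_T) : Om -> R := fun w => ln (invest v t w).
Definition ln_Y (t : 'I_T) : Om -> R := fun w => ln (Y v t w).

Definition ces (t : 'I_T) (w : Om) : R :=
  gamma1 p t * theta v (cur t) w `^ sigma p t
  + gamma2 p t * invest v t w `^ sigma p t.

(* [powR] is a junk value at negative bases, hence the clause 0 < ces. *)
Record model : Prop := {
  theta_pos : forall t, \forall w \ae P, 0 < theta v t w;
  inv_pos : forall t, \forall w \ae P, 0 < invest v t w;
  Y_pos : forall t, \forall w \ae P, 0 < Y v t w;
  ces_pos : forall t, \forall w \ae P, 0 < ces t w;
  production : forall t, \forall w \ae P,
    theta v (nxt t) w =
      ces t w `^ (psi p t / sigma p t) * expR (eta_th v t w);
  measure_th : forall t m, \forall w \ae P,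
    Z_th v t m w = mu_th p t m + la_th p t m * ln_th t w + eps_th v t m w;
  measure_I : forall t m, \forall w \ae P,
    Z_I v t m w = mu_I p t m + la_I p t m * ln_I t w + eps_I v t m w;
  investment : forall t, \forall w \ae P,
    ln_I t w = beta0 p t + beta1 p t * ln_th (cur t) w
               + beta2 p t * ln_Y t w + eta_I v t w;
  outcome : \forall w \ae P,
    Q v w = rho0 p + rho1 p * ln_th ord_max w + eta_Q v w }.

(* eps_th, eps_I and eta_Q as a single family *)
Definition err_index : finType :=
  ('I_T.+1 * 'I_2 + 'I_T * 'I_2 + unit)%type.

Definition err (j : err_index) : Om -> R :=
  match j with
  | inl (inl (t, m)) => eps_th v t m
  | inl (inr (t, m)) => eps_I v t m
  | inr _ => eta_Q v
  end.

Definition sigma_err : set (set Om) := sigma_of (range err).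
Definition sigma_latent : set (set Om) :=
  sigma_of (range (fun t => theta v t : Om -> R) `|`
            range (fun t => invest v t : Om -> R)).
Definition sigma_Y : set (set Om) :=
  sigma_of (range (fun t => Y v t : Om -> R)).

Definition errors_cond_indep : Prop :=
  cond_indep P (fun j => sigma_of [set err j]) sigma_Y /\
  cond_indep2 P sigma_err sigma_latent sigma_Y.

(* Y is exogenous with respect to the measurement and outcome errors. *)
Definition exogenous_Y : Prop := indep2 P sigma_err sigma_Y.

(* Skills and investment enter through their logarithms; their levels are not
   required to have moments, a property that is not invariant under
   theta |-> exp (a + b * ln theta). *)
Definition all_finite_moments : Prop :=
  [/\ forall t, finite_moments P (ln_th t),
      forall t, finite_moments P (ln_I t),
      forall t, finite_moments P (Y v t) /\ finite_moments P (ln_Y t),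
      (forall t m, finite_moments P (Z_th v t m)) /\
      (forall t m, finite_moments P (Z_I v t m)) /\
      finite_moments P (Q v) &
      (forall j, finite_moments P (err j)) /\
      (forall t, finite_moments P (eta_th v t)) /\
      (forall t, finite_moments P (eta_I v t))].

Definition errors_centered : Prop := forall j, ('E_P[err j] = 0)%E.

Definition latent_correlated : Prop :=
  (forall t : 'I_T.+1,
     (exists s : 'I_T, covariance P (ln_th t) (ln_I s) != 0%E) \/
     (exists s : 'I_T.+1,
        s != t /\ covariance P (ln_th t) (ln_th s) != 0%E)) /\
  (forall t : 'I_T,
     (exists s : 'I_T.+1, covariance P (ln_I t) (ln_th s) != 0%E) \/
     (exists s : 'I_T, s != t /\ covariance P (ln_I t) (ln_I s) != 0%E)).

Definition errors_regular_char_fun : Prop := forall j, regular_zeros (char_fun P (err j)).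

Definition rich_support : Prop := forall t : 'I_T, exists (c : R * R * R) (r : R),
  0 < r /\ eball3 c r `<=` support3 P (theta v (cur t)) (invest v t) (Y v t).

Definition shocks_cond_mean : Prop :=
  (forall t : 'I_T,
     is_cond_exp P (eta_I v t)
       (sigma_of [set (theta v (cur t) : Om -> R); (Y v t : Om -> R)])
       (fun=> 0)) /\
  (exists kappa : 'I_T -> R, forall t : 'I_T,
     is_cond_exp P (eta_th v t)
       (sigma_of [set (theta v (cur t) : Om -> R); (eta_I v t : Om -> R);
                      (Y v t : Om -> R)])
       (fun w => kappa t * eta_I v t w)).

Definition obs_index : finType :=
  ('I_T + 'I_T.+1 * 'I_2 + 'I_T * 'I_2 + unit)%type.

Definition obs (j : obs_index) : Om -> R :=
  match j with
  | inl (inl (inl t)) => Y v t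
  | inl (inl (inr (t, m))) => Z_th v t m
  | inl (inr (t, m)) => Z_I v t m
  | inr _ => Q v
  end.

End Conditions.

Record valid (S : structure R T) : Prop := {
  valid_params : admissible (par S);
  valid_model : model (prob S) (par S) (vars S);
  valid_exo : exogenous_Y (prob S) (vars S);
  valid_indep : errors_cond_indep (prob S) (vars S);
  valid_moments : all_finite_moments (prob S) (vars S);
  valid_centered : errors_centered (prob S) (vars S);
  valid_corr : latent_correlated (prob S) (vars S);
  valid_char_fun : errors_regular_char_fun (prob S) (vars S);
  valid_support : rich_support (prob S) (vars S);
  valid_shocks : shocks_cond_mean (prob S) (vars S) }.

Definition obs_equiv (S1 S2 : structure R T) : Prop :=
  same_joint_law (prob S1) (obs (vars S1)) (prob S2) (obs (vars S2)).

Definition identified_set (S0 : structure R T) : set (params R T) :=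
  [set p | exists S : structure R T,
     [/\ valid S, par S = p & obs_equiv S S0]].

Section Transformed.
Variable p : params R T.

Definition la_th_t (t : 'I_T.+1) (m : 'I_2) : R :=
  la_th p t m / la_th p t ord0.
Definition mu_th_t (t : 'I_T.+1) (m : 'I_2) : R :=
  mu_th p t m - la_th p t m / la_th p t ord0 * mu_th p t ord0.
Definition la_I_t (t : 'I_T) (m : 'I_2) : R :=
  la_I p t m / la_I p t ord0.
Definition mu_I_t (t : 'I_T) (m : 'I_2) : R :=
  mu_I p t m - la_I p t m / la_I p t ord0 * mu_I p t ord0.
Definition gamma1_t (t : 'I_T) : R :=
  gamma1 p t * expR (sigma p t *
    (mu_th p (nxt t) ord0 / (la_th p (nxt t) ord0 * psi p t)
     - mu_th p (cur t) ord0 / la_th p (cur t) ord0)).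
Definition gamma2_t (t : 'I_T) : R :=
  gamma2 p t * expR (sigma p t *
    (mu_th p (nxt t) ord0 / (la_th p (nxt t) ord0 * psi p t)
     - mu_I p t ord0 / la_I p t ord0)).
Definition beta0_t (t : 'I_T) : R :=
  la_I p t ord0 * beta0 p t + mu_I p t ord0
  - la_I p t ord0 / la_th p (cur t) ord0 * mu_th p (cur t) ord0 * beta1 p t.
Definition beta1_t (t : 'I_T) : R :=
  la_I p t ord0 / la_th p (cur t) ord0 * beta1 p t.
Definition beta2_t (t : 'I_T) : R := la_I p t ord0 * beta2 p t.
Definition rho0_t : R :=
  rho0 p - rho1 p * mu_th p ord_max ord0 / la_th p ord_max ord0.
Definition rho1_t : R := rho1 p / la_th p ord_max ord0.

End Transformed.

Record same_transformed (p q : params R T) : Prop := {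
  same_th : forall t m,
    mu_th_t p t m = mu_th_t q t m /\ la_th_t p t m = la_th_t q t m;
  same_I : forall t m,
    mu_I_t p t m = mu_I_t q t m /\ la_I_t p t m = la_I_t q t m;
  same_rho : rho0_t p = rho0_t q /\ rho1_t p = rho1_t q;
  same_gamma : forall t,
    gamma1_t p t = gamma1_t q t /\ gamma2_t p t = gamma2_t q t;
  same_sigma : forall t,
    sigma p t / la_th p (cur t) ord0 = sigma q t / la_th q (cur t) ord0 /\
    sigma p t / la_I p t ord0 = sigma q t / la_I q t ord0;
  same_psi : forall t,
    la_th p (nxt t) ord0 * psi p t / sigma p t =
    la_th q (nxt t) ord0 * psi q t / sigma q t;
  same_beta : forall t,
    [/\ beta0_t p t = beta0_t q t, beta1_t p t = beta1_t q t &
        beta2_t p t = beta2_t q t] }.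

End Model.

(* Main.v *)
From HB Require Import structures.
Require Import Defs.
From mathcomp Require Import all_boot all_order all_algebra.
From mathcomp Require Import complex.
From mathcomp Require Import all_classical all_reals all_analysis.
From mathcomp Require Import measurable_realfun.
From mathcomp Require Import ring lra.

Set Implicit Arguments.
Unset Strict Implicit.
Unset Printing Implicit Defensive.

Import Order.TTheory GRing.Theory Num.Theory.
Import numFieldNormedType.Exports.

Local Open Scope classical_set_scope.
Local Open Scope ring_scope.

(* The first measurements are, up to their errors, affine functions of ln theta
   and ln I; call these functions signals. A measurement error has a
   characteristic function that solves a linear first-order equation: with
   Z1 = X + e1 and Z2 = mu + la X + e2, the observable contrast Z2 - la Z1
   does not involve X, and weighting exp(ir(Z2 - la Z1)) by Z1 brings in the
   derivative of the characteristic function of e1. The equation propagates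
   across the zeros because they are isolated and simple. Deconvolution then
   gives the joint law of two signals and ln Y, as well as the mean of a third
   signal on boxes of these variables. Letting the boxes shrink to a point of
   the support turns the investment and production equations into pointwise
   identities, from which the transformed parameters are read off.

   Conversely, given parameters with the same transformed values, redefining
   theta and I so that the signals do not change, and rescaling the shocks,
   yields a structure with the same observables. *)

(** Condition (a) is conditional on income, whereas deconvolution needs plain independence.
    Exogeneity of income bridges the two: the constant P(A) is a version of the conditional
    probability of an error event A, so that each error becomes independent of the sigma-algebra
    generated by the other errors, the latents and income. Deconvolution yields trigonometric
    moments. Indicators of rays are iterated bounded limits of trigonometric polynomials, an
    argument that allows signed weights; the mean of a third signal is therefore treated like a
    probability, with that signal as weight. Integrals over boxes of positive probability stand for
    conditional means. The production shock is correlated with investment, so that shrinking boxes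
    only give the log of the CES aggregate plus an unknown multiple of the investment residual. As
    [beta2] is nonzero, moving income at fixed signals changes the residual and not the aggregate,
    which separates the two terms. Finally, [sigma / la_th] and [sigma / la_I] are both determined,
    which ties the two scales together: normalizing the loadings of skills pins those of
    investment. *)

Local Notation measurable_wrt G X := (measurable_fun setT (X : g_sigma_algebraType G -> _)).

(** * Integrable random variables and their expectations *)

Section Integrable.
Context (R : realType) (d : measure_display) (Om : measurableType d).
Variable P : probability Om R.
Implicit Types (X Y f : Om -> R) (A : set Om) (c : R).

Definition L1 (X : Om -> R) : Prop := P.-integrable setT (EFin \o X).

Lemma L1_measurable X : L1 X -> measurable_fun setT X.
Proof. by move=> /integrableP[mX _]; exact/measurable_EFinP. Qed.

Lemma L1_dominated X Y : measurable_fun setT X -> L1 Y ->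
  (forall w, `|X w| <= `|Y w|) -> L1 X.
Proof.
move=> mX LY XY; apply: (le_integrable _ _ _ LY) => //.
  exact/measurable_EFinP.
by move=> w _; rewrite /= lee_fin.
Qed.

Lemma L1_cst c : L1 (fun=> c).
Proof. exact: finite_measure_integrable_cst. Qed.

Lemma L1_bounded X c : measurable_fun setT X -> (forall w, `|X w| <= c) -> L1 X.
Proof.
move=> mX Xc; apply: (L1_dominated mX (L1_cst c)) => w.
by rewrite (le_trans (Xc w))// ler_norm.
Qed.

Lemma L1D X Y : L1 X -> L1 Y -> L1 (fun w => X w + Y w).
Proof. by move=> LX LY; apply: (integrableD measurableT LX LY). Qed.

Lemma L1Z c X : L1 X -> L1 (fun w => c * X w).
Proof. by move=> LX; apply: (integrableZl measurableT c LX). Qed.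

Lemma L1N X : L1 X -> L1 (fun w => - X w).
Proof.
by move=> LX; under eq_fun do rewrite -mulN1r; exact: L1Z.
Qed.

Lemma L1B X Y : L1 X -> L1 Y -> L1 (fun w => X w - Y w).
Proof. by move=> LX LY; apply: L1D => //; exact: L1N. Qed.

Lemma L1_norm X : L1 X -> L1 (fun w => `|X w|).
Proof. by move=> LX; apply: (integrable_abse LX). Qed.

Lemma L1M X f c : L1 X -> measurable_fun setT f -> (forall w, `|f w| <= c) ->
  L1 (fun w => X w * f w).
Proof.
move=> LX mf fc; apply: (L1_dominated (Y := fun w => c * X w)).
- by apply: measurable_funM => //; exact: L1_measurable.
- exact: L1Z.
- move=> w; rewrite normrM mulrC normrM ler_wpM2r//.
  by rewrite (le_trans (fc w))// ler_norm.
Qed.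

Lemma L1_indic A : measurable A -> L1 (\1_A).
Proof. exact: integrable_indic. Qed.

Lemma L1_ae X Y : L1 X -> measurable_fun setT Y ->
  (\forall w \ae P, X w = Y w) -> L1 Y.
Proof.
move=> /integrableP[mX iX] mY XY; apply/integrableP; split.
  exact/measurable_EFinP.
rewrite -(_ : (\int[P]_w `|(EFin \o X) w| = \int[P]_w `|(EFin \o Y) w|)%E)//.
apply: ae_eq_integral => //.
- exact: (measurableT_comp _ mX).
- by apply: measurableT_comp => //; exact/measurable_EFinP.
- by apply: filterS XY => w XYw _ /=; rewrite XYw.
Qed.

Lemma expect_ae X Y : measurable_fun setT X -> measurable_fun setT Y ->
  (\forall w \ae P, X w = Y w) -> \int[P]_w X w = \int[P]_w Y w.
Proof.
move=> mX mY XY; congr fine; apply: ae_eq_integral => //; try exact/measurable_EFinP.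
by apply: filterS XY => w XYw _ /=; rewrite XYw.
Qed.

Lemma expectD X Y : L1 X -> L1 Y ->
  \int[P]_w (X w + Y w) = \int[P]_w X w + \int[P]_w Y w.
Proof. by move=> LX LY; rewrite RintegralD. Qed.

Lemma expectB X Y : L1 X -> L1 Y ->
  \int[P]_w (X w - Y w) = \int[P]_w X w - \int[P]_w Y w.
Proof. by move=> LX LY; rewrite RintegralB. Qed.

Lemma expectZ c X : L1 X -> \int[P]_w (c * X w) = c * \int[P]_w X w.
Proof. by move=> LX; rewrite RintegralZl. Qed.

Lemma expect_cst c : \int[P]_w (fun=> c) w = c.
Proof.
by rewrite Rintegral_cst//= [P _]probability_setT mulr1.
Qed.

Lemma expect_indic A : measurable A -> \int[P]_w \1_A w = fine (P A).
Proof. by move=> mA; rewrite /Rintegral integral_indic// setIT. Qed.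

Lemma expect_restrict X A : measurable A ->
  \int[P]_w (X w * \1_A w) = \int[P]_(w in A) X w.
Proof.
move=> mA; rewrite [RHS]Rintegral_mkcond; apply: eq_Rintegral => w _.
by rewrite patchE indicE; case: (_ \in _); rewrite ?mulr1 ?mulr0.
Qed.

Lemma expect_le X Y : L1 X -> L1 Y -> (\forall w \ae P, X w <= Y w) ->
  \int[P]_w X w <= \int[P]_w Y w.
Proof.
move=> LX LY XY.
have mX := L1_measurable LX; have mY := L1_measurable LY.
(* The minimum equals [X] almost surely and lies below [Y] everywhere, which upgrades the almost
   sure inequality to a pointwise one. *)
rewrite (_ : \int[P]_w X w = \int[P]_w (Num.min (X w) (Y w))).
  apply: le_Rintegral => //; last by move=> w _; rewrite ge_min lexx orbT.
  apply: (@L1_ae X) => //; first exact: measurable_minr.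
  by apply: filterS XY => w; case: lerP.
apply: expect_ae => //; first exact: measurable_minr.
by apply: filterS XY => w; case: lerP.
Qed.

Lemma expect_cvg (X_ : nat -> Om -> R) X Y : (forall n, measurable_fun setT (X_ n)) ->
  measurable_fun setT X -> L1 Y -> (forall n w, `|X_ n w| <= Y w) ->
  (forall w, X_ n w @[n --> \oo] --> X w) ->
  \int[P]_w X_ n w @[n --> \oo] --> \int[P]_w X w.
Proof.
move=> mX_ mX LY XY cX.
have Y0 w : 0 <= Y w by rewrite (le_trans _ (XY 0%N w)).
have LX : L1 X.
  apply: (L1_dominated mX LY) => w; rewrite (ger0_norm (Y0 w)).
  have cXw : `|X_ n w| @[n --> \oo] --> `|X w| by apply: cvg_norm; exact: cX.
  rewrite -(cvg_lim _ cXw)//; apply: limr_le; first by apply/cvg_ex; eexists; exact: cXw.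
  by apply: nearW => n; exact: XY.
apply: fine_cvg; rewrite fineK; last exact: integrable_fin_num.
apply: (@dominated_cvg _ _ _ P setT measurableT (fun n w => (X_ n w)%:E) _ (EFin \o Y)) => //.
- by move=> n; exact/measurable_EFinP.
- by move=> w _; apply: cvg_EFin; [exact: nearW|exact: cX].
- by move=> n w _; rewrite lee_fin.
Qed.

Lemma finite_momentsP X : finite_moments P X -> L1 X.
Proof. by move=> [/Lfun1_integrable]. Qed.

Lemma finite_moments_mul X Y : finite_moments P X -> finite_moments P Y ->
  L1 (fun w => X w * Y w).
Proof. by move=> [_ X2] [_ Y2]; exact/Lfun1_integrable/(Lfun2_mul_Lfun1 X2 Y2). Qed.

Lemma expectationE X : fine 'E_P[X]%E = \int[P]_w X w.
Proof. by rewrite unlock. Qed.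

End Integrable.

(** * Transfer of expectations between spaces carrying the same law *)

Section SameLaw.
Context (R : realType).
Context (d1 : measure_display) (Om1 : measurableType d1) (P1 : probability Om1 R).
Context (d2 : measure_display) (Om2 : measurableType d2) (P2 : probability Om2 R).

(** Both integrals are pushed forward to the real line, where the two image measures agree.
    Integrability transfers in the same way, applied to the absolute value. *)
Lemma same_law_expect (U1 : Om1 -> R) (U2 : Om2 -> R) :
  measurable_fun setT U1 -> measurable_fun setT U2 ->
  (forall B, measurable B -> P1 (U1 @^-1` B) = P2 (U2 @^-1` B)) ->
  L1 P1 U1 -> L1 P2 U2 /\ \int[P1]_w U1 w = \int[P2]_w U2 w.
Proof.
move=> mU1 mU2 U12 LU1.
pose f1 : {mfun Om1 >-> R} := mfun_Sub (mem_set mU1).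
pose f2 : {mfun Om2 >-> R} := mfun_Sub (mem_set mU2).
have midE : measurable_fun setT (fun x : R => x%:E) by exact/measurable_EFinP.
have E12 (g : R -> \bar R) : measurable_fun setT g ->
    (\int[distribution P1 f1]_x g x = \int[distribution P2 f2]_x g x)%E.
  move=> mg; apply: eq_measure_integral => A mA _; exact: U12.
have LU2 : L1 P2 U2.
  apply/integrableP; split; first exact/measurable_EFinP.
  have mabs : measurable_fun setT (fun x : R => `|x%:E|%E) by exact: measurableT_comp.
  have := @ge0_integral_distribution _ _ _ _ _ P2 f2 (fun x => `|x%:E|)%E mabs (fun=> abse_ge0 _).
  rewrite /comp/= => <-; rewrite -E12//.
  rewrite (@ge0_integral_distribution _ _ _ _ _ P1 f1 (fun x => `|x%:E|)%E mabs (fun=> abse_ge0 _)).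
  by have /integrableP[] := LU1.
split=> //; congr fine.
have := @integral_distribution _ _ _ _ _ P1 f1 (fun x => x%:E) midE LU1.
have := @integral_distribution _ _ _ _ _ P2 f2 (fun x => x%:E) midE LU2.
by rewrite /comp/= => <- <-; apply: E12.
Qed.

Variable J : Type.
Variables (X1 : J -> Om1 -> R) (X2 : J -> Om2 -> R).

(** Generator of [cylinder_sigma], singled out so that [g_sigma_algebraType] can turn the space of
    families into a measurable type. *)
Definition cylinders : set (set (J -> R)) :=
  \bigcup_(X in range (fun (j : J) (x : J -> R) => x j))
    preimage_set_system setT X measurable.

Lemma measurable_coord j :
  measurable_fun setT (fun x : g_sigma_algebraType cylinders => x j).
Proof.
move=> _ B mB; apply: sub_sigma_algebra; exists (fun x => x j); first by exists j.
by exists B.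
Qed.

(** In the identification direction, observational equivalence is exploited only through this
    statement, with [phi] a function of the observables. *)
Lemma same_joint_law_expect (phi : (J -> R) -> R) :
  (forall j, measurable_fun setT (X1 j)) -> (forall j, measurable_fun setT (X2 j)) ->
  same_joint_law P1 X1 P2 X2 ->
  measurable_wrt cylinders phi ->
  L1 P1 (fun w => phi (X1 ^~ w)) ->
  L1 P2 (fun w => phi (X2 ^~ w)) /\
  \int[P1]_w phi (X1 ^~ w) = \int[P2]_w phi (X2 ^~ w).
Proof.
move=> mX1 mX2 X12 mphi.
have mtuple d (Om : measurableType d) (X : J -> Om -> R) :
    (forall j, measurable_fun setT (X j)) ->
    measurable_fun setT (fun w => X ^~ w : g_sigma_algebraType cylinders).
  move=> mX; apply: (@measurability _ _ Om (g_sigma_algebraType cylinders) setT _ cylinders) => //.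
  move=> _ [_ [_ [j _ <-] [B mB <-]] <-].
  by have := mX j measurableT B mB; rewrite !setTI.
apply: (@same_law_expect (fun w => phi (X1 ^~ w)) (fun w => phi (X2 ^~ w))).
- exact: (measurableT_comp mphi (mtuple _ _ _ mX1)).
- exact: (measurableT_comp mphi (mtuple _ _ _ mX2)).
- move=> B mB; apply: (X12 (phi @^-1` B)).
  by have := mphi measurableT B mB; rewrite setTI.
Qed.

End SameLaw.

(** * Product formula for independent variables *)

Section Independence.
Context (R : realType) (d : measure_display) (Om : measurableType d).
Variable P : probability Om R.

Definition indep_rv (U V : Om -> R) : Prop := forall A B : set R,
  measurable A -> measurable B ->
  P (U @^-1` A `&` V @^-1` B) = (P (U @^-1` A) * P (V @^-1` B))%E.

(** Uniqueness of the product measure makes it the law of the pair. Tonelli applied to absolute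
    values gives integrability of the product although both factors may be unbounded, and Fubini
    then gives its mean. *)
Lemma indep_rv_expect (U V : Om -> R) : L1 P U -> L1 P V -> indep_rv U V ->
  L1 P (fun w => U w * V w) /\
  \int[P]_w (U w * V w) = \int[P]_w U w * \int[P]_w V w.
Proof.
move=> LU LV UV; have mU := L1_measurable LU; have mV := L1_measurable LV.
pose f : {mfun Om >-> R} := mfun_Sub (mem_set mU).
pose g : {mfun Om >-> R} := mfun_Sub (mem_set mV).
have mUV : measurable_fun setT (fun w => (U w, V w)) by exact: measurable_fun_pair.
pose h : {mfun Om >-> (R * R)%type} := mfun_Sub (mem_set mUV).
have midE : measurable_fun setT (fun x : R => x%:E) by exact/measurable_EFinP.
have lawE A : measurable A ->
    (distribution P f \x distribution P g)%E A = distribution P h A.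
  by move=> mA; apply: product_measure_unique.
have IE (k : R * R -> \bar R) :
    (\int[distribution P h]_z k z = \int[distribution P f \x distribution P g]_z k z)%E.
  by apply: eq_measure_integral => A mA _; exact/esym/lawE.
have mM : measurable_fun setT (fun z : R * R => (z.1 * z.2)%:E).
  by apply/measurable_EFinP; apply: measurable_funM.
have mMa : measurable_fun setT (fun z : R * R => `|(z.1 * z.2)%:E|%E).
  by apply: measurableT_comp => //.
have absE (X : Om -> R) (LX : L1 P X) (k : {mfun Om >-> R}) : (k : Om -> R) = X ->
    (\int[distribution P k]_x `|x%:E| = \int[P]_w `|(X w)%:E|)%E.
  move=> <-.
  rewrite (@ge0_integral_distribution _ _ _ _ _ P k (fun x => `|x%:E|)%E)//.
  by apply: measurableT_comp.
have idI (X : Om -> R) (LX : L1 P X) (k : {mfun Om >-> R}) : (k : Om -> R) = X ->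
    (distribution P k).-integrable setT (fun x : R => x%:E).
  move=> kX; apply/integrableP; split => //.
  by rewrite (absE X LX k kX); have /integrableP[] := LX.
have fI := idI U LU f erefl.
have gI := idI V LV g erefl.
have fin : (\int[distribution P f]_x \int[distribution P g]_y
    `|((x, y).1 * (x, y).2)%:E| < +oo)%E.
  rewrite (eq_integral (fun x : R => `|x%:E| * \int[P]_w `|(V w)%:E|)%E); last first.
    move=> x _; rewrite -(absE V LV g erefl) -ge0_integralZl//; last exact: measurableT_comp.
    by apply: eq_integral => y _; rewrite -abseM -EFinM.
  rewrite ge0_integralZr//; last 2 first.
  - by apply: measurableT_comp.
  - exact: integral_ge0.
  rewrite (absE U LU f erefl).
  have /integrableP[_] := LU; have /integrableP[_] := LV => /= V_ U_.
  by rewrite lte_mul_pinfty// ?integral_ge0// ge0_fin_numE// integral_ge0.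
have LUV : L1 P (fun w => U w * V w).
  apply/integrableP; split; first by apply/measurable_EFinP; exact: measurable_funM.
  have := @ge0_integral_distribution _ _ _ _ _ P h
    (fun z => `|(z.1 * z.2)%:E|)%E mMa (fun=> abse_ge0 _).
  rewrite /comp/= => <-; rewrite IE.
  by rewrite (@fubini_tonelli1 _ _ _ _ R (distribution P f) (distribution P g)
    (fun z => `|(z.1 * z.2)%:E|)%E).
split=> //.
rewrite /Rintegral.
have := @integral_distribution _ _ _ _ _ P h (fun z => (z.1 * z.2)%:E) mM LUV.
rewrite /comp/= => <-; rewrite IE.
rewrite -(@integral12_prod_meas1 _ _ _ _ R (distribution P f) (distribution P g)
   (fun z => (z.1 * z.2)%:E))//=; last exact/integrable12ltyP.
rewrite /fubini_F (eq_integral (fun x : R => x%:E * \int[distribution P g]_y y%:E)%E); last first.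
  by move=> x _; rewrite -integralZl.
have := @integral_distribution _ _ _ _ _ P g (fun x => x%:E) midE LV.
have := @integral_distribution _ _ _ _ _ P f (fun x => x%:E) midE LU.
rewrite /comp/= => <- <-.
have gfin := integrable_fin_num measurableT gI.
have ffin := integrable_fin_num measurableT fI.
by rewrite -(fineK gfin) integralZr// fineM.
Qed.

End Independence.

(** * Existence of conditional expectations *)

Section ConditionalExpectation.
Context (R : realType) (d : measure_display) (Om : measurableType d).
Variables (P : probability Om R) (G : set (set Om)).
Hypothesis GM : <<s G >> `<=` measurable.
Local Notation T := (g_sigma_algebraType G).

Lemma measurable_to_sub : measurable_fun setT (id : Om -> T).
Proof. by move=> _ B mB; rewrite setTI; exact: GM. Qed.

Let idT : {mfun Om >-> T} := mfun_Sub (mem_set measurable_to_sub).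

Section Charge.
Variables (X : Om -> R) (LX : L1 P X).

(** The set function whose Radon-Nikodym derivative is the conditional expectation. The
    integrability proof is an argument so that the charge structure declared below can depend on
    it. *)
Definition sub_charge (_ : L1 P X) (A : set T) : \bar R := (\int[P]_(w in (A : set Om)) (X w)%:E)%E.

Let nu := induced_charge LX.

Let sub_charge0 : sub_charge LX set0 = 0%E.
Proof. exact: (charge0 nu). Qed.

Let sub_charge_fin A : measurable A -> sub_charge LX A \is a fin_num.
Proof. by move=> /GM mA; apply: (fin_num_measure nu). Qed.

Let sub_charge_additive : semi_sigma_additive (sub_charge LX).
Proof.
move=> F mF tF mUF.
have nuF := @charge_semi_sigma_additive _ _ _ nu F (fun n => GM (mF n)) tF (GM mUF).
exact: nuF.
Qed.

HB.instance Definition _ := isCharge.Build _ _ _ (sub_charge LX)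
  sub_charge0 sub_charge_fin sub_charge_additive.

End Charge.

(** Radon-Nikodym on the sub-sigma-algebra, with [mu] the restriction of [P], obtained as the law of
    the identity. [cond_indep] speaks about given versions of conditional probabilities, so that a
    version has to be supplied for latent events. *)
Lemma cond_exp_exists (X : Om -> R) : L1 P X ->
  exists f, is_cond_exp P X <<s G >> f.
Proof.
move=> LX; have mX := L1_measurable LX.
pose nu : {charge set T -> \bar R} := sub_charge LX.
pose mu : probability T R := distribution P idT.
have dom : nu `<< mu.
  apply/null_content_dominatesP => A mA PA0.
  apply: null_set_integral => //; first exact: GM.
  by apply: measurable_funTS; exact/measurable_EFinP.
pose g := Radon_Nikodym nu mu.
have gfin x : g x \is a fin_num by exact: Radon_Nikodym_fin_num.
have gI : mu.-integrable setT g by exact: Radon_Nikodym_integrable.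
have mg : measurable_fun setT g by exact: measurable_int gI.
have mf : measurable_fun setT (fine \o g : T -> R) by exact: measurableT_comp.
have mfOm : measurable_fun setT (fine \o g : Om -> R).
  exact: (measurableT_comp mf measurable_to_sub).
have gE : EFin \o (fine \o g) = g by apply/funext => x; rewrite /= fineK.
have LF : L1 P (fine \o g).
  apply/integrableP; split; first exact/measurable_EFinP.
  have /integrableP[_] := gI.
  rewrite (@ge0_integral_distribution _ _ _ _ _ P idT (fun x => `|g x|)%E)//.
    by rewrite /comp/= -gE.
  exact: measurableT_comp.
exists (fine \o g); split => //.
- by move=> B mB; have := mf measurableT B mB; rewrite setTI.
- move=> A mA; have mA' := GM mA.
  have -> : (\int[P]_(w in A) (X w)%:E = nu A)%E by [].
  rewrite (Radon_Nikodym_integral dom mA).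
  rewrite (@integral_pushforward _ _ Om T R idT measurable_to_sub P A g mg)//.
    by rewrite -[in RHS]gE.
  by apply: (integrableS measurableT) => //; rewrite -gE.
Qed.

End ConditionalExpectation.

(** * From conditional independence given income to plain independence *)

Section ConditionalIndependence.
Context (R : realType) (d : measure_display) (Om : measurableType d).
Variables (P : probability Om R) (J : finType) (F : J -> set (set Om)).
Variables (F1 F2 G : set (set Om)).
Hypothesis FS : forall j, sigma_algebra setT (F j).
Hypothesis F1S : sigma_algebra setT F1.
Hypothesis F2S : sigma_algebra setT F2.
Hypothesis FF1 : forall j, F j `<=` F1.
Hypothesis F1M : F1 `<=` measurable.
Hypothesis F2M : F2 `<=` measurable.
Hypothesis GM : <<s G >> `<=` measurable.
Hypothesis F1G : indep2 P F1 <<s G >>.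
Hypothesis cF : cond_indep P F <<s G >>.
Hypothesis cF12 : cond_indep2 P F1 F2 <<s G >>.

Let sigT (S : set (set Om)) : sigma_algebra setT S -> S setT.
Proof. by move=> [S0 SC _]; rewrite -(setD0 setT); exact: SC. Qed.

Let sigI (S : set (set Om)) A B : sigma_algebra setT S -> S A -> S B -> S (A `&` B).
Proof.
move=> [S0 SC SU] SA SB; rewrite -(setCK (A `&` B)) -setTD setCI; apply: (SC).
rewrite -bigcup2E; apply: SU => -[|[|n]]//=; rewrite -setTD; exact: SC.
Qed.

Let sG : sigma_algebra setT <<s G >>.
Proof. exact: smallest_sigma_algebra. Qed.

(** Exogeneity: events of [F1] are independent of the conditioning sigma-algebra, hence their
    conditional probability has a constant version. This is what removes the conditioning in the
    lemmas below. *)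
Let cond_prob_const A : F1 A -> is_cond_prob P A <<s G >> (fun=> fine (P A)).
Proof.
move=> FA; have mA := F1M FA; split.
- exact: L1_indic.
- exact: L1_cst.
- move=> B mB; rewrite preimage_cst; case: ifP => _; first exact: sigT.
  by case: sG.
- move=> C sC; have mC := GM sC.
  rewrite integral_cst//= fineK ?fin_num_measure//.
  by rewrite integral_indic//; exact/esym/F1G.
Qed.

(** The constant version for [A] and any version for [B] multiply to a version for the intersection;
    integrating over [C] pulls the constant out. *)
Lemma cond_indep_latent A B C : F1 A -> F2 B -> <<s G >> C ->
  P (A `&` (B `&` C)) = (P A * P (B `&` C))%E.
Proof.
move=> FA FB sC; have mA := F1M FA; have mB := F2M FB; have mC := GM sC.
have [p pB] := cond_exp_exists GM (L1_indic P mB).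
have := @cF12 (fun b => if b then A else B)
  (fun b => if b then (fun=> fine (P A)) else p).
case; first by case.
  by case => //; exact: cond_prob_const.
move=> _ _ _ /(_ C sC).
have -> : \bigcap_(j in [set: bool]) (if j then A else B) = A `&` B.
  apply/seteqP; split => [w h|w [wA wB] [] _ //].
  by split; [exact: (h true)|exact: (h false)].
rewrite integral_indic//; last exact: measurableI.
rewrite setIA => <-.
have [_ /(integrableS measurableT mC (@subsetT _ _)) Lp _ /(_ C sC) pC] := pB.
under eq_integral do rewrite big_bool /= EFinM.
by rewrite integralZl// pC integral_indic// fineK ?fin_num_measure.
Qed.

(** With constant versions, the conditional product formula integrated over the whole space is the
    unconditional one. *)
Lemma cond_indep_mutual (A : J -> set Om) : (forall j, F j (A j)) ->
  P (\bigcap_(j in [set: J]) A j) = (\prod_j P (A j))%E.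
Proof.
move=> FA; have mA j := F1M (FF1 (FA j)).
have [|_ _ _ /(_ setT (sigT sG))] := cF FA (p := fun j => fun=> fine (P (A j))).
  by move=> j; apply: cond_prob_const; exact: FF1 (FA j).
rewrite integral_indic//; last exact: fin_bigcap_measurable.
rewrite setIT => <-.
rewrite integral_cst//= [X in (_ * X)%E]probability_setT mule1.
elim/big_ind2 : _ => // [x1 y1 x2 y2 <- <-|j _]; first by rewrite EFinM.
by rewrite fineK// fin_num_measure.
Qed.

(* A pi-system of events that do not involve the j-th error. *)
Definition rest_sets (j : J) : set (set Om) :=
  [set D | exists A B C, [/\ forall k, F k (A k), A j = setT, F2 B, <<s G >> C &
     D = (\bigcap_(k in [set: J]) A k) `&` (B `&` C)]].

Let bigcapF1 (A : J -> set Om) : (forall k, F k (A k)) ->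
  F1 (\bigcap_(k in [set: J]) A k).
Proof.
move=> FA; rewrite (_ : \bigcap_(k in [set: J]) A k = \big[setI/setT]_(k <- enum J) A k); last first.
  by rewrite -bigcap_seq; apply/seteqP; split => w h k _; apply: h; rewrite //= mem_enum.
elim/big_ind : _ => [|X Y|k _]; [exact: sigT|exact: sigI|exact: FF1 (FA k)].
Qed.

Lemma rest_sets_measurable j : rest_sets j `<=` measurable.
Proof.
move=> _ [A [B [C [FA _ FB sC ->]]]]; apply: measurableI; first exact/F1M/bigcapF1.
by apply: measurableI; [exact: F2M|exact: GM].
Qed.

Lemma rest_sets_setI j : setI_closed (rest_sets j).
Proof.
move=> _ _ [A [B [C [FA Aj FB sC ->]]]] [A' [B' [C' [FA' Aj' FB' sC' ->]]]].
exists (fun k => A k `&` A' k), (B `&` B'), (C `&` C'); split.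
- by move=> k; exact: (sigI (FS k)).
- by rewrite Aj Aj' setIT.
- exact: (sigI F2S).
- exact: (sigI sG).
- by rewrite bigcapI setIACA (setIACA B).
Qed.

Lemma rest_setsT j : rest_sets j setT.
Proof.
exists (fun=> setT), setT, setT; split => //; [by move=> k; exact: (sigT (FS k))|exact: (sigT F2S)|exact: (sigT sG)|].
by rewrite !setIT; apply/seteqP; split.
Qed.

Lemma rest_sets_err j k A : k != j -> F k A -> rest_sets j A.
Proof.
move=> kj FA; exists (fun i => if i == k then A else setT), setT, setT; split => //.
- by move=> i; case: eqP => [->//|_]; exact: (sigT (FS i)).
- by rewrite eq_sym (negbTE kj).
- exact: (sigT F2S).
- exact: (sigT sG).
- rewrite !setIT; apply/seteqP; split => [w wA i _|w /(_ k I)]; last by rewrite eqxx.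
  by case: ifP.
Qed.

Lemma rest_sets_latent j B : F2 B -> rest_sets j B.
Proof.
move=> FB; exists (fun=> setT), B, setT; split => //; [by move=> k; exact: (sigT (FS k))|exact: (sigT sG)|].
by rewrite setIT; apply/seteqP; split => // w [].
Qed.

Lemma rest_sets_cond j C : <<s G >> C -> rest_sets j C.
Proof.
move=> sC; exists (fun=> setT), setT, C; split => //; [by move=> k; exact: (sigT (FS k))|exact: (sigT F2S)|].
by rewrite setTI; apply/seteqP; split => // w [].
Qed.

(** The j-th slot of a set in [rest_sets j] is the whole space, so [A] can be placed there. Both
    sides then expand into the same product over the errors times the probability of the latent and
    income part. *)
Lemma cond_indep_rest j A D : F j A -> rest_sets j D ->
  P (A `&` D) = (P A * P D)%E.
Proof.
move=> FA [A' [B [C [FA' A'j FB sC ->]]]].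
pose A2 k := if k == j then A else A' k.
have FA2 k : F k (A2 k) by rewrite /A2; case: eqP => // ->.
rewrite setIA (_ : A `&` \bigcap_(k in [set: J]) A' k = \bigcap_(k in [set: J]) A2 k); last first.
  apply/seteqP; split => [w [wA wA'] k _|w wA2].
    by rewrite /A2; case: eqP => // _; exact: wA'.
  split; first by have := wA2 j I; rewrite /A2 eqxx.
  by move=> k _; have := wA2 k I; rewrite /A2; case: eqP => // ->; rewrite A'j.
rewrite !cond_indep_latent//; [|exact: bigcapF1|exact: bigcapF1].
rewrite !cond_indep_mutual// muleA; congr (_ * _)%E.
rewrite (bigD1 j)//= [in RHS](bigD1 j)//= A'j probability_setT mul1e /A2 eqxx.
by congr (_ * _)%E; apply: eq_bigr => k /negbTE ->.
Qed.

(** A pi-lambda argument: for a fixed event of [U], the finite measures P(A and D) and P(A) P(D) in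
    D agree on the pi-system [rest_sets j], hence on the sigma-algebra it generates. *)
Lemma cond_indep_rv (j : J) (U V : Om -> R) :
  (forall B, measurable B -> F j (U @^-1` B)) ->
  measurable_wrt (rest_sets j) V ->
  indep_rv P U V.
Proof.
move=> FU mV A B mA mB.
have FA := FU A mA; have mUA := F1M (FF1 FA).
have sB : <<s rest_sets j >> (V @^-1` B) by have := mV measurableT B mB; rewrite setTI.
pose m1 : {measure set Om -> \bar R} := mrestr P mUA.
pose c : {nonneg R} := NngNum (fine_ge0 (measure_ge0 P (U @^-1` A))).
pose m2 : {measure set Om -> \bar R} := mscale c P.
have PE D : m2 D = (P (U @^-1` A) * P D)%E.
  by rewrite /m2/= /mscale/= fineK// fin_num_measure.
have m12 : m1 (V @^-1` B) = m2 (V @^-1` B).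
  apply: (@g_sigma_algebra_measure_unique _ R Om (rest_sets j) (@rest_sets_measurable j)
    (fun=> setT) (fun=> rest_setsT j) _ m1 m2 (@rest_sets_setI j)) => //.
  - by apply/seteqP; split => // w _; exists 0%N.
  - by move=> D DR; rewrite PE /m1/= /mrestr setIC; exact: (cond_indep_rest FA DR).
  - move=> _; rewrite /m1/= /mrestr setTI.
    by rewrite (le_lt_trans (probability_le1 P mUA))// ltry.
by rewrite -PE -m12 /m1/= /mrestr setIC.
Qed.

End ConditionalIndependence.

(** The two equations are the real and imaginary parts of (a + ib)(x + iy) = 0. This replaces
    complex division throughout. *)
Lemma rot_eq0 (R : realType) (a b x y : R) : x ^+ 2 + y ^+ 2 != 0 ->
  a * x - b * y = 0 -> a * y + b * x = 0 -> a = 0 /\ b = 0.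
Proof.
move=> xy0 e1 e2; split; apply: (mulIf xy0); rewrite mul0r.
  have -> : a * (x ^+ 2 + y ^+ 2) = (a * x - b * y) * x + (a * y + b * x) * y by ring.
  by rewrite e1 e2 !mul0r addr0.
have -> : b * (x ^+ 2 + y ^+ 2) = (a * y + b * x) * x - (a * x - b * y) * y by ring.
by rewrite e1 e2 !mul0r subr0.
Qed.

(** * Uniqueness for a linear equation between two plane curves, across isolated simple zeros *)

Section CurveUniqueness.
Context (R : realType).
Implicit Types (f df : R -> R).

Lemma derive0_eq f df (a b : R) :
  (forall t : R, a < t < b -> is_derive t 1 f (df t)) -> (forall t, a < t < b -> df t = 0) ->
  forall x y, a < x < b -> a < y < b -> f x = f y.
Proof.
move=> fdf df0.
suff H x y : a < x < b -> a < y < b -> x < y -> f x = f y.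
  by move=> x y xab yab; case: (ltgtP x y) => [/H->//|/H->//|->].
move=> /andP[ax xb] /andP[ay yb] xy.
have ab t : t \in `[x, y] -> a < t < b.
  by rewrite in_itv/= => /andP[xt ty]; rewrite (lt_le_trans ax)//= (le_lt_trans ty).
have [| |c cxy] := @MVT R f df x y xy.
- by move=> t txy; apply/fdf/ab; exact: subset_itv_oo_cc txy.
- apply: derivable_within_continuous => t /ab /fdf fdft; exact: ex_derive.
- rewrite df0 ?mul0r; last by apply: ab; exact: subset_itv_oo_cc cxy.
  by move/eqP; rewrite subr_eq0 => /eqP.
Qed.

(** As the two-sided derivative is known to exist, its value can be read off along a sequence that
    approaches [z] from one side; the sign of [s] chooses the side. *)
Lemma derive_vanishing_side f (z l s e : R) : is_derive z 1 f l -> 0 < e -> s != 0 ->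
  (forall h, 0 <= h < e -> f (z + s * h) = 0) -> l = 0.
Proof.
move=> [/cvg_ex[/= l' fl'] fl] e0 s0 f0.
have l'l : l' = l.
  rewrite -fl /derive; apply/esym.
  exact: (cvg_lim (@Rhausdorff R) fl').
rewrite -l'l {fl l'l}.
(* The shift by 2 keeps every step strictly below [e], also for n = 0. *)
pose h n := s * (e / n.+2%:R).
have h0 n : h n != 0 by rewrite mulf_neq0// mulf_neq0 ?invr_eq0 ?pnatr_eq0// gt_eqF.
have hc : h n @[n --> \oo] --> (0 : R).
  rewrite -(mulr0 s); apply: cvgM; first exact: cvg_cst.
  rewrite -(mulr0 e); apply: cvgM; first exact: cvg_cst.
  by have := @cvg_harmonic R; rewrite -(cvg_shiftS (@harmonic R)).
move/cvgr_dnbhsP : fl' => /(_ h (conj h0 hc)).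
rewrite (_ : (fun n => _) = fun=> 0); last first.
  apply/funext => n; rewrite scaler1 (addrC (h n)) /h f0; last first.
    rewrite divr_ge0 ?ltW//= ltr_pdivrMr// ltr_pMr// ltr1n//.
  have := f0 0; rewrite mulr0 addr0 lexx e0 => /(_ isT) ->.
  by rewrite subr0 scaler0.
by move=> /(cvg_lim (@Rhausdorff R)) <-; rewrite lim_cst//.
Qed.

Variables (u v u0 v0 du dv du0 dv0 : R -> R).
Hypothesis uD : forall t : R, is_derive t 1 u (du t).
Hypothesis vD : forall t : R, is_derive t 1 v (dv t).
Hypothesis u0D : forall t : R, is_derive t 1 u0 (du0 t).
Hypothesis v0D : forall t : R, is_derive t 1 v0 (dv0 t).
Hypothesis W1 : forall t, du t * u0 t - dv t * v0 t = du0 t * u t - dv0 t * v t.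
Hypothesis W2 : forall t, du t * v0 t + dv t * u0 t = du0 t * v t + dv0 t * u t.

Let n t := u0 t ^+ 2 + v0 t ^+ 2.

Let nD (t : R) : is_derive t 1 n (2 * (u0 t * du0 t + v0 t * dv0 t)).
Proof.
have u0Dt := u0D t; have v0Dt := v0D t.
apply: (is_derive_eq (is_deriveD (is_deriveM u0Dt u0Dt) (is_deriveM v0Dt v0Dt))).
by rewrite /GRing.scale/=; ring.
Qed.

Let nVD (t : R) : n t != 0 ->
   is_derive t 1 (fun t => (n t)^-1) (- (n t) ^- 2 * (2 * (u0 t * du0 t + v0 t * dv0 t))).
Proof. by move=> nt0; have := nD t => nDt; exact: (is_deriveV (f := n)). Qed.

(** [W1] and [W2] are the real and imaginary parts of f' g = g' f, for f = u + iv and g = u0 + i v0.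
    Hence the quotient f / g, whose real and imaginary parts are [p] and [q] below, has derivative
    zero wherever g does not vanish. *)
Let quotient_cst (a b : R) : (forall t, a < t < b -> n t != 0) ->
  exists c s, forall t, a < t < b -> u t = c * u0 t - s * v0 t /\ v t = c * v0 t + s * u0 t.
Proof.
move=> n0; have [ba|ab] := leP b a.
  by exists 0, 0 => t /andP[/lt_trans /[apply]]; rewrite ltNge ba.
pose m := (a + b) / 2.
have mab : a < m < b by rewrite /m; apply/andP; split; lra.
pose p t := (u t * u0 t + v t * v0 t) * (n t)^-1.
pose q t := (v t * u0 t - u t * v0 t) * (n t)^-1.
have pE t : a < t < b -> p t = p m.
  move=> tab; apply: (derive0_eq (df := fun t => (u t * u0 t + v t * v0 t) * (- (n t) ^- 2 *
     (2 * (u0 t * du0 t + v0 t * dv0 t))) + (n t)^-1 *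
     (du t * u0 t + u t * du0 t + (dv t * v0 t + v t * dv0 t)))) tab mab.
    move=> {}t /n0 /nVD niDt.
    apply: (is_derive_eq (is_deriveM (is_deriveD (is_deriveM (uD t) (u0D t))
      (is_deriveM (vD t) (v0D t))) niDt)).
    by rewrite !fctE /GRing.scale/=; ring.
  move=> {}t /n0; rewrite /n => nt0.
  (* Real part of (f' g - g' f) times the squared conjugate of g, over the fourth power of its
     modulus; the imaginary part is treated below in the same way. *)
  rewrite [LHS](_ : _ = ((u0 t ^+ 2 - v0 t ^+ 2) *
      ((du t * u0 t - dv t * v0 t) - (du0 t * u t - dv0 t * v t)) +
      2 * u0 t * v0 t * ((du t * v0 t + dv t * u0 t) - (du0 t * v t + dv0 t * u t)))
      / (u0 t ^+ 2 + v0 t ^+ 2) ^+ 2); last by field.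
  by rewrite W1 W2 !subrr !mulr0 addr0 mul0r.
have qE t : a < t < b -> q t = q m.
  move=> tab; apply: (derive0_eq (df := fun t => (v t * u0 t - u t * v0 t) * (- (n t) ^- 2 *
     (2 * (u0 t * du0 t + v0 t * dv0 t))) + (n t)^-1 *
     (dv t * u0 t + v t * du0 t - (du t * v0 t + u t * dv0 t)))) tab mab.
    move=> {}t /n0 /nVD niDt.
    apply: (is_derive_eq (is_deriveM (is_deriveB (is_deriveM (vD t) (u0D t))
      (is_deriveM (uD t) (v0D t))) niDt)).
    by rewrite !fctE /GRing.scale/=; ring.
  move=> {}t /n0; rewrite /n => nt0.
  rewrite [LHS](_ : _ = (- (2 * u0 t * v0 t) *
      ((du t * u0 t - dv t * v0 t) - (du0 t * u t - dv0 t * v t)) +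
      (u0 t ^+ 2 - v0 t ^+ 2) * ((du t * v0 t + dv t * u0 t) - (du0 t * v t + dv0 t * u t)))
      / (u0 t ^+ 2 + v0 t ^+ 2) ^+ 2); last by field.
  by rewrite W1 W2 !subrr !mulr0 addr0 mul0r.
exists (p m), (q m) => t tab; rewrite -(pE t tab) -(qE t tab) /p /q.
by have := n0 t tab; rewrite /n => nt0; split; field.
Qed.

Hypothesis init : u 0 = u0 0 /\ v 0 = v0 0.
Hypothesis n_at0 : n 0 != 0.
Hypothesis zeros_isolated : forall z, n z = 0 ->
  exists2 e, 0 < e & forall t, 0 < `|t - z| < e -> n t != 0.
Hypothesis zeros_simple : forall z, n z = 0 -> du0 z ^+ 2 + dv0 z ^+ 2 != 0.

Let n_eq0 t : n t = 0 -> u0 t = 0 /\ v0 t = 0.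
Proof.
by rewrite /n => /eqP; rewrite paddr_eq0 ?sqr_ge0// !sqrf_eq0 => /andP[/eqP-> /eqP->].
Qed.

Let quotient_cst1 (a b y : R) : (forall t, a < t < b -> n t != 0) -> a < y < b ->
  u y = u0 y -> v y = v0 y ->
  forall t, a < t < b -> u t = u0 t /\ v t = v0 t.
Proof.
move=> n0 yab uy vy t tab; have [c [s cs]] := quotient_cst n0.
have [uyE vyE] := cs y yab; have [-> ->] := cs t tab.
have [] := @rot_eq0 R (c - 1) s _ _ (n0 y yab).
- by rewrite uy in uyE; lra.
- by rewrite vy in vyE; lra.
by move=> /eqP; rewrite subr_eq0 => /eqP -> ->; rewrite !mul1r !mul0r subr0 addr0.
Qed.

(** Both curves vanish at [z], so the difference between one and the constant multiple of the other
    vanishes on a closed one-sided interval, and so does its derivative at [z]. The sign [s] selects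
    the side. *)
Let quotient_derive (z e s : R) : s ^+ 2 = 1 -> 0 < e -> n z = 0 -> u z = 0 -> v z = 0 ->
  forall c k, (forall h, 0 < h < e -> u (z + s * h) = c * u0 (z + s * h) - k * v0 (z + s * h) /\
     v (z + s * h) = c * v0 (z + s * h) + k * u0 (z + s * h)) ->
  du z = c * du0 z - k * dv0 z /\ dv z = c * dv0 z + k * du0 z.
Proof.
move=> s1 e0 /n_eq0[u0z v0z] uz vz c k uv.
have s0 : s != 0 by rewrite -sqrf_eq0 s1 oner_eq0.
split; apply/eqP; rewrite -subr_eq0; apply/eqP.
  have D : is_derive z 1 (u - (c *: u0 - k *: v0)) (du z - (c * du0 z - k * dv0 z)).
    exact: (is_deriveB (uD z) (is_deriveB (is_deriveZ c (u0D z)) (is_deriveZ k (v0D z)))).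
  apply: (derive_vanishing_side D e0 s0).
  move=> h /andP[]; rewrite le_eqVlt => /predU1P[<- _|h0 he].
    by rewrite mulr0 addr0 !fctE /= uz u0z v0z !scaler0 !subr0.
  have /uv[uE _] : 0 < h < e by rewrite h0.
  by rewrite !fctE/= uE /GRing.scale/=; ring.
have D : is_derive z 1 (v - (c *: v0 + k *: u0)) (dv z - (c * dv0 z + k * du0 z)).
  exact: (is_deriveB (vD z) (is_deriveD (is_deriveZ c (v0D z)) (is_deriveZ k (u0D z)))).
apply: (derive_vanishing_side D e0 s0).
move=> h /andP[]; rewrite le_eqVlt => /predU1P[<- _|h0 he].
  by rewrite mulr0 addr0 !fctE /= vz u0z v0z !scaler0 addr0 subr0.
have /uv[_ vE] : 0 < h < e by rewrite h0.
by rewrite !fctE/= vE /GRing.scale/=; ring.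
Qed.

(* The quotient (u + iv) / (u0 + iv0) is locally constant off the zeros of
   u0 + iv0. Its values on the two sides of a zero both equal the quotient of
   the derivatives there, so that it cannot jump. *)
Lemma curve_unique t : u t = u0 t /\ v t = v0 t.
Proof.
have cont f df : (forall t : R, is_derive t 1 f (df t)) -> continuous f.
  move=> fD x; apply/differentiable_continuous/derivable1_diffP.
  by have := fD x => fDx; exact: ex_derive.
have cu := cont _ _ uD; have cv := cont _ _ vD.
have cu0 := cont _ _ u0D; have cv0 := cont _ _ v0D.
pose Eq := [set t | u t = u0 t] `&` [set t | v t = v0 t].
have closed_eqf (f g : R -> R) : continuous f -> continuous g -> closed [set t | f t = g t].
  move=> cf cg; rewrite (_ : [set t | f t = g t] = (fun t => f t - g t) @^-1` [set 0]).
    apply: closed_comp => [x _|]; last exact: closed_eq.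
    by apply: cvgB; [exact: cf|exact: cg].
  by apply/seteqP; split => x /= /eqP => [|]; [rewrite -subr_eq0|rewrite subr_eq0] => /eqP.
have cEq : closed Eq by apply: closedI; exact: closed_eqf.
have nz (z : R) : n z != 0 -> exists2 e, 0 < e & forall t, `|t - z| < e -> n t != 0.
  move=> nz0.
  have nc : {for z, continuous n} by exact: (cont n _ nD).
  have /nbhs_ballP[e /= e0 eP] : \forall x \near z, n x != 0 by exact: cvgr_neq0 nc nz0.
  by exists e => // x xz; apply: eP; rewrite /ball/= distrC.
have ballE (x y e : R) : `|x - y| < e = (y - e < x < y + e) by rewrite ltr_distl.
have EqP (z e y : R) : 0 < e -> `|y - z| < e -> u y = u0 y -> v y = v0 y ->
    (forall t, `|t - z| < e -> n t != 0) -> Eq° z.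
  move=> e0 yz uy vy ne; apply/nbhs_ballP; exists e => //= x; rewrite /ball/= distrC => xz.
  apply: (@quotient_cst1 (z - e) (z + e) y) => //; rewrite -?ballE//.
  by move=> w; rewrite -ballE; exact: ne.
(* The interior of the coincidence set is open and contains 0. Once it is known to be closed,
   connectedness makes it the whole line; the only delicate limit points are the zeros of the second
   curve. *)
have clopen : closed Eq°.
  move=> z zE.
  have [/= uz vz] : Eq z by apply: cEq; move=> B /zE [y [/interior_subset Ey By]]; exists y.
  have [nz0|/eqP nz0] := eqVneq (n z) 0; last first.
    have [e e0 ne] := nz z (introN eqP nz0).
    by apply: (EqP z e z); rewrite // subrr normr0.
  have [e e0 ne] := zeros_isolated nz0.
  have [u0z v0z] := n_eq0 nz0.
  rewrite u0z in uz; rewrite v0z in vz.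
  have neR x : z < x < z + e -> n x != 0.
    by move=> /andP[zt te]; apply: ne; rewrite ltr_distl normr_gt0 subr_eq0; apply/and3P; split; lra.
  have neL x : z - e < x < z -> n x != 0.
    by move=> /andP[zt te]; apply: ne; rewrite ltr_distl normr_gt0 subr_eq0; apply/and3P; split; lra.
  have [cR [kR R_]] := quotient_cst neR; have [cL [kL L_]] := quotient_cst neL.
  have [duR dvR] : du z = cR * du0 z - kR * dv0 z /\ dv z = cR * dv0 z + kR * du0 z.
    apply: (@quotient_derive z e 1) => //; first by rewrite expr1n.
    by move=> h /andP[h0 he]; apply: R_; rewrite mul1r; apply/andP; split; lra.
  have [duL dvL] : du z = cL * du0 z - kL * dv0 z /\ dv z = cL * dv0 z + kL * du0 z.
    apply: (@quotient_derive z e (-1)) => //; first by rewrite sqrrN expr1n.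
    by move=> h /andP[h0 he]; apply: L_; rewrite mulN1r; apply/andP; split; lra.
  have [] := @rot_eq0 R (cR - cL) (kR - kL) _ _ (zeros_simple nz0); [lra|lra|].
  move=> /eqP; rewrite subr_eq0 => /eqP cRL /eqP; rewrite subr_eq0 => /eqP kRL.
  (* The constants on the two sides agree by now. A coincidence point near [z], other than [z]
     itself, forces their common value to be 1. *)
  have [y [Ey yz]] := zE (ball z e) (nbhsx_ballx z e e0).
  have [<-//|yz'] := eqVneq y z.
  have [/= uy vy] : Eq y by exact: interior_subset Ey.
  rewrite /ball/= distrC in yz.
  have ny : n y != 0 by apply: ne; rewrite normr_gt0 subr_eq0 yz'.
  have [uyE vyE] : u y = cR * u0 y - kR * v0 y /\ v y = cR * v0 y + kR * u0 y.
    move: yz; rewrite ballE => /andP[ey ye].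
    case: (ltgtP y z) yz' => // yz _; last by apply: R_; rewrite yz.
    by rewrite cRL kRL; apply: L_; rewrite yz andbT.
  rewrite uy in uyE; rewrite vy in vyE.
  have [] := @rot_eq0 R (cR - 1) kR _ _ ny; [lra|lra|].
  move=> /eqP; rewrite subr_eq0 => /eqP cR1 kR0.
  rewrite /interior/=; apply/nbhs_ballP; exists e => //= x; rewrite /ball/= distrC ballE => /andP[ex xe].
  suff [ux vx] : u x = u0 x /\ v x = v0 x by [].
  case: (ltgtP x z) => [xz|xz|->]; last by rewrite uz vz u0z v0z.
    have [|-> ->] := L_ x; first by rewrite ex.
    by rewrite -cRL -kRL cR1 kR0 !mul1r !mul0r subr0 addr0.
  have [|-> ->] := R_ x; first by rewrite xz.
  by rewrite cR1 kR0 !mul1r !mul0r subr0 addr0.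
have E0 : Eq° 0.
  have [u_0 v_0] := init.
  have [e e0 ne] := nz 0 n_at0.
  by apply: (EqP 0 e 0); rewrite // subrr normr0.
have cT : connected (setT : set R) by apply/connected_intervalP.
have EqT : Eq° = setT.
  apply: cT; first by exists 0.
    by exists Eq°; rewrite ?setTI//; exact: open_interior.
  by exists Eq°; rewrite ?setTI.
by have /interior_subset[] : Eq° t by rewrite EqT.
Qed.

End CurveUniqueness.

Lemma measurable_cosR (R : realType) : measurable_fun setT (@cos R).
Proof. by apply: continuous_measurable_fun; exact: continuous_cos. Qed.

(** * Weighted characteristic functions as real cosine integrals *)

Section Oscillation.
Context (R : realType) (d : measure_display) (Om : measurableType d).
Variable P : probability Om R.
Implicit Types (V X e : Om -> R) (a b s t : R).

(* The real and imaginary parts of E[V exp(isX)] are osc V X 0 s and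
   osc V X (- (pi / 2)) s. *)
Definition osc V X b s : R := \int[P]_w (V w * cos (s * X w + b)).

Lemma cos_le1 (x : R) : `|cos x| <= 1.
Proof. exact: cos_max. Qed.

Lemma cosB_pihalf (x : R) : cos (x - pi / 2) = sin x.
Proof. by rewrite cosB cos_pihalf sin_pihalf mulr0 mulr1 add0r. Qed.

Lemma cosD_pihalf (x : R) : cos (x + pi / 2) = - sin x.
Proof. by rewrite cosD cos_pihalf sin_pihalf mulr0 mulr1 sub0r. Qed.

Lemma measurable_cos_affine X a b : measurable_fun setT X ->
  measurable_fun setT (fun w => cos (a * X w + b)).
Proof.
move=> mX; apply: (measurableT_comp (@measurable_cosR R)).
by apply: measurable_funD => //; apply: measurable_funM.
Qed.

Lemma L1_osc V X a b : L1 P V -> measurable_fun setT X ->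
  L1 P (fun w => V w * cos (a * X w + b)).
Proof.
move=> LV mX; apply: (@L1M _ _ _ _ _ _ 1) => //; first exact: measurable_cos_affine.
by move=> w; exact: cos_le1.
Qed.

Lemma osc_continuous V X b : L1 P V -> measurable_fun setT X -> continuous (osc V X b).
Proof.
move=> LV mX s.
have sI : s \in `]s - 1, s + 1[%classic.
  by rewrite inE/= in_itv/=; apply/andP; split; lra.
apply: (@continuity_under_integral R d Om P (fun s w => V w * cos (s * X w + b))
  setT measurableT (s - 1) (s + 1) _ _ (fun w => `|V w|)) sI.
- by move=> x _; exact: L1_osc.
- apply: aeW => w _ x _; apply: cvgM; first exact: cvg_cst.
  apply: continuous_comp; last exact: continuous_cos.
  by apply: cvgD; [apply: cvgM; [exact: cvg_id|exact: cvg_cst]|exact: cvg_cst].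
- exact: L1_norm.
- move=> x _; apply: aeW => w _; rewrite normrM ler_piMr//; exact: cos_le1.
Qed.

(** Differentiation under the integral, dominated by |V X|. A phase [b] in [osc] keeps the family
    closed under differentiation: the derivative of a cosine is the cosine shifted by pi / 2. *)
Lemma osc_derive V X b s : L1 P V -> L1 P (fun w => V w * X w) -> measurable_fun setT X ->
  is_derive s 1 (osc V X b) (osc (fun w => V w * X w) X (b + pi / 2) s).
Proof.
move=> LV LVX mX.
pose f s w := V w * cos (s * X w + b).
have fD (t : R) w : is_derive t 1 (f ^~ w) (V w * X w * cos (t * X w + (b + pi / 2))).
  have D1 : is_derive t 1 (fun t => t * X w + b) (X w).
    apply: (is_derive_eq (is_deriveD (is_deriveM (is_derive_id t (1 : R)) (is_derive_cst (X w) t (1 : R)))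
      (is_derive_cst b t (1 : R)))).
    by rewrite /GRing.scale/=; ring.
  have D2 := is_derive1_comp (is_derive_cos ((fun t => t * X w + b) t)) D1.
  apply: (is_derive_eq (is_deriveM (is_derive_cst (V w) t (1 : R)) D2)).
  by rewrite addrA cosD_pihalf /GRing.scale/=; ring.
have f1 t w : partial1of2 f t w = V w * X w * cos (t * X w + (b + pi / 2)).
  by rewrite partial1of2E; have := fD t w => fDtw; rewrite derive_val.
have sI : `]s - 1, s + 1[%classic s by rewrite /= in_itv/=; apply/andP; split; lra.
have If x : `]s - 1, s + 1[%classic x -> P.-integrable setT (EFin \o f x).
  by move=> _; exact: L1_osc.
have Df x y : `]s - 1, s + 1[%classic x -> setT y -> derivable (f ^~ y) x 1.
  by move=> _ _; have := fD x y => fDxy; exact: ex_derive.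
have Gf x y : `]s - 1, s + 1[%classic x -> setT y -> `|partial1of2 f x y| <= `|V y * X y|.
  by move=> _ _; rewrite f1 normrM ler_piMr//; exact: cos_le1.
have E : osc (fun w => V w * X w) X (b + pi / 2) s = \int[P]_y partial1of2 f s y.
  by apply: eq_Rintegral => w _; rewrite f1.
apply: DeriveDef.
  exact: (@derivable_under_integral R d Om P f setT measurableT s (s - 1) (s + 1) sI If Df
    (fun w => `|V w * X w|) _ (L1_norm LVX) Gf).
have := @differentiation_under_integral R d Om P f setT measurableT s (s - 1) (s + 1) sI If Df
    (fun w => `|V w * X w|) _ (L1_norm LVX) Gf.
by rewrite derive1E E => ->.
Qed.

Lemma char_funE X t : char_fun P X t = (osc (fun=> 1) X 0 t +i* osc (fun=> 1) X (- (pi / 2)) t)%C.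
Proof.
rewrite /char_fun !expectationE; congr (_ +i* _)%C; apply: eq_Rintegral => w _.
  by rewrite mul1r addr0.
by rewrite mul1r cosB_pihalf.
Qed.

Definition indep_of e (S : set (set Om)) := forall V,
  measurable_wrt S V -> indep_rv P e V.

Lemma indep_rv_comp e V (f : R -> R) : measurable_fun setT f -> indep_rv P e V ->
  indep_rv P (f \o e) V.
Proof.
move=> mf eV A B mA mB; rewrite comp_preimage; apply: eV => //.
by have := mf measurableT A mA; rewrite setTI.
Qed.

Lemma indep_of_expect e S (f : R -> R) V : indep_of e S -> measurable_fun setT f ->
  L1 P (f \o e) -> measurable_wrt S V -> L1 P V ->
  L1 P (fun w => f (e w) * V w) /\
  \int[P]_w (f (e w) * V w) = \int[P]_w f (e w) * \int[P]_w V w.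
Proof.
move=> eS mf Lf mV LV; apply: (indep_rv_expect (U := f \o e)) => //.
by apply: indep_rv_comp => //; exact: eS.
Qed.

(** The addition formula splits the cosine of a sum into products of a function of [e] and an
    [S]-measurable function; independence factors each of them. This is the real part of a product
    of complex expectations. *)
Lemma osc_indep e S (g : R -> R) V (T : Om -> R) a :
  measurable_fun setT e -> indep_of e S -> measurable_fun setT g -> L1 P (g \o e) ->
  measurable_wrt S V -> L1 P V ->
  measurable_wrt S T -> measurable_fun setT T ->
  L1 P (fun w => g (e w) * V w * cos (a * e w + T w)) /\
  \int[P]_w (g (e w) * V w * cos (a * e w + T w)) =
    osc (g \o e) e 0 a * \int[P]_w (V w * cos (T w))
    - osc (g \o e) e (- (pi / 2)) a * \int[P]_w (V w * sin (T w)).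
Proof.
move=> me eS mg Lg mV LV mT mT'.
have L c : L1 P (fun w => V w * cos (1 * T w + c)) by exact: L1_osc.
have Le c : L1 P (fun w => g (e w) * cos (a * e w + c)) by exact: L1_osc.
have H c k : L1 P (fun w => g (e w) * cos (a * e w + c) * (V w * cos (1 * T w + k))) /\
    \int[P]_w (g (e w) * cos (a * e w + c) * (V w * cos (1 * T w + k))) =
    osc (g \o e) e c a * \int[P]_w (V w * cos (1 * T w + k)).
  apply: (indep_of_expect (f := fun x => g x * cos (a * x + c)) eS) => //.
  - apply: measurable_funM => //; apply: (measurableT_comp (@measurable_cosR R)).
    by apply: measurable_funD => //; exact: measurable_funM.
  - exact: Le.
  - apply: (@measurable_funM _ (g_sigma_algebraType S) R setT V (fun w => cos (1 * T w + k))) => //.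
    apply: (measurableT_comp (@measurable_cosR R)).
    by apply: measurable_funD => //; exact: measurable_funM.
have [L0 E0] := H 0 0; have [L1_ E1] := H (- (pi / 2)) (- (pi / 2)).
have -> : \int[P]_w (V w * cos (T w)) = \int[P]_w (V w * cos (1 * T w + 0)).
  by apply: eq_Rintegral => w _; rewrite mul1r addr0.
have -> : \int[P]_w (V w * sin (T w)) = \int[P]_w (V w * cos (1 * T w - pi / 2)).
  by apply: eq_Rintegral => w _; rewrite mul1r cosB_pihalf.
have E : (fun w => g (e w) * V w * cos (a * e w + T w)) = (fun w =>
    g (e w) * cos (a * e w + 0) * (V w * cos (1 * T w + 0)) -
    g (e w) * cos (a * e w - pi / 2) * (V w * cos (1 * T w - pi / 2))).
  by apply/funext => w; rewrite !mul1r !addr0 !cosB_pihalf cosD; ring.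
by rewrite E -E0 -E1; split; [exact: L1B|exact: expectB].
Qed.

End Oscillation.

(** * Observable moments of two measurements of one latent *)

Section RepeatedMeasurement.
Context (R : realType) (d : measure_display) (Om : measurableType d).
Variables (P : probability Om R) (X e1 e2 : Om -> R) (S1 S2 : set (set Om)).
Hypothesis LX : L1 P X.
Hypothesis Le1 : L1 P e1.
Hypothesis me2 : measurable_fun setT e2.
Hypothesis e1S1 : indep_of P e1 S1.
Hypothesis e2S2 : indep_of P e2 S2.
Hypothesis XS1 : measurable_wrt S1 X.
Hypothesis e2S1 : measurable_wrt S1 e2.
Hypothesis XS2 : measurable_wrt S2 X.

Let me1 : measurable_fun setT e1. Proof. exact: L1_measurable Le1. Qed.

Let mcst k (S : set (set Om)) : measurable_fun setT ((fun=> k : R) : g_sigma_algebraType S -> R).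
Proof. exact: measurable_cst. Qed.

Let mT r c : measurable_fun setT ((fun w => r * e2 w + c) : g_sigma_algebraType S1 -> R).
Proof. by apply: measurable_funD => //; exact: measurable_funM. Qed.

Let mT' r c : measurable_fun setT (fun w => r * e2 w + c).
Proof. by apply: measurable_funD => //; exact: measurable_funM. Qed.

Let sinE (x : R) : sin x = cos (x - pi / 2). Proof. by rewrite cosB_pihalf. Qed.

Let c1 a b := osc P (fun=> 1) e1 b a.
Let c2 a b := osc P (fun=> 1) e2 b a.
Let d1 a b := osc P e1 e1 b a.

(* The contrast Z2 - la Z1 = e2 - la e1 does not involve X, hence its
   characteristic function, and the one weighted by Z1 = X + e1, only involve
   E[X], the characteristic functions of e1 and e2, and the derivative of the
   former. *)
Lemma contrast_cos la r b : \int[P]_w cos (r * (e2 w - la * e1 w) + b) =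
  c1 (- la * r) 0 * c2 r b - c1 (- la * r) (- (pi / 2)) * c2 r (b - pi / 2).
Proof.
have [_] := @osc_indep R d Om P e1 S1 (fun=> 1) (fun=> 1) (fun w => r * e2 w + b) (- la * r)
  me1 e1S1 (measurable_cst _) (L1_cst P 1) (@mcst 1 S1) (L1_cst P 1) (mT r b) (mT' r b).
under eq_Rintegral do rewrite !mul1r.
rewrite (_ : (fun w => cos (- la * r * e1 w + (r * e2 w + b))) =
   (fun w => cos (r * (e2 w - la * e1 w) + b))); last by apply/funext => w; congr cos; ring.
move=> ->; congr (_ * _ - _ * _); apply: eq_Rintegral => w _.
by rewrite sinE addrA.
Qed.

Lemma weighted_contrast_cos la r b :
  \int[P]_w ((X w + e1 w) * cos (r * (e2 w - la * e1 w) + b)) =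
  (\int[P]_w X w) * (\int[P]_w cos (r * (e2 w - la * e1 w) + b)) +
  (d1 (- la * r) 0 * c2 r b - d1 (- la * r) (- (pi / 2)) * c2 r (b - pi / 2)).
Proof.
have [LA EA] := @osc_indep R d Om P e1 S1 (fun=> 1) X (fun w => r * e2 w + b) (- la * r)
  me1 e1S1 (measurable_cst _) (L1_cst P 1) XS1 LX (mT r b) (mT' r b).
have [LB EB] := @osc_indep R d Om P e1 S1 id (fun=> 1) (fun w => r * e2 w + b) (- la * r)
  me1 e1S1 (@measurable_id _ _ setT) Le1 (@mcst 1 S1) (L1_cst P 1) (mT r b) (mT' r b).
(* A second use of independence, of [e2] from [X] this time, which reduces the latent to its
   mean. *)
have XT c : \int[P]_w (X w * cos (r * e2 w + c)) = (\int[P]_w X w) * c2 r c.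
  have H k := @osc_indep R d Om P e2 S2 (fun=> 1) X (fun=> k) r
    me2 e2S2 (measurable_cst _) (L1_cst P 1) XS2 LX (@mcst k S2) (measurable_cst _).
  have [_ E] := H c.
  have [_ E'] := @osc_indep R d Om P e2 S2 (fun=> 1) (fun=> 1) (fun=> c) r
    me2 e2S2 (measurable_cst _) (L1_cst P 1) (@mcst 1 S2) (L1_cst P 1) (@mcst c S2) (measurable_cst _).
  transitivity (\int[P]_w (1 * X w * cos (r * e2 w + c))).
    by apply: eq_Rintegral => w _; rewrite !mul1r.
  rewrite E /c2 /osc.
  rewrite (_ : \int[P]_w (1 * cos (r * e2 w + c)) = \int[P]_w (1 * 1 * cos (r * e2 w + c))); last first.
    by apply: eq_Rintegral => w _; rewrite !mul1r.
  rewrite E' !RintegralZr//; try exact: L1_cst.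
  by rewrite !expect_cst /osc; ring.
have -> : (fun w => (X w + e1 w) * cos (r * (e2 w - la * e1 w) + b)) =
    (fun w => 1 * X w * cos (- la * r * e1 w + (r * e2 w + b)) +
      id (e1 w) * 1 * cos (- la * r * e1 w + (r * e2 w + b))).
  apply/funext => w; rewrite mul1r mulr1 -mulrDl; congr (_ * cos _); ring.
rewrite expectD// EA EB contrast_cos.
under [X in _ - _ * X + _]eq_Rintegral do rewrite sinE -addrA.
rewrite !XT /c1 /d1 /c2.
have -> : \int[P]_w (1 * sin (r * e2 w + b)) = osc P (fun=> 1) e2 (b - pi / 2) r.
  by apply: eq_Rintegral => w _; rewrite sinE addrA.
rewrite /osc /comp/=; ring.
Qed.

End RepeatedMeasurement.

(** * Zeros of the characteristic function of an error *)

Section RegularZeros.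
Context (R : realType) (d : measure_display) (Om : measurableType d).
Variables (P : probability Om R) (e : Om -> R).
Hypothesis Le : L1 P e.
Hypothesis regular : regular_zeros (char_fun P e).

Let me : measurable_fun setT e. Proof. exact: L1_measurable Le. Qed.

Definition char_norm2 t : R := osc P (fun=> 1) e 0 t ^+ 2 + osc P (fun=> 1) e (- (pi / 2)) t ^+ 2.

Lemma char_norm2_eq0 t : char_norm2 t = 0 <-> char_fun P e t = 0.
Proof.
rewrite char_funE /char_norm2; split => [/eqP|[-> ->]]; last by rewrite expr0n addr0.
by rewrite paddr_eq0 ?sqr_ge0// !sqrf_eq0 => /andP[/eqP-> /eqP->].
Qed.

Lemma char_norm2_0 : char_norm2 0 = 1.
Proof.
rewrite /char_norm2 /osc.
under eq_Rintegral do rewrite mul0r addr0 mul1r cos0.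
under [X in _ + X ^+ 2]eq_Rintegral do rewrite mul0r mul1r cosB_pihalf sin0.
by rewrite !expect_cst expr0n expr1n addr0.
Qed.

Lemma char_norm2_continuous : continuous char_norm2.
Proof.
by move=> t; apply: cvgD; apply: cvgM; apply: osc_continuous => //; exact: L1_cst.
Qed.

(** At a zero this is isolation, elsewhere continuity. It allows identities obtained off the zeros
    to be extended by continuity. *)
Lemma char_norm2_near s : \forall t \near s^', char_norm2 t != 0.
Proof.
have [s0|s0] := eqVneq (char_norm2 s) 0; last first.
  by apply: cvg_within; exact: cvgr_neq0 (@char_norm2_continuous s) s0.
have [/(_ s (proj1 (char_norm2_eq0 s) s0)) [_ [V Vs VZ]] _] := regular.
rewrite near_withinE; apply: filterS Vs => t Vt ts; apply/eqP => /char_norm2_eq0 nt.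
have : (V `&` [set s | char_fun P e s = 0]) t by [].
by rewrite VZ => /= tE; rewrite tE eqxx in ts.
Qed.

Lemma char_norm2_isolated z : exists2 r, 0 < r &
  forall t, 0 < `|t - z| < r -> char_norm2 t != 0.
Proof.
have := char_norm2_near z; rewrite near_withinE => /nbhs_ballP[r /= r0 rP].
exists r => // t /andP[tz tr]; apply: rP; rewrite ?/ball/= 1?distrC//.
by rewrite -subr_eq0 -normr_gt0.
Qed.

Lemma char_derivative : L1 P (fun w => 1 * e w) /\ forall b (t : R),
  is_derive t 1 (osc P (fun=> 1) e b) (osc P e e (b + pi / 2) t).
Proof.
have L1e : L1 P (fun w => 1 * e w) by under eq_fun do rewrite mul1r.
split=> // b t; have := osc_derive b t (L1_cst P 1) L1e me.
rewrite (_ : (fun w => 1 * e w) = e)//.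
by apply/funext => w; rewrite mul1r.
Qed.

(** The clause on derivatives in [regular_zeros] is applied at order 1, where its differentiability
    premise follows from integrability of the error. *)
Lemma char_simple z : char_norm2 z = 0 ->
  osc P e e (0 + pi / 2) z ^+ 2 + osc P e e (- (pi / 2) + pi / 2) z ^+ 2 != 0.
Proof.
move=> /char_norm2_eq0 z0; have [_ D] := char_derivative.
have reE : re_part (char_fun P e) = osc P (fun=> 1) e 0.
  by apply/funext => t; rewrite /re_part char_funE.
have imE : im_part (char_fun P e) = osc P (fun=> 1) e (- (pi / 2)).
  by apply/funext => t; rewrite /im_part char_funE.
have [_ /(_ 1%N isT _ z z0)] := regular.
have H : times_derivable 1 (char_fun P e).
  move=> j; rewrite ltnS leqn0 => /eqP -> t; rewrite reE imE; split.
    by have := D 0 t => D0; exact: ex_derive.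
  by have := D (- (pi / 2)) t => D0; exact: ex_derive.
move=> /(_ H); rewrite /cderive reE imE !derive1n1 !derive1E.
have := D 0 z => D0; have := D (- (pi / 2)) z => D1.
rewrite !derive_val; apply: contra_neq => /eqP.
by rewrite paddr_eq0 ?sqr_ge0// !sqrf_eq0 => /andP[/eqP-> /eqP->].
Qed.

End RegularZeros.

Lemma continuous_dnbhs_eq0 (R : realType) (f : R -> R) s : {for s, continuous f} ->
  (\forall t \near s^', f t = 0) -> f s = 0.
Proof.
move=> cf f0; apply: (@cvg_unique _ (@Rhausdorff R) (f @ s^')).
  by apply: cvg_trans cf; apply: cvg_app; exact: cvg_within.
have : (fun=> 0 : R) @ s^' --> (0 : R) by exact: cvg_cst.
by apply: cvg_trans; apply: near_eq_cvg; apply: filterS f0 => t ->.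
Qed.

(** * The law of the first measurement error is determined *)

Section ErrorLaw.
Context (R : realType).
Context (d : measure_display) (Om : measurableType d) (P : probability Om R).
Context (d' : measure_display) (Om' : measurableType d') (P' : probability Om' R).
Variables (X e1 e2 : Om -> R) (S1 S2 : set (set Om)).
Variables (X' e1' e2' : Om' -> R) (S1' S2' : set (set Om')).
Hypotheses (LX : L1 P X) (LX' : L1 P' X') (Le1 : L1 P e1) (Le1' : L1 P' e1').
Hypotheses (Le2 : L1 P e2) (Le2' : L1 P' e2').
Hypotheses (e1S1 : indep_of P e1 S1) (e1S1' : indep_of P' e1' S1').
Hypotheses (e2S2 : indep_of P e2 S2) (e2S2' : indep_of P' e2' S2').
Hypothesis XS1 : measurable_wrt S1 X.
Hypothesis XS1' : measurable_wrt S1' X'.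
Hypothesis e2S1 : measurable_wrt S1 e2.
Hypothesis e2S1' : measurable_wrt S1' e2'.
Hypothesis XS2 : measurable_wrt S2 X.
Hypothesis XS2' : measurable_wrt S2' X'.
Hypothesis reg1' : regular_zeros (char_fun P' e1').
Hypothesis reg2 : regular_zeros (char_fun P e2).
Hypothesis reg2' : regular_zeros (char_fun P' e2').
Variable la : R.
Hypothesis la0 : la != 0.
Hypothesis EX : \int[P]_w X w = \int[P']_w X' w.
Hypothesis A_obs : forall r b,
  \int[P]_w cos (r * (e2 w - la * e1 w) + b) = \int[P']_w cos (r * (e2' w - la * e1' w) + b).
Hypothesis B_obs : forall r b,
  \int[P]_w ((X w + e1 w) * cos (r * (e2 w - la * e1 w) + b)) =
  \int[P']_w ((X' w + e1' w) * cos (r * (e2' w - la * e1' w) + b)).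

Let me1 := L1_measurable Le1.
Let me2 := L1_measurable Le2.
Let me1' := L1_measurable Le1'.
Let me2' := L1_measurable Le2'.

Let h : R := - (pi / 2).
Let u := osc P (fun=> 1) e1 0.
Let v := osc P (fun=> 1) e1 h.
Let u' := osc P' (fun=> 1) e1' 0.
Let v' := osc P' (fun=> 1) e1' h.
Let D0 := osc P e1 e1 0.
Let D1 := osc P e1 e1 h.
Let D0' := osc P' e1' e1' 0.
Let D1' := osc P' e1' e1' h.
Let p := osc P (fun=> 1) e2 0.
Let q := osc P (fun=> 1) e2 h.
Let p' := osc P' (fun=> 1) e2' 0.
Let q' := osc P' (fun=> 1) e2' h.

Let osc_pi d0 (Om0 : measurableType d0) (P0 : probability Om0 R) (V Z : Om0 -> R) r :
  L1 P0 V -> measurable_fun setT Z -> osc P0 V Z (h - pi / 2) r = - osc P0 V Z 0 r.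
Proof.
move=> LV mZ; rewrite -[RHS]mulN1r /osc -expectZ; last exact: L1_osc.
apply: eq_Rintegral => w _; rewrite /h.
have -> : r * Z w + (- (pi / 2) - pi / 2) = r * Z w + 0 - pi by field.
by rewrite cosB cospi sinpi; ring.
Qed.

(** Real and imaginary parts of two complex equations: the contrast formulas of the two structures,
    unweighted and weighted. In the weighted one, the terms in the mean of the latent cancel by [EX]
    and [A_obs]. *)
Let obs_eqs r : [/\ u (- la * r) * p r - v (- la * r) * q r = u' (- la * r) * p' r - v' (- la * r) * q' r,
  u (- la * r) * q r + v (- la * r) * p r = u' (- la * r) * q' r + v' (- la * r) * p' r,
  D0 (- la * r) * p r - D1 (- la * r) * q r = D0' (- la * r) * p' r - D1' (- la * r) * q' r &
  D0 (- la * r) * q r + D1 (- la * r) * p r = D0' (- la * r) * q' r + D1' (- la * r) * p' r].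
Proof.
have A b := contrast_cos Le1 me2 e1S1 e2S1 la r b.
have A' b := contrast_cos Le1' me2' e1S1' e2S1' la r b.
have B b := weighted_contrast_cos LX Le1 me2 e1S1 e2S2 XS1 e2S1 XS2 la r b.
have B' b := weighted_contrast_cos LX' Le1' me2' e1S1' e2S2' XS1' e2S1' XS2' la r b.
have := A_obs r 0; rewrite A A' sub0r => A0.
have := A_obs r h; rewrite A A' !osc_pi//; try exact: L1_cst.
move=> A1.
have := B_obs r 0; rewrite B B' EX A_obs => /addrI; rewrite sub0r => B0.
have := B_obs r h; rewrite B B' EX A_obs => /addrI; rewrite !osc_pi//; try exact: L1_cst.
move=> B1.
by split; rewrite // /u /v /u' /v' /p /q /p' /q' /D0 /D1 /D0' /D1' /h; move: A1 B1; rewrite /h; lra.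
Qed.

Let W1 t := D0 t * u' t - D1 t * v' t - (D0' t * u t - D1' t * v t).
Let W2 t := D0 t * v' t + D1 t * u' t - (D0' t * v t + D1' t * u t).

(* The logarithmic derivatives of the characteristic functions of e1 and e1'
   agree wherever those of e2 and e2' do not vanish. *)
Let W_eq0 r : char_norm2 P e2 r != 0 -> char_norm2 P' e2' r != 0 ->
  W1 (- la * r) = 0 /\ W2 (- la * r) = 0.
Proof.
move=> n0 n0'; have [E1 E2 E3 E4] := obs_eqs r; set s := - la * r.
(* W1 + i W2 times the characteristic functions of [e2] and [e2'] is a difference of two products,
   each of a weighted with an unweighted contrast; [obs_eqs] equates them. The two factors are then
   cancelled one after the other. *)
have [k1 k2] : W1 s * p r - W2 s * q r = 0 /\ W1 s * q r + W2 s * p r = 0.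
  apply: (rot_eq0 n0').
    rewrite [LHS](_ : _ = (D0 s * p r - D1 s * q r) * (u' s * p' r - v' s * q' r)
      - (D0 s * q r + D1 s * p r) * (u' s * q' r + v' s * p' r)
      - ((D0' s * p' r - D1' s * q' r) * (u s * p r - v s * q r)
      - (D0' s * q' r + D1' s * p' r) * (u s * q r + v s * p r))).
      by rewrite E1 E2 E3 E4 subrr.
    by rewrite /W1 /W2 /p' /q'; ring.
  rewrite [LHS](_ : _ = (D0 s * p r - D1 s * q r) * (u' s * q' r + v' s * p' r)
      + (D0 s * q r + D1 s * p r) * (u' s * p' r - v' s * q' r)
      - ((D0' s * p' r - D1' s * q' r) * (u s * q r + v s * p r)
      + (D0' s * q' r + D1' s * p' r) * (u s * p r - v s * q r))).
    by rewrite E1 E2 E3 E4 subrr.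
  by rewrite /W1 /W2 /p' /q'; ring.
exact: (rot_eq0 n0).
Qed.

Let cosc d0 (Om0 : measurableType d0) (P0 : probability Om0 R) (V e : Om0 -> R) b :
  L1 P0 V -> L1 P0 e -> continuous (osc P0 V e b).
Proof. by move=> LV Le; apply: osc_continuous => //; exact: L1_measurable Le. Qed.

(** As [la] is nonzero, every t is of the form - la r. The identity holds in a punctured
    neighborhood of r and extends to r by continuity. *)
Let W12 t : W1 t = 0 /\ W2 t = 0.
Proof.
pose r := t / - la.
have tE : - la * r = t by rewrite mulrC divfK// oppr_eq0.
have near0 : \forall x \near r^', W1 (- la * x) = 0 /\ W2 (- la * x) = 0.
  have N := char_norm2_near Le2 reg2 r; have N' := char_norm2_near Le2' reg2' r.
  by apply: filterS2 N N' => x; exact: W_eq0.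
have cs (F : R -> R) : continuous F -> {for r, continuous (fun x => F (- la * x))}.
  move=> cF; apply: continuous_comp; last exact: cF.
  by apply: cvgM; [exact: cvg_cst|exact: cvg_id].
have c1 V b : L1 P V -> continuous (osc P V e1 b) by move=> LV; exact: cosc.
have c1' V b : L1 P' V -> continuous (osc P' V e1' b) by move=> LV; exact: cosc.
rewrite -tE; split.
  apply: (@continuous_dnbhs_eq0 R (fun x => W1 (- la * x)) r).
    apply: cs => x; apply: cvgB; apply: cvgB; apply: cvgM;
      by [apply: c1 => //; exact: L1_cst|apply: c1' => //; exact: L1_cst].
  by apply: filterS near0 => x [].
apply: (@continuous_dnbhs_eq0 R (fun x => W2 (- la * x)) r).
  apply: cs => x; apply: cvgB; apply: cvgD; apply: cvgM;
    by [apply: c1 => //; exact: L1_cst|apply: c1' => //; exact: L1_cst].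
by apply: filterS near0 => x [].
Qed.

(** Both characteristic functions equal 1 at 0, and [W12] is the linear equation between them; the
    zeros of the second one are isolated and simple by regularity. *)
Lemma error_law_unique t : osc P (fun=> 1) e1 0 t = osc P' (fun=> 1) e1' 0 t /\
  osc P (fun=> 1) e1 (- (pi / 2)) t = osc P' (fun=> 1) e1' (- (pi / 2)) t.
Proof.
have [_ D] := char_derivative Le1; have [_ D'] := char_derivative Le1'.
have pih d0 (Om0 : measurableType d0) (P0 : probability Om0 R) (e : Om0 -> R) s : L1 P0 e ->
    osc P0 e e (0 + pi / 2) s = - osc P0 e e h s.
  move=> Le; rewrite -[RHS]mulN1r /osc -expectZ; last by apply: L1_osc => //; exact: L1_measurable Le.
  by apply: eq_Rintegral => w _; rewrite add0r cosD_pihalf cosB_pihalf; ring.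
have pi0 d0 (Om0 : measurableType d0) (P0 : probability Om0 R) (e : Om0 -> R) s :
    osc P0 e e (h + pi / 2) s = osc P0 e e 0 s by rewrite /h addNr.
apply: (curve_unique (D 0) (D h) (D' 0) (D' h)).
(* The derivative of the characteristic function is i (D0 + i D1). The factor i makes [W2] give the
   real equation and [W1] the imaginary one. *)
- move=> s; have [w1 w2] := W12 s; rewrite !pih// !pi0.
  by move: w2; rewrite /W1 /W2 -/u -/v -/u' -/v' -/D0 -/D1 -/D0' -/D1'; lra.
- move=> s; have [w1 w2] := W12 s; rewrite !pih// !pi0.
  by move: w1; rewrite /W1 /W2 -/u -/v -/u' -/v' -/D0 -/D1 -/D0' -/D1'; lra.
- have c0 d0 (Om0 : measurableType d0) (P0 : probability Om0 R) (e : Om0 -> R) b :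
      osc P0 (fun=> 1) e b 0 = cos b.
    rewrite /osc; under eq_Rintegral do rewrite mul0r add0r mul1r.
    exact: expect_cst.
  by rewrite !c0.
- by have /= := char_norm2_0 P' e1'; rewrite /char_norm2 => ->; rewrite oner_eq0.
- by move=> z _; exact: char_norm2_isolated Le1' reg1' z.
- by move=> z; exact: char_simple Le1' reg1' z.
Qed.

End ErrorLaw.

(** * From trigonometric moments to indicators of rays *)

Section Rays.
Context (R : realType).
Context (d : measure_display) (Om : measurableType d) (P : probability Om R).
Context (d' : measure_display) (Om' : measurableType d') (P' : probability Om' R).
Variables (V X : Om -> R) (V' X' : Om' -> R).
Hypotheses (LV : L1 P V) (LV' : L1 P' V').
Hypotheses (mX : measurable_fun setT X) (mX' : measurable_fun setT X').
Implicit Types f g h : R -> R.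
Hypothesis oscE : forall a b, osc P V X b a = osc P' V' X' b a.

(** Test functions on which the signed image measures of V dP under X and of V' dP' under X' agree.
    The class is closed under linear combinations and bounded pointwise limits. *)
Definition same_moment (f : R -> R) : Prop :=
  [/\ measurable_fun setT f, exists C, forall x, `|f x| <= C &
      \int[P]_w (V w * f (X w)) = \int[P']_w (V' w * f (X' w))].

Let L1f (f : R -> R) C : measurable_fun setT f -> (forall x, `|f x| <= C) ->
  L1 P (fun w => V w * f (X w)) /\ L1 P' (fun w => V' w * f (X' w)).
Proof.
move=> mf fC; split; apply: (@L1M _ _ _ _ _ _ C) => //;
  exact: (measurableT_comp mf).
Qed.

Lemma same_momentD f g : same_moment f -> same_moment g -> same_moment (fun x => f x + g x).
Proof.
move=> [mf [C fC] fE] [mg [D gD] gE]; split.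
- exact: measurable_funD.
- by exists (C + D) => x; rewrite (le_trans (ler_normD _ _))// lerD.
- have [Lf Lf'] := L1f mf fC; have [Lg Lg'] := L1f mg gD.
  under eq_Rintegral do rewrite mulrDr; rewrite expectD// fE gE -expectD//.
  by apply: eq_Rintegral => w _; rewrite mulrDr.
Qed.

Lemma same_momentZ k f : same_moment f -> same_moment (fun x => k * f x).
Proof.
move=> [mf [C fC] fE]; split.
- exact: measurable_funM.
- by exists (`|k| * C) => x; rewrite normrM ler_wpM2l.
- have [Lf Lf'] := L1f mf fC.
  under eq_Rintegral do rewrite mulrCA; rewrite expectZ// fE -expectZ//.
  by apply: eq_Rintegral => w _; rewrite mulrCA.
Qed.

Lemma same_moment_lim (f_ : nat -> R -> R) f : (forall n, same_moment (f_ n)) ->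
  (forall n x, `|f_ n x| <= 1) -> (forall x, f_ n x @[n --> \oo] --> f x) -> same_moment f.
Proof.
move=> Hf f1 cf.
have mf_ n : measurable_fun setT (f_ n) by have [] := Hf n.
have mf : measurable_fun setT f.
  by apply: (measurable_fun_cvg mf_) => x _; exact: cf.
split => //.
  exists 1 => x; have cfx : `|f_ n x| @[n --> \oo] --> `|f x| by apply: cvg_norm; exact: cf.
  rewrite -(cvg_lim _ cfx)//; apply: limr_le; first by apply/cvg_ex; eexists; exact: cfx.
  by apply: nearW => n; exact: f1.
have c d0 (Om0 : measurableType d0) (P0 : probability Om0 R) (U Z : Om0 -> R) :
    L1 P0 U -> measurable_fun setT Z ->
    \int[P0]_w (U w * f_ n (Z w)) @[n --> \oo] --> \int[P0]_w (U w * f (Z w)).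
  move=> LU mZ; have mU := L1_measurable LU.
  apply: (@expect_cvg _ _ _ P0 _ _ (fun w => `|U w|)).
  - by move=> n; apply: measurable_funM => //; exact: (measurableT_comp (mf_ n)).
  - by apply: measurable_funM => //; exact: (measurableT_comp mf).
  - exact: L1_norm.
  - by move=> n w; rewrite normrM ler_piMr.
  - by move=> w; apply: cvgM; [exact: cvg_cst|exact: cf].
apply: (cvg_unique (@Rhausdorff R) (c _ _ _ _ _ LV mX)).
rewrite (_ : (fun n => _) = (fun n => \int[P']_w (V' w * f_ n (X' w)))); first exact: c.
by apply/funext => n; have [] := Hf n.
Qed.

Let trig (f : R -> R) : Prop := forall a b, same_moment (fun x => f x * cos (a * x + b)).
(** A product of two test functions need not be one, whereas multipliers are closed under sums and
    products. Starting from sines, all polynomials in sines are thus reached. *)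
Let trig_mult (g : R -> R) : Prop := forall f, trig f -> trig (fun x => g x * f x).

Let trig1 : trig (fun=> 1).
Proof.
move=> a b; split.
- apply: measurable_funM => //; apply: (measurableT_comp (@measurable_cosR R)).
  by apply: measurable_funD => //; exact: measurable_funM.
- by exists 1 => x; rewrite mul1r; exact: cos_le1.
- under eq_Rintegral do rewrite mul1r; under [RHS]eq_Rintegral do rewrite mul1r.
  exact: oscE.
Qed.

Let trig_mult_sin u v : trig_mult (fun x => sin (u * x + v)).
Proof.
move=> f tf a b.
have -> : (fun x => sin (u * x + v) * f x * cos (a * x + b)) =
  (fun x => 2^-1 * (f x * cos ((u + a) * x + (v + b - pi / 2))) +
            2^-1 * (f x * cos ((u - a) * x + (v - b - pi / 2)))).
  apply/funext => x.
  have -> : (u + a) * x + (v + b - pi / 2) = (u * x + v) + (a * x + b) - pi / 2 by ring.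
  have -> : (u - a) * x + (v - b - pi / 2) = (u * x + v) - (a * x + b) - pi / 2 by ring.
  move: (u * x + v) (a * x + b) => y z.
  by rewrite !cosB_pihalf sinD sinB; field.
by apply: same_momentD; apply: same_momentZ; exact: tf.
Qed.

Let trig_multD g h : trig_mult g -> trig_mult h -> trig_mult (fun x => g x + h x).
Proof.
move=> tg th f tf a b; under eq_fun do rewrite mulrDl mulrDl.
by apply: same_momentD; [exact: tg|exact: th].
Qed.

Let trig_multM g h : trig_mult g -> trig_mult h -> trig_mult (fun x => g x * h x).
Proof. by move=> tg th f tf; under eq_fun do rewrite -mulrA; apply: tg; exact: th. Qed.

Let trig_mult_cst k : trig_mult (fun=> k).
Proof. by move=> f tf a b; under eq_fun do rewrite -mulrA; apply: same_momentZ; exact: tf. Qed.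

Let trig_multX g n : trig_mult g -> trig_mult (fun x => g x ^+ n).
Proof.
move=> tg; elim: n => [|n IH]; first exact: trig_mult_cst.
by under eq_fun do rewrite exprS; exact: trig_multM.
Qed.

(* On [0, 1], (1 - t^n)^(n 2^n) tends to the indicator of t < 1/2. *)
Let step n (t : R) := (1 - t ^+ n) ^+ (n * 2 ^ n)%N.

Let step_bound n (t : R) : 0 <= t <= 1 -> 0 <= step n t <= 1.
Proof.
move=> /andP[t0 t1]; rewrite /step.
have tn0 : 0 <= t ^+ n by rewrite exprn_ge0.
have tn1 : t ^+ n <= 1 by rewrite exprn_ile1.
by rewrite exprn_ge0 ?subr_ge0//= exprn_ile1// ?subr_ge0// gerBl.
Qed.

Let bernoulli (x : R) n : 0 <= x <= 1 -> 1 - n%:R * x <= (1 - x) ^+ n.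
Proof.
move=> /andP[x0 x1]; elim: n => [|n IH]; first by rewrite mul0r subr0 expr0.
rewrite exprS (le_trans _ (ler_wpM2l _ IH)) ?subr_ge0// -subr_ge0.
rewrite [X in 0 <= X](_ : _ = n%:R * x ^+ 2); first by rewrite mulr_ge0// sqr_ge0.
by rewrite -natr1; ring.
Qed.

Let cvg_nX (q : R) : 0 <= q < 1 -> n%:R * q ^+ n @[n --> \oo] --> (0 : R).
Proof.
move=> /andP[q0 q1].
have [->|qn0] := eqVneq q 0.
  apply: cvg_near_cst; exists 1%N => // n /= n1; rewrite expr0n gtn_eqF//= mulr0//.
(* Writing q^n as r^n r^n, the bound n r^n <= 1 / (1 - r) absorbs the factor n and leaves r^n to
   tend to 0. *)
pose r := Num.sqrt q.
have r0 : 0 < r by rewrite sqrtr_gt0 lt0r qn0.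
have r1 : r < 1 by rewrite -sqrtr1 ltr_sqrt.
have qE : q = r * r by rewrite -expr2 sqr_sqrtr.
have h0 : 0 < 1 - r by rewrite subr_gt0.
apply: (@squeeze_cvgr _ _ _ _ (fun=> 0) (fun n => (1 - r)^-1 * r ^+ n)); last 2 first.
- exact: cvg_cst.
- rewrite -(mulr0 (1 - r)^-1); apply: cvgM; first exact: cvg_cst.
  by apply: cvg_expr; rewrite ger0_norm// ltW.
apply: nearW => n; rewrite mulr_ge0 ?exprn_ge0//=.
rewrite qE exprMn mulrA; apply: ler_wpM2r; first by rewrite exprn_ge0 ?ltW.
rewrite -[leRHS]mul1r ler_pdivlMr// (@le_trans _ _ (1 - r ^+ n))//; last first.
  by rewrite gerBl exprn_ge0// ltW.
elim: n => [|n IH]; first by rewrite !mul0r expr0 subrr.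
have -> : n.+1%:R * r ^+ n.+1 * (1 - r) =
    r * (n%:R * r ^+ n * (1 - r)) + r ^+ n.+1 * (1 - r) by rewrite -natr1 exprS; ring.
rewrite (le_trans (lerD (ler_wpM2l (ltW r0) IH) (lexx _)))// -subr_ge0.
rewrite [X in 0 <= X](_ : _ = (1 - r) * (1 - r ^+ n.+1)); last by rewrite exprS; ring.
by rewrite mulr_ge0 ?subr_ge0 ?ltW// exprn_ilt1 ?ltW.
Qed.

(** Bernoulli's inequality bounds [step n t] from below by 1 - n (2t)^n. *)
Let step_cvg1 (t : R) : 0 <= t < 2^-1 -> step n t @[n --> \oo] --> (1 : R).
Proof.
move=> /andP[t0 t2].
have q01 : 0 <= 2 * t < 1 by apply/andP; split; lra.
apply: (@squeeze_cvgr _ _ _ _ (fun n => 1 - n%:R * (2 * t) ^+ n) (fun=> 1)); last 2 first.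
- rewrite -[X in _ --> X]subr0; apply: cvgB; [exact: cvg_cst|exact: cvg_nX].
- exact: cvg_cst.
apply: nearW => n; have t01 : 0 <= t <= 1 by apply/andP; split; lra.
have /andP[_ ->] := step_bound n t01; rewrite andbT.
have tn : 0 <= t ^+ n <= 1 by rewrite exprn_ge0//= exprn_ile1//; lra.
apply: le_trans (bernoulli (n * 2 ^ n) tn).
by rewrite natrM natrX exprMn mulrA.
Qed.

(** From 1 - x <= exp(-x), [step n t] is at most exp(- n (2t)^n), hence at most exp(-n). The factor
    n in the exponent settles the endpoint t = 1/2, where (2t)^n stays equal to 1. *)
Let step_cvg0 (t : R) : 2^-1 <= t <= 1 -> step n t @[n --> \oo] --> (0 : R).
Proof.
move=> /andP[t2 t1].
apply: (@squeeze_cvgr _ _ _ _ (fun=> 0) (fun n => expR (- 1) ^+ n)); last 2 first.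
- exact: cvg_cst.
- by apply: cvg_expr; rewrite ger0_norm ?expR_ge0// expR_lt1; lra.
apply: nearW => n; have t01 : 0 <= t <= 1 by apply/andP; split; lra.
have /andP[-> _] := step_bound n t01; rewrite /=.
have tn : t ^+ n <= 1 by rewrite exprn_ile1//; lra.
rewrite /step (@le_trans _ _ (expR (- t ^+ n) ^+ (n * 2 ^ n)%N))//.
  by rewrite lerXn2r ?nnegrE ?subr_ge0 ?expR_ge0//; exact: expR_ge1Dx.
rewrite -!expRM_natl ler_expR mulrN mulrN1 lerN2 natrM natrX -mulrA ler_peMr//.
by rewrite -exprMn exprn_ege1//; lra.
Qed.

(* The sets where a wave is negative are unions of intervals that exhaust the
   ray below c as the wavelength grows. *)
Let wave (L c x : R) := sin (L * (x - c)).

(** The map (1 + wave) / 2 takes values in [0, 1] and is below 1/2 exactly where the wave is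
    negative. Its images under [step] are polynomials in a sine, hence multipliers of the constant
    1. *)
Let same_moment_wave L c : same_moment (fun x => (wave L c x < 0)%R%:R).
Proof.
have t01 x : 0 <= (1 + wave L c x) / 2 <= 1.
  have := sin_max (L * (x - c)); rewrite ler_norml -/(wave L c x) => /andP[w1 w2].
  by apply/andP; split; lra.
apply: (@same_moment_lim (fun n x => step n ((1 + wave L c x) / 2))).
- move=> n.
  have tw : trig_mult (fun x => wave L c x).
    rewrite (_ : (fun x => _) = (fun x => sin (L * x + - (L * c)))); first exact: trig_mult_sin.
    by apply/funext => x; rewrite /wave mulrBr.
  have ts : trig_mult (fun x => step n ((1 + wave L c x) / 2)).
    apply: trig_multX.
    rewrite (_ : (fun x => _) = (fun x => 1 + (-1) * (((1 + wave L c x) * 2^-1) ^+ n))).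
      apply: trig_multD; first exact: trig_mult_cst.
      apply: trig_multM; first exact: trig_mult_cst.
      apply: trig_multX; apply: trig_multM; last exact: trig_mult_cst.
      by apply: trig_multD => //; exact: trig_mult_cst.
    by apply/funext => x; rewrite mulN1r.
  have := ts _ trig1 0 0.
  by under eq_fun do rewrite mul0r addr0 cos0 !mulr1.
- by move=> n x; have /andP[s0 s1] := step_bound n (t01 x); rewrite ger0_norm.
- move=> x; case: ltP => w0 /=.
    by apply: step_cvg1; have /andP[-> _] := t01 x; rewrite /=; lra.
  by apply: step_cvg0; have /andP[_ ->] := t01 x; rewrite andbT; lra.
Qed.

(** With frequency 1 / (n + 1), the argument of the sine is eventually within pi of 0, where the
    sine has the sign of x - c. *)
Lemma same_moment_ray c : same_moment (fun x => (x < c)%R%:R).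
Proof.
apply: (@same_moment_lim (fun n x => (wave n.+1%:R^-1 c x < 0)%R%:R)).
- by move=> n; exact: same_moment_wave.
- by move=> n x; case: (_ < _); rewrite ?normr1 ?normr0.
move=> x; apply: cvg_near_cst.
have small : \forall n \near \oo, n.+1%:R^-1 * `|x - c| < pi.
  have : n.+1%:R^-1 * `|x - c| @[n --> \oo] --> (0 : R).
    rewrite -(mul0r `|x - c|); apply: cvgM; last exact: cvg_cst.
    exact: cvg_harmonic.
  by move/cvgr_lt; apply; exact: pi_gt0.
apply: filterS small => n xn.
have n0 : 0 < n.+1%:R^-1 :> R by rewrite invr_gt0.
case: (ltP x c) => xc.
  rewrite (_ : (wave n.+1%:R^-1 c x < 0) = true)//.
  rewrite /wave -oppr_gt0 -sinN -mulrN opprB.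
  apply: sin_gt0_pi; rewrite mulr_gt0 ?subr_gt0//=.
  by rewrite (le_lt_trans _ xn)// ler_pM2l// distrC ler_norm.
rewrite (_ : (wave n.+1%:R^-1 c x < 0) = false)//; apply/negbTE; rewrite -leNgt.
apply: sin_ge0_pi; rewrite mulr_ge0 ?subr_ge0 ?(ltW n0)//=.
by apply/ltW/(le_lt_trans _ xn); rewrite ler_pM2l// ler_norm.
Qed.

Lemma expect_ray_eq c :
  \int[P]_w (V w * (X w < c)%R%:R) = \int[P']_w (V' w * (X' w < c)%R%:R).
Proof. by have [] := same_moment_ray c. Qed.

End Rays.

(** * Removal of an error of known characteristic function *)

Section Deconvolution.
Context (R : realType).
Context (d : measure_display) (Om : measurableType d) (P : probability Om R).
Context (d' : measure_display) (Om' : measurableType d') (P' : probability Om' R).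
Variables (V X e : Om -> R) (S : set (set Om)).
Variables (V' X' e' : Om' -> R) (S' : set (set Om')).
Hypotheses (LV : L1 P V) (LV' : L1 P' V').
Hypotheses (mX : measurable_fun setT X) (mX' : measurable_fun setT X').
Hypotheses (Le : L1 P e) (Le' : L1 P' e').
Hypotheses (eS : indep_of P e S) (eS' : indep_of P' e' S').
Hypothesis VS : measurable_wrt S V.
Hypothesis VS' : measurable_wrt S' V'.
Hypothesis XS : measurable_wrt S X.
Hypothesis XS' : measurable_wrt S' X'.
Hypothesis reg : regular_zeros (char_fun P e).
Hypothesis same_error_law : forall t, osc P (fun=> 1) e 0 t = osc P' (fun=> 1) e' 0 t /\
  osc P (fun=> 1) e (- (pi / 2)) t = osc P' (fun=> 1) e' (- (pi / 2)) t.
Hypothesis obsE : forall a b,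
  \int[P]_w (V w * cos (a * (X w + e w) + b)) = \int[P']_w (V' w * cos (a * (X' w + e' w) + b)).

(** Convolution becomes multiplication: the noisy weighted characteristic function is that of the
    error times the noiseless one. *)
Lemma osc_error d0 (Om0 : measurableType d0) (P0 : probability Om0 R) (V0 X0 e0 : Om0 -> R) S0 a b :
  L1 P0 V0 -> L1 P0 e0 -> indep_of P0 e0 S0 -> measurable_fun setT X0 ->
  measurable_wrt S0 V0 ->
  measurable_wrt S0 X0 ->
  \int[P0]_w (V0 w * cos (a * (X0 w + e0 w) + b)) =
  osc P0 (fun=> 1) e0 0 a * osc P0 V0 X0 b a
  - osc P0 (fun=> 1) e0 (- (pi / 2)) a * osc P0 V0 X0 (b - pi / 2) a.
Proof.
move=> LV0 Le0 eS0 mX0 VS0 XS0.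
have mT : measurable_fun setT ((fun w => a * X0 w + b) : g_sigma_algebraType S0 -> R).
  by apply: measurable_funD => //; exact: measurable_funM.
have mT' : measurable_fun setT (fun w => a * X0 w + b).
  by apply: measurable_funD => //; exact: measurable_funM.
have [_] := @osc_indep R d0 Om0 P0 e0 S0 (fun=> 1) V0 (fun w => a * X0 w + b) a
  (L1_measurable Le0) eS0 (measurable_cst _) (L1_cst P0 1) VS0 LV0 mT mT'.
rewrite (_ : (fun w => 1 * V0 w * _) = (fun w => V0 w * cos (a * (X0 w + e0 w) + b))); last first.
  by apply/funext => w; rewrite mul1r; congr (_ * cos _); ring.
move=> ->; congr (_ * _ - _ * _); apply: eq_Rintegral => w _.
by rewrite addrA cosB_pihalf.
Qed.

(** Off the zeros of the characteristic function of the error one may divide by it; at the zeros,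
    which are isolated, the equality follows by continuity. *)
Lemma osc_deconvolution b a : osc P V X b a = osc P' V' X' b a.
Proof.
pose D b a := osc P V X b a - osc P' V' X' b a.
suff D0 : forall a, char_norm2 P e a != 0 -> D b a = 0.
  apply/eqP; rewrite -subr_eq0; apply/eqP.
  apply: (@continuous_dnbhs_eq0 R (D b) a).
    by apply: cvgB; exact: osc_continuous.
  by apply: filterS (char_norm2_near Le reg a) => x; exact: D0.
move=> {}a na.
have E c := obsE a c.
(* Two quarter-turns of the phase change the sign, so that the equations for phases b and b - pi / 2
   form a closed system in two unknowns. *)
have Dpi : D (b - pi / 2 - pi / 2) a = - D b a.
  have H d0 (Om0 : measurableType d0) (P0 : probability Om0 R) (V0 X0 : Om0 -> R) :
      L1 P0 V0 -> measurable_fun setT X0 ->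
      osc P0 V0 X0 (b - pi / 2 - pi / 2) a = - osc P0 V0 X0 b a.
    move=> LV0 mX0; rewrite -[RHS]mulN1r /osc -expectZ; last exact: L1_osc.
    apply: eq_Rintegral => w _.
    have -> : a * X0 w + (b - pi / 2 - pi / 2) = a * X0 w + b - pi by field.
    by rewrite cosB cospi sinpi; ring.
  by rewrite /D !H//; ring.
have [s1 s2] := same_error_law a.
have F c : osc P (fun=> 1) e 0 a * D c a - osc P (fun=> 1) e (- (pi / 2)) a * D (c - pi / 2) a = 0.
  have := E c; rewrite (osc_error _ _ LV Le eS mX VS XS) (osc_error _ _ LV' Le' eS' mX' VS' XS').
  by rewrite -s1 -s2 /D; lra.
have F0 := F b; have := F (b - pi / 2); rewrite Dpi => F1.
have [] := @rot_eq0 R (D b a) (D (b - pi / 2) a) _ _ na.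
- by rewrite -[RHS]F0; ring.
- by move: F1; set x := D b a; set y := D _ a; lra.
- by [].
Qed.

Lemma expect_ray_deconvolution c :
  \int[P]_w (V w * (X w < c)%R%:R) = \int[P']_w (V' w * (X' w < c)%R%:R).
Proof. by apply: expect_ray_eq => // a b; exact: osc_deconvolution. Qed.

End Deconvolution.

(** * Skills and investments under a common index; signals *)

Section Latents.
Context (R : realType) (T : nat).

Definition lat_index : finType := ('I_T.+1 + 'I_T)%type.

Definition mu_lat (p : params R T) (k : lat_index) (m : 'I_2) : R :=
  match k with inl t => mu_th p t m | inr t => mu_I p t m end.
Definition la_lat (p : params R T) (k : lat_index) (m : 'I_2) : R :=
  match k with inl t => la_th p t m | inr t => la_I p t m end.
Definition obs_lat (k : lat_index) (m : 'I_2) : obs_index T :=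
  match k with inl t => inl (inl (inr (t, m))) | inr t => inl (inr (t, m)) end.
Definition err_lat (k : lat_index) (m : 'I_2) : err_index T :=
  match k with inl t => inl (inl (t, m)) | inr t => inl (inr (t, m)) end.

Definition ln_lat d (Om : measurableType d) (v : variables R T Om) (k : lat_index) : Om -> R :=
  match k with inl t => ln_th v t | inr t => ln_I v t end.

(* The first measurement without its error. Unlike ln theta and ln I, it has a
   law that the observables determine. *)
Definition signal d (Om : measurableType d) (p : params R T) (v : variables R T Om) k w : R :=
  mu_lat p k ord0 + la_lat p k ord0 * ln_lat v k w.

(** Generator of [sigma_Y], in the form that the lemmas on conditional independence expect. *)
Definition income_sets d (Om : measurableType d) (v : variables R T Om) : set (set Om) :=
  \bigcup_(X in range (fun t => Y v t : Om -> R)) preimage_set_system setT X measurable.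

Definition err_rest d (Om : measurableType d) (v : variables R T Om) : err_index T -> set (set Om) :=
  rest_sets (fun j => sigma_of [set err v j]) (sigma_latent v) (income_sets v).

Lemma err_lat_inj k m k' m' : err_lat k m = err_lat k' m' -> k = k' /\ m = m'.
Proof. by case: k; case: k' => t t' //= [-> ->]. Qed.

End Latents.

Local Notation signal1 S := (signal (par S) (vars S)).
Local Notation obs1 S k := (obs (vars S) (obs_lat k ord0)).
Local Notation err1 S k := (err (vars S) (err_lat k ord0)).
Local Notation err_rest1 S k := (err_rest (vars S) (err_lat k ord0)).

Lemma sigma_of_preimage (R : realType) (Om : Type) (S : set (Om -> R)) (X : Om -> R) B :
  S X -> measurable B -> sigma_of S (X @^-1` B).
Proof. by move=> SX mB; apply: sub_sigma_algebra; exists X => //; exists B => //; rewrite setTI. Qed.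

Lemma sigma_of_sub_measurable (R : realType) d (Om : measurableType d) (S : set (Om -> R)) :
  (forall X, S X -> measurable_fun setT X) -> sigma_of S `<=` measurable.
Proof.
move=> mS; apply: smallest_sub; first exact: sigma_algebra_measurable.
by move=> _ [X SX [B mB <-]]; exact: mS.
Qed.

Lemma sigma_of_sub (R : realType) (Om : Type) (S S' : set (Om -> R)) :
  (forall X, S X -> forall B, measurable B -> sigma_of S' (X @^-1` B)) -> sigma_of S `<=` sigma_of S'.
Proof.
move=> SS'; apply: smallest_sub; first exact: smallest_sigma_algebra.
by move=> _ [X SX [B mB <-]]; rewrite setTI; exact: SS'.
Qed.

Lemma sigma_of_fun (R : realType) (Om : Type) (S : set (Om -> R)) :
  sigma_algebra setT (sigma_of S).
Proof. exact: smallest_sigma_algebra. Qed.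

(** * Independence, moments and measurement equations in a valid structure *)

Section ValidStructure.
Context (R : realType) (T : nat) (S : structure R T).
Hypothesis hS : valid S.

Local Notation P := (prob S).
Local Notation p := (par S).
Local Notation v := (vars S).

Lemma measurable_err j : measurable_fun setT (err v j).
Proof. by case: j => [[[t m]|[t m]]|[]] /=; exact: measurable_funP. Qed.

Lemma measurable_obs j : measurable_fun setT (obs v j).
Proof. by case: j => [[[t|[t m]]|[t m]]|[]] /=; exact: measurable_funP. Qed.

Lemma measurable_ln_lat k : measurable_fun setT (ln_lat v k).
Proof. by case: k => t; apply: (measurableT_comp (@measurable_ln R)); exact: measurable_funP. Qed.

Lemma measurable_signal k : measurable_fun setT (signal p v k).
Proof.
apply: measurable_funD => //; apply: measurable_funM => //; exact: measurable_ln_lat.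
Qed.

(** Condition (a) and exogeneity of income, combined: each error is unconditionally independent of
    all other errors, latents and incomes taken together. *)
Lemma err_indep_of j : indep_of P (err v j) (err_rest v j).
Proof.
move=> V mV; have [cF cF12] := valid_indep hS.
apply: (@cond_indep_rv R _ _ P _ (fun j => sigma_of [set err v j]) (sigma_err v)
  (sigma_latent v) (income_sets v) _ _ _ _ _ _ _ _ cF cF12 j) => //.
- by move=> k; exact: sigma_of_fun.
- exact: sigma_of_fun.
- exact: sigma_of_fun.
- move=> k; apply: sigma_of_sub => X -> B mB; apply: sigma_of_preimage => //; by exists k.
- by apply: sigma_of_sub_measurable => _ [k _ <-]; exact: measurable_err.
- by apply: sigma_of_sub_measurable => _ [] [k _ <-]; exact: measurable_funP.
- by apply: sigma_of_sub_measurable => _ [k _ <-]; exact: measurable_funP.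
- exact: valid_exo hS.
- by move=> B mB; exact: sigma_of_preimage.
Qed.

Lemma err_rest_err j k : k != j ->
  measurable_fun setT (err v k : g_sigma_algebraType (err_rest v j) -> R).
Proof.
move=> kj _ B mB; rewrite setTI; apply: sub_sigma_algebra.
apply: (rest_sets_err _ _ _ kj).
- by move=> i; exact: sigma_of_fun.
- exact: sigma_of_fun.
- exact: sigma_of_preimage.
Qed.

Lemma err_rest_ln_lat j k :
  measurable_fun setT (ln_lat v k : g_sigma_algebraType (err_rest v j) -> R).
Proof.
suff H (X : Defs.space S -> R) : (range (fun t => theta v t : Defs.space S -> R) `|`
            range (fun t => invest v t : Defs.space S -> R)) X ->
    measurable_wrt (err_rest v j) X.
  by case: k => t; apply: (measurableT_comp (@measurable_ln R)); apply: H; [left|right]; exists t.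
move=> hX _ B mB; rewrite setTI; apply: sub_sigma_algebra.
apply: rest_sets_latent; first by move=> i; exact: sigma_of_fun.
exact: sigma_of_preimage.
Qed.

Lemma err_rest_signal j k :
  measurable_fun setT (signal p v k : g_sigma_algebraType (err_rest v j) -> R).
Proof.
apply: measurable_funD => //; apply: measurable_funM => //; exact: err_rest_ln_lat.
Qed.

Lemma err_rest_ln_Y j t :
  measurable_fun setT (ln_Y v t : g_sigma_algebraType (err_rest v j) -> R).
Proof.
apply: (measurableT_comp (@measurable_ln R)) => _ B mB; rewrite setTI.
apply: sub_sigma_algebra; apply: rest_sets_cond; first by move=> i; exact: sigma_of_fun.
  exact: sigma_of_fun.
by apply: sigma_of_preimage => //; exists t.
Qed.

Lemma L1_err j : L1 P (err v j).
Proof. by have [_ _ _ _ [H _]] := valid_moments hS; exact: finite_momentsP (H j). Qed.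

Lemma finite_moments_ln_lat k : finite_moments P (ln_lat v k).
Proof. by have [Hth HI _ _ _] := valid_moments hS; case: k => t /=. Qed.

Lemma L1_ln_lat k : L1 P (ln_lat v k).
Proof. exact/finite_momentsP/finite_moments_ln_lat. Qed.

Lemma L1_signal k : L1 P (signal p v k).
Proof. by apply: L1D; [exact: L1_cst|apply: L1Z; exact: L1_ln_lat]. Qed.

Lemma L1_signal_mul k k' : L1 P (fun w => signal p v k w * signal p v k' w).
Proof.
have -> : (fun w => signal p v k w * signal p v k' w) = (fun w =>
   (mu_lat p k ord0 * mu_lat p k' ord0 + mu_lat p k ord0 * la_lat p k' ord0 * ln_lat v k' w) +
   (la_lat p k ord0 * mu_lat p k' ord0 * ln_lat v k w +
    la_lat p k ord0 * la_lat p k' ord0 * (ln_lat v k w * ln_lat v k' w))).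
  by apply/funext => w; rewrite /signal; ring.
apply: L1D; first by apply: L1D; [exact: L1_cst|apply: L1Z; exact: L1_ln_lat].
apply: L1D; first by apply: L1Z; exact: L1_ln_lat.
by apply/L1Z/finite_moments_mul; exact: finite_moments_ln_lat.
Qed.

Lemma expect_err j : \int[P]_w err v j w = 0.
Proof. by rewrite -expectationE (valid_centered hS). Qed.

Lemma err_orthogonal j V : measurable_wrt (err_rest v j) V ->
  L1 P V -> L1 P (fun w => err v j w * V w) /\ \int[P]_w (err v j w * V w) = 0.
Proof.
move=> mV LV.
have [L E] := indep_of_expect (@err_indep_of j) (@measurable_id _ _ setT) (L1_err j) mV LV.
by split => //; move: E; rewrite /= => ->; rewrite expect_err mul0r.
Qed.

Lemma la_lat_neq0 k m : la_lat p k m != 0.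
Proof. by have [Hth HI _ _ _] := valid_params hS; case: k => t /=. Qed.

Lemma measurement k m : \forall w \ae P,
  obs v (obs_lat k m) w = mu_lat p k m + la_lat p k m * ln_lat v k w + err v (err_lat k m) w.
Proof.
by case: k => t /=; [exact: (measure_th (valid_model hS))|exact: (measure_I (valid_model hS))].
Qed.

(** In terms of the signal, the intercept and slope of a measurement are exactly the transformed
    parameters. *)
Lemma measurement_signal k m : \forall w \ae P,
  obs v (obs_lat k m) w =
  mu_lat p k m - la_lat p k m / la_lat p k ord0 * mu_lat p k ord0
  + la_lat p k m / la_lat p k ord0 * signal p v k w + err v (err_lat k m) w.
Proof.
apply: filterS (measurement k m) => w ->; rewrite /signal.
by field; exact: la_lat_neq0.
Qed.

Lemma obs_signal k : \forall w \ae P,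
  obs v (obs_lat k ord0) w = signal p v k w + err v (err_lat k ord0) w.
Proof. exact: measurement. Qed.

Lemma outcome_signal : \forall w \ae P,
  obs v (inr tt) w = rho0_t p + rho1_t p * signal p v (inl ord_max) w + err v (inr tt) w.
Proof.
apply: filterS (outcome (valid_model hS)) => w /= ->.
rewrite /rho0_t /rho1_t /signal/=.
by field; exact: (la_lat_neq0 (inl ord_max)).
Qed.

Lemma expect_signal k : \int[P]_w signal p v k w = \int[P]_w obs v (obs_lat k ord0) w.
Proof.
rewrite -[LHS]addr0 -(expect_err (err_lat k ord0)) -expectD; [|exact: L1_signal|exact: L1_err].
apply: expect_ae; last by apply: filterS (obs_signal k).
- by apply: measurable_funD; [exact: measurable_signal|exact: measurable_err].
- exact: measurable_obs.
Qed.

End ValidStructure.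

(** * First and second moments of measurements *)

Section SecondMoments.
Context (R : realType) (T : nat) (S : structure R T).
Hypothesis hS : valid S.

Local Notation P := (prob S).
Local Notation p := (par S).
Local Notation v := (vars S).

Lemma finite_moments_obs j : finite_moments P (obs v j).
Proof.
have [_ _ HY [Hth [HI HQ]] _] := valid_moments hS.
by case: j => [[[t|[t m]]|[t m]]|[]] //=; have [] := HY t.
Qed.

Lemma L1_obs j : L1 P (obs v j).
Proof. exact/finite_momentsP/finite_moments_obs. Qed.

Section Regression.
Variables (k k' : lat_index T) (a b : R) (i : obs_index T) (j : err_index T).
Hypothesis kk' : k' != k.
Hypothesis jk' : j != err_lat k' ord0.
Hypothesis iE : \forall w \ae P, obs v i w = a + b * signal p v k w + err v j w.

Lemma regression_mean : \int[P]_w obs v i w = a + b * \int[P]_w obs v (obs_lat k ord0) w.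
Proof.
have Ls := L1_signal hS k; have Lj := L1_err hS j.
rewrite -(expect_signal hS) -expectZ// -[X in _ = X + _](expect_cst P a).
transitivity (\int[P]_w (a + b * signal p v k w + err v j w)).
  apply: expect_ae iE; first exact: measurable_obs.
  apply: (L1_measurable (P := P)); apply: L1D => //; apply: L1D; [exact: L1_cst|exact: L1Z].
rewrite expectD//; last by apply: L1D; [exact: L1_cst|exact: L1Z].
by rewrite expectD ?(expect_err hS) ?addr0//; [exact: L1_cst|exact: L1Z].
Qed.

(** The first measurement of another latent [k'] acts as an instrument. Its error differs from the
    error [j] and is independent of the signal of [k], hence every product that contains an error
    has mean zero. *)
Lemma regression_cross : \int[P]_w (obs v i w * obs v (obs_lat k' ord0) w) =
  a * \int[P]_w obs v (obs_lat k' ord0) w + b * \int[P]_w (signal p v k w * signal p v k' w).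
Proof.
have Ls := L1_signal hS k'; have Lss := L1_signal_mul hS k k'.
have [L1_ E1] := err_orthogonal hS (@err_rest_signal R T S j k') Ls.
have [L2 E2] := err_orthogonal hS (@err_rest_signal R T S (err_lat k' ord0) k) (L1_signal hS k).
have [L3 E3] := err_orthogonal hS (@err_rest_err R T S _ _ jk') (L1_err hS j).
have Lj := L1_err hS (err_lat k' ord0).
rewrite -(expect_signal hS) -!expectZ//.
transitivity (\int[P]_w (a * signal p v k' w + b * (signal p v k w * signal p v k' w)
   + (err v j w * signal p v k' w + a * err v (err_lat k' ord0) w
   + b * (err v (err_lat k' ord0) w * signal p v k w)
   + err v (err_lat k' ord0) w * err v j w))).
  apply: expect_ae.
  - by apply: measurable_funM; exact: measurable_obs.
  - apply: (L1_measurable (P := P)); apply: L1D; first by apply: L1D; exact: L1Z.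
    by apply: L1D => //; apply: L1D; [apply: L1D => //|]; exact: L1Z.
  - by apply: filterS2 iE (obs_signal hS k') => w -> ->; ring.
have Lr : L1 P (fun w => err v j w * signal p v k' w + a * err v (err_lat k' ord0) w
   + b * (err v (err_lat k' ord0) w * signal p v k w)
   + err v (err_lat k' ord0) w * err v j w).
  by apply: L1D => //; apply: L1D; [apply: L1D => //|]; exact: L1Z.
rewrite expectD//; last by apply: L1D; exact: L1Z.
rewrite expectD; [|exact: L1Z|exact: L1Z].
suff -> : \int[P]_w (err v j w * signal p v k' w + a * err v (err_lat k' ord0) w
   + b * (err v (err_lat k' ord0) w * signal p v k w)
   + err v (err_lat k' ord0) w * err v j w) = 0 by rewrite addr0.
rewrite expectD//; last by apply: L1D; [apply: L1D => //|]; exact: L1Z.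
rewrite expectD; [|by apply: L1D => //; exact: L1Z|exact: L1Z].
rewrite expectD//; last exact: L1Z.
by rewrite E1 E3 !expectZ// E2 (expect_err hS) !mulr0 !addr0.
Qed.

End Regression.

Lemma obs_cross k k' : k' != k ->
  \int[P]_w (obs v (obs_lat k ord0) w * obs v (obs_lat k' ord0) w) =
  \int[P]_w (signal p v k w * signal p v k' w).
Proof.
move=> kk'; rewrite (@regression_cross k k' 0 1 (obs_lat k ord0) (err_lat k ord0)) ?mul0r ?add0r ?mul1r//.
- by apply/eqP => /err_lat_inj[kE _]; rewrite kE eqxx in kk'.
- by apply: filterS (obs_signal hS k) => w ->; rewrite add0r mul1r.
Qed.

Lemma signal_covariance k k' : covariance P (ln_lat v k) (ln_lat v k') != 0%E ->
  \int[P]_w (signal p v k w * signal p v k' w)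
  - (\int[P]_w signal p v k w) * (\int[P]_w signal p v k' w) != 0.
Proof.
have [F1 F2] := finite_moments_ln_lat hS k; have [F1' F2'] := finite_moments_ln_lat hS k'.
have Lk := L1_ln_lat hS k; have Lk' := L1_ln_lat hS k'.
have Lkk : L1 P (fun w => ln_lat v k w * ln_lat v k' w).
  by apply: finite_moments_mul; exact: finite_moments_ln_lat.
rewrite covarianceE//; last exact: Lfun2_mul_Lfun1.
have toR X : L1 P X -> 'E_P[X]%E = (\int[P]_w X w)%:E.
  by move=> LX; rewrite unlock fineK//; exact: integrable_fin_num.
rewrite !toR// -EFinM -EFinB eqe => c0.
have Es l : \int[P]_w signal p v l w = mu_lat p l ord0 + la_lat p l ord0 * \int[P]_w ln_lat v l w.
  have Ll := L1_ln_lat hS l.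
  by rewrite expectD ?expect_cst ?expectZ//; [exact: L1_cst|exact: L1Z].
rewrite !Es (_ : \int[P]_w (signal p v k w * signal p v k' w) =
   (mu_lat p k ord0 * mu_lat p k' ord0 + mu_lat p k ord0 * la_lat p k' ord0 * \int[P]_w ln_lat v k' w) +
   (la_lat p k ord0 * mu_lat p k' ord0 * \int[P]_w ln_lat v k w +
    la_lat p k ord0 * la_lat p k' ord0 * \int[P]_w (ln_lat v k w * ln_lat v k' w))); last first.
  rewrite -!expectZ// -[X in X + _ + _](expect_cst P).
  rewrite -expectD//; [|exact: L1_cst|exact: L1Z].
  rewrite -expectD; [|exact: L1Z|exact: L1Z].
  rewrite -expectD; last 2 first.
  - by apply: L1D; [exact: L1_cst|exact: L1Z].
  - by apply: L1D; exact: L1Z.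
  by apply: eq_Rintegral => w _; rewrite /signal; ring.
rewrite [X in X != 0](_ : _ = la_lat p k ord0 * la_lat p k' ord0 *
  (\int[P]_w (ln_lat v k w * ln_lat v k' w) - (\int[P]_w ln_lat v k w) * (\int[P]_w ln_lat v k' w))).
  by rewrite !mulf_neq0// (la_lat_neq0 hS).
by ring.
Qed.

Lemma correlated k : exists2 k', k' != k & covariance P (ln_lat v k) (ln_lat v k') != 0%E.
Proof.
have [Hth HI] := valid_corr hS; case: k => t.
- have [[s cs]|[s [st cs]]] := Hth t; first by exists (inr s).
  by exists (inl s).
- have [[s cs]|[s [st cs]]] := HI t; first by exists (inl s).
  by exists (inr s).
Qed.

End SecondMoments.

(** * Linear parameters determined by the observables *)

Section Linear.
Context (R : realType) (T : nat) (S S0 : structure R T).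
Hypotheses (hS : valid S) (hS0 : valid S0) (SS0 : obs_equiv S S0).

Lemma obs_expect (phi : (obs_index T -> R) -> R) :
  measurable_wrt (@cylinders R (obs_index T)) phi ->
  L1 (prob S) (fun w => phi (obs (vars S) ^~ w)) ->
  \int[prob S]_w phi (obs (vars S) ^~ w) = \int[prob S0]_w phi (obs (vars S0) ^~ w).
Proof.
by move=> mphi Lphi; have [_ ->] := same_joint_law_expect (@measurable_obs R T S)
  (@measurable_obs R T S0) SS0 mphi Lphi.
Qed.

Lemma obs_mean i : \int[prob S]_w obs (vars S) i w = \int[prob S0]_w obs (vars S0) i w.
Proof. by apply: (obs_expect (measurable_coord i)); exact: L1_obs. Qed.

Lemma obs_product i i' : \int[prob S]_w (obs (vars S) i w * obs (vars S) i' w) =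
  \int[prob S0]_w (obs (vars S0) i w * obs (vars S0) i' w).
Proof.
apply: (obs_expect (phi := fun x => x i * x i')).
  by apply: measurable_funM; exact: measurable_coord.
by apply: finite_moments_mul; exact: finite_moments_obs.
Qed.

(** The mean and the cross moment with an instrument are two linear equations in intercept and
    slope. Their determinant is the covariance of two signals, nonzero by condition (e) and the
    nonzero loadings. *)
Lemma regression_unique k (a b a0 b0 : R) i j :
  (forall k' : lat_index T, k' != k -> j != err_lat k' ord0) ->
  (\forall w \ae prob S, obs (vars S) i w =
     a + b * signal1 S k w + err (vars S) j w) ->
  (\forall w \ae prob S0, obs (vars S0) i w =
     a0 + b0 * signal1 S0 k w + err (vars S0) j w) ->
  a = a0 /\ b = b0.
Proof.
move=> jk E E0; have [k' kk' c] := correlated hS0 k.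
set A := \int[prob S0]_w obs (vars S0) i w.
set B := \int[prob S0]_w obs1 S0 k w.
set C := \int[prob S0]_w obs (vars S0) (obs_lat k' ord0) w.
set AC := \int[prob S0]_w (obs (vars S0) i w * obs (vars S0) (obs_lat k' ord0) w).
set BC := \int[prob S0]_w (obs1 S0 k w * obs (vars S0) (obs_lat k' ord0) w).
have det : BC - B * C != 0.
  by have := signal_covariance hS0 c; rewrite -(obs_cross hS0 kk') !(expect_signal hS0).
have e1 : A = a + b * B by have := regression_mean hS E; rewrite !obs_mean.
have e2 : A = a0 + b0 * B by have := regression_mean hS0 E0.
have e3 : AC = a * C + b * BC.
  by have := regression_cross hS (jk _ kk') E; rewrite -(obs_cross hS kk') !obs_product !obs_mean.
have e4 : AC = a0 * C + b0 * BC.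
  by have := regression_cross hS0 (jk _ kk') E0; rewrite -(obs_cross hS0 kk').
have bb0 : b = b0.
  apply/eqP; rewrite -subr_eq0; apply/eqP; apply: (mulIf det); rewrite mul0r.
  have -> : (b - b0) * (BC - B * C) =
    (a * C + b * BC) - (a0 * C + b0 * BC) - C * ((a + b * B) - (a0 + b0 * B)) by ring.
  by rewrite -e1 -e2 -e3 -e4; ring.
by split=> //; rewrite bb0 in e1; lra.
Qed.

Lemma measurement_unique k m :
  mu_lat (par S) k m - la_lat (par S) k m / la_lat (par S) k ord0 * mu_lat (par S) k ord0 =
  mu_lat (par S0) k m - la_lat (par S0) k m / la_lat (par S0) k ord0 * mu_lat (par S0) k ord0 /\
  la_lat (par S) k m / la_lat (par S) k ord0 = la_lat (par S0) k m / la_lat (par S0) k ord0.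
Proof.
apply: (@regression_unique k _ _ _ _ (obs_lat k m) (err_lat k m)).
- by move=> k' kk'; apply/eqP => /err_lat_inj[kE _]; rewrite kE eqxx in kk'.
- exact: measurement_signal.
- exact: measurement_signal.
Qed.

Lemma outcome_unique : rho0_t (par S) = rho0_t (par S0) /\ rho1_t (par S) = rho1_t (par S0).
Proof.
apply: (@regression_unique (inl ord_max) _ _ _ _ (inr tt) (inr tt)).
- by case.
- exact: outcome_signal.
- exact: outcome_signal.
Qed.

End Linear.

Lemma measurable_ray (R : realType) (c : R) : measurable_fun setT (fun x : R => (x < c)%R%:R : R).
Proof.
rewrite (_ : (fun x : R => _) = \1_(`]-oo, c[%classic)).
  by apply: measurable_indic; exact: measurable_itv.
by apply/funext => x; rewrite indicE mem_setE in_itv.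
Qed.

Lemma norm_indicator_le1 (R : realType) (b : bool) : `|b%:R : R| <= 1.
Proof. by case: b; rewrite ?normr1 ?normr0. Qed.

(** * Error laws and deconvolution in the model *)

Section ErrorLaws.
Context (R : realType) (T : nat) (S S0 : structure R T).
Hypotheses (hS : valid S) (hS0 : valid S0) (SS0 : obs_equiv S S0).

(** The transformed coefficients of the second measurement are already known to agree, so that the
    contrast is the same function of the observables in both structures. *)
Lemma measurement_error_law k s :
  osc (prob S) (fun=> 1) (err1 S k) 0 s =
  osc (prob S0) (fun=> 1) (err1 S0 k) 0 s /\
  osc (prob S) (fun=> 1) (err1 S k) (- (pi / 2)) s =
  osc (prob S0) (fun=> 1) (err1 S0 k) (- (pi / 2)) s.
Proof.
have [muE laE] := measurement_unique hS hS0 SS0 k ord_max.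
set mu := (X in _ = X) in muE; set la := (X in _ = X) in laE.
have la0 : la != 0 by rewrite mulf_neq0// ?invr_eq0 (la_lat_neq0 hS0).
have j10 : err_lat k ord_max != err_lat k ord0 by apply/eqP => /err_lat_inj[].
have j01 : err_lat k ord0 != err_lat k ord_max by rewrite eq_sym.
pose Z2 x := x (obs_lat k (ord_max : 'I_2)) : R.
pose Z1 x := x (obs_lat k (ord0 : 'I_2)) : R.
pose phi r b x := cos (r * (Z2 x - mu - la * Z1 x) + b).
have mphi r b : measurable_fun setT (phi r b : g_sigma_algebraType (@cylinders R (obs_index T)) -> R).
  apply: (measurableT_comp (@measurable_cosR R)); apply: measurable_funD => //; apply: measurable_funM => //.
  apply: measurable_funB; first by apply: measurable_funB => //; exact: measurable_coord.
  by apply: measurable_funM => //; exact: measurable_coord.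
have contrast (S' : structure R T) (h' : valid S') :
    mu_lat (par S') k ord_max - la_lat (par S') k ord_max / la_lat (par S') k ord0 * mu_lat (par S') k ord0 = mu ->
    la_lat (par S') k ord_max / la_lat (par S') k ord0 = la ->
    \forall w \ae prob S', forall r b, phi r b (obs (vars S') ^~ w) =
      cos (r * (err (vars S') (err_lat k ord_max) w - la * err1 S' k w) + b)
      /\ Z1 (obs (vars S') ^~ w) =
         signal1 S' k w + err1 S' k w.
  move=> muE' laE'; apply: filterS2 (measurement_signal h' k ord_max) (obs_signal h' k).
  move=> w E2 E1 r b; rewrite /phi /Z2 /Z1 E2 E1 muE' laE'; split=> //.
  by congr (cos (_ * _ + _)); ring.
have C := contrast S hS muE laE; have C0 := contrast S0 hS0 erefl erefl.
have mcontrast (S' : structure R T) r b : measurable_fun setT (fun w =>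
    cos (r * (err (vars S') (err_lat k ord_max) w - la * err1 S' k w) + b)).
  apply: measurable_cos_affine; apply: measurable_funB; first exact: measurable_err.
  by apply: measurable_funM => //; exact: measurable_err.
have mphi' (S' : structure R T) r b : measurable_fun setT (fun w => phi r b (obs (vars S') ^~ w)).
  apply: (@measurable_cos_affine _ _ _ (fun w => obs (vars S') (obs_lat k ord_max) w - mu
     - la * obs1 S' k w)).
  apply: measurable_funB; first by apply: measurable_funB => //; exact: measurable_obs.
  by apply: measurable_funM => //; exact: measurable_obs.
apply: (@error_law_unique R _ _ (prob S) _ _ (prob S0)
  (signal1 S k) (err1 S k) (err (vars S) (err_lat k ord_max))
  (err_rest1 S k) (err_rest (vars S) (err_lat k ord_max))
  (signal1 S0 k) (err1 S0 k) (err (vars S0) (err_lat k ord_max))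
  (err_rest1 S0 k) (err_rest (vars S0) (err_lat k ord_max))
  (L1_signal hS k) (L1_signal hS0 k) (L1_err hS _) (L1_err hS0 _) (L1_err hS _) (L1_err hS0 _)
  (@err_indep_of _ _ _ hS _) (@err_indep_of _ _ _ hS0 _) (@err_indep_of _ _ _ hS _) (@err_indep_of _ _ _ hS0 _)
  (@err_rest_signal _ _ _ _ _) (@err_rest_signal _ _ _ _ _)
  (@err_rest_err _ _ _ _ _ j10) (@err_rest_err _ _ _ _ _ j10)
  (@err_rest_signal _ _ _ _ _) (@err_rest_signal _ _ _ _ _)
  (valid_char_fun hS0 _) (valid_char_fun hS _) (valid_char_fun hS0 _) la la0).
- by rewrite !expect_signal//; exact: obs_mean.
- move=> r b.
  transitivity (\int[prob S]_w phi r b (obs (vars S) ^~ w)).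
    by apply: expect_ae => //; apply: filterS C => w /(_ r b)[].
  transitivity (\int[prob S0]_w phi r b (obs (vars S0) ^~ w)).
    apply: obs_expect => //; apply: (@L1_bounded _ _ _ _ _ 1) => // w; exact: cos_le1.
  by apply: expect_ae => //; apply: filterS C0 => w /(_ r b)[].
- move=> r b.
  have m1 (S' : structure R T) : valid S' -> measurable_fun setT (fun w =>
      (signal1 S' k w + err1 S' k w) *
      cos (r * (err (vars S') (err_lat k ord_max) w - la * err1 S' k w) + b)).
    move=> h'; apply: measurable_funM => //; apply: measurable_funD; last exact: measurable_err.
    exact: measurable_signal.
  have L2 : L1 (prob S) (fun w => Z1 (obs (vars S) ^~ w) * phi r b (obs (vars S) ^~ w)).
    apply: (@L1M _ _ _ _ _ _ 1) => //; first exact: L1_obs.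
    by move=> w; exact: cos_le1.
  have m2 (S' : structure R T) : measurable_fun setT (fun w => Z1 (obs (vars S') ^~ w) * phi r b (obs (vars S') ^~ w)).
    by apply: measurable_funM => //; exact: measurable_obs.
  transitivity (\int[prob S]_w (Z1 (obs (vars S) ^~ w) * phi r b (obs (vars S) ^~ w))).
    apply: expect_ae; [exact: m1|exact: m2|].
    by apply: filterS C => w /(_ r b)[-> ->].
  transitivity (\int[prob S0]_w (Z1 (obs (vars S0) ^~ w) * phi r b (obs (vars S0) ^~ w))).
    apply: (obs_expect SS0 (phi := fun x => Z1 x * phi r b x)) => //.
    by apply: measurable_funM => //; exact: measurable_coord.
  apply: expect_ae; [exact: m2|exact: m1|].
  by apply: filterS C0 => w /(_ r b)[-> ->].
Qed.

Section OneRay.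
Variables (k : lat_index T) (V : Defs.space S -> R) (V0 : Defs.space S0 -> R).
Hypotheses (LV : L1 (prob S) V) (LV0 : L1 (prob S0) V0).
Hypothesis mV : measurable_wrt (err_rest1 S k) V.
Hypothesis mV0 : measurable_wrt (err_rest1 S0 k) V0.
Hypothesis VV0 : forall a b,
  \int[prob S]_w (V w * cos (a * obs1 S k w + b)) =
  \int[prob S0]_w (V0 w * cos (a * obs1 S0 k w + b)).

(** The weights may involve anything free of the error being removed, including other noisy
    measurements. This freedom allows errors to be removed one at a time. *)
Lemma ray_signal c :
  \int[prob S]_w (V w * (signal1 S k w < c)%R%:R) =
  \int[prob S0]_w (V0 w * (signal1 S0 k w < c)%R%:R).
Proof.
have E (S' : structure R T) (h' : valid S') (U : Defs.space S' -> R) a b : L1 (prob S') U ->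
    \int[prob S']_w (U w * cos (a * (signal1 S' k w
       + err1 S' k w) + b)) =
    \int[prob S']_w (U w * cos (a * obs1 S' k w + b)).
  move=> LU; apply: expect_ae.
  - apply: measurable_funM; first exact: L1_measurable LU.
    by apply: measurable_cos_affine; apply: measurable_funD; [exact: measurable_signal|exact: measurable_err].
  - apply: measurable_funM; first exact: L1_measurable LU.
    by apply: measurable_cos_affine; exact: measurable_obs.
  - by apply: filterS (obs_signal h' k) => w ->.
apply: (@expect_ray_deconvolution R _ _ (prob S) _ _ (prob S0) V (signal1 S k)
  (err1 S k) (err_rest1 S k)
  V0 (signal1 S0 k)
  (err1 S0 k) (err_rest1 S0 k) LV LV0
  (@measurable_signal _ _ _ _) (@measurable_signal _ _ _ _) (L1_err hS _) (L1_err hS0 _)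
  (@err_indep_of _ _ _ hS _) (@err_indep_of _ _ _ hS0 _) mV mV0
  (@err_rest_signal _ _ _ _ _) (@err_rest_signal _ _ _ _ _) (valid_char_fun hS _)).
- exact: measurement_error_law.
- by move=> a b; rewrite !E.
Qed.

End OneRay.

End ErrorLaws.

Lemma normrM_le1 (R : realType) (x y : R) : `|x| <= 1 -> `|y| <= 1 -> `|x * y| <= 1.
Proof. by move=> x1 y1; rewrite normrM mulr_ile1. Qed.

(** * Joint laws of two signals and income, and means of a third signal *)

Section Boxes.
Context (R : realType) (T : nat) (S S0 : structure R T).
Hypotheses (hS : valid S) (hS0 : valid S0) (SS0 : obs_equiv S S0).

Section TwoRays.
Variables (k1 k2 : lat_index T) (k12 : k2 != k1).
Variables (V : Defs.space S -> R) (V0 : Defs.space S0 -> R).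
Hypotheses (LV : L1 (prob S) V) (LV0 : L1 (prob S0) V0).
Hypothesis mV : forall k, k = k1 \/ k = k2 -> measurable_wrt (err_rest1 S k) V.
Hypothesis mV0 : forall k, k = k1 \/ k = k2 -> measurable_wrt (err_rest1 S0 k) V0.
Hypothesis VV0 : forall a b a' b',
  \int[prob S]_w (V w * cos (a' * obs1 S k2 w + b')
     * cos (a * obs1 S k1 w + b)) =
  \int[prob S0]_w (V0 w * cos (a' * obs1 S0 k2 w + b')
     * cos (a * obs1 S0 k1 w + b)).

(** The first measurement agrees with this sum only almost surely. The sum is exactly measurable for
    the sigma-algebra of the remaining variables when another latent is deconvolved, as the
    independence statements require. *)
Let noisy (S' : structure R T) (k : lat_index T) w :=
  signal1 S' k w + err1 S' k w.

Let mnoisy (S' : structure R T) k : measurable_fun setT (@noisy S' k).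
Proof. by apply: measurable_funD; [exact: measurable_signal|exact: measurable_err]. Qed.

Let U (S' : structure R T) (W : Defs.space S' -> R) a b w := W w * cos (a * @noisy S' k2 w + b).

Let LU (S' : structure R T) (W : Defs.space S' -> R) a b : L1 (prob S') W -> L1 (prob S') (U W a b).
Proof. by move=> LW; exact: L1_osc. Qed.

Let mU (S' : structure R T) (W : Defs.space S' -> R) a b :
  measurable_wrt (err_rest1 S' k1) W ->
  measurable_fun setT (U W a b : g_sigma_algebraType (err_rest1 S' k1) -> R).
Proof.
move=> mW; apply: measurable_funM => //; apply: (measurableT_comp (@measurable_cosR R)).
apply: measurable_funD => //; apply: measurable_funM => //; apply: measurable_funD.
  exact: err_rest_signal.
by apply: err_rest_err; apply/eqP => /err_lat_inj[kE _]; move: k12; rewrite kE eqxx.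
Qed.

Let mray (S' : structure R T) k c : measurable_fun setT (fun w => (signal1 S' k w < c)%R%:R : R).
Proof. exact: (measurableT_comp (measurable_ray c) (@measurable_signal _ _ _ _)). Qed.

(** The error of [k1] is removed while [k2] still appears through its noisy measurement; then the
    error of [k2] is removed, with the ray of [k1] as part of the weight. *)
Lemma two_rays c1 c2 :
  \int[prob S]_w (V w * (signal1 S k1 w < c1)%R%:R
     * (signal1 S k2 w < c2)%R%:R) =
  \int[prob S0]_w (V0 w * (signal1 S0 k1 w < c1)%R%:R
     * (signal1 S0 k2 w < c2)%R%:R).
Proof.
have mS (S' : structure R T) (W : Defs.space S' -> R) X :
    L1 (prob S') W -> measurable_fun setT X -> measurable_fun setT (fun w => W w * X w).
  by move=> LW mX; apply: measurable_funM => //; exact: L1_measurable LW.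
have mobs (S' : structure R T) k a b : measurable_fun setT
    (fun w => cos (a * obs1 S' k w + b)).
  by apply: measurable_cos_affine; exact: measurable_obs.
have L2 (S' : structure R T) (W : Defs.space S' -> R) k c :
    L1 (prob S') W -> L1 (prob S') (fun w => W w * (signal1 S' k w < c)%R%:R).
  move=> LW; apply: (@L1M _ _ _ _ _ _ 1) => // w.
  by exact: norm_indicator_le1.
have first a' b' : \int[prob S]_w (U V a' b' w * (signal1 S k1 w < c1)%R%:R) =
    \int[prob S0]_w (U V0 a' b' w * (signal1 S0 k1 w < c1)%R%:R).
  have swap (S' : structure R T) (h' : valid S') (W : Defs.space S' -> R) a b : L1 (prob S') W ->
      \int[prob S']_w (U W a' b' w * cos (a * obs1 S' k1 w + b)) =
      \int[prob S']_w (W w * cos (a' * obs1 S' k2 w + b')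
        * cos (a * obs1 S' k1 w + b)).
    move=> LW; apply: expect_ae.
    - by apply: mS => //; exact: LU.
    - by apply: measurable_funM; [exact: mS|exact: mobs].
    - by apply: filterS (obs_signal h' k2) => w; rewrite /U /noisy => ->.
  apply: (ray_signal hS hS0 SS0); [exact: LU|exact: LU| | |].
  - by apply: mU; apply: mV; left.
  - by apply: mU; apply: mV0; left.
  - by move=> a b; rewrite !swap.
apply: (ray_signal hS hS0 SS0); [exact: L2|exact: L2| | |].
- apply: measurable_funM; first by apply: mV; right.
  exact: (measurableT_comp (measurable_ray c1) (@err_rest_signal _ _ _ _ _)).
- apply: measurable_funM; first by apply: mV0; right.
  exact: (measurableT_comp (measurable_ray c1) (@err_rest_signal _ _ _ _ _)).
move=> a b.
have swap (S' : structure R T) (h' : valid S') (W : Defs.space S' -> R) : L1 (prob S') W ->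
    \int[prob S']_w (W w * (signal1 S' k1 w < c1)%R%:R *
      cos (a * obs1 S' k2 w + b)) =
    \int[prob S']_w (U W a b w * (signal1 S' k1 w < c1)%R%:R).
  move=> LW; apply: expect_ae.
  - by apply: measurable_funM; [exact: mS|exact: mobs].
  - by apply: mS => //; exact: LU.
  - by apply: filterS (obs_signal h' k2) => w; rewrite /U /noisy => ->; ring.
by rewrite !swap.
Qed.

End TwoRays.

Section Targets.
Variables (t : 'I_T) (h : R -> R).
Hypotheses (mh : measurable_fun setT h) (h1 : forall x, `|h x| <= 1).

Let hY (S' : structure R T) w := h (ln_Y (vars S') t w).

Let mhY (S' : structure R T) : measurable_fun setT (@hY S').
Proof.
apply: (measurableT_comp mh); apply: (measurableT_comp (@measurable_ln R)).
exact: measurable_funP.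
Qed.

Let LhY (S' : structure R T) : L1 (prob S') (@hY S').
Proof. by apply: (@L1_bounded _ _ _ _ _ 1) => [|w]; [exact: mhY|exact: h1]. Qed.

Let hY1 (S' : structure R T) w : `|@hY S' w| <= 1.
Proof. exact: h1. Qed.

Let rhY (S' : structure R T) j :
  measurable_fun setT (@hY S' : g_sigma_algebraType (err_rest (vars S') j) -> R).
Proof. by apply: (measurableT_comp mh); exact: err_rest_ln_Y. Qed.

Let hobs (x : obs_index T -> R) := h (ln (x (inl (inl (inl t))))).

Let mhobs : measurable_wrt (@cylinders R (obs_index T)) hobs.
Proof.
apply: (measurableT_comp mh); apply: (measurableT_comp (@measurable_ln R)).
exact: measurable_coord.
Qed.

Let mcobs i a b : measurable_fun setT
  ((fun x => cos (a * x i + b)) : g_sigma_algebraType (@cylinders R (obs_index T)) -> R).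
Proof.
apply: (measurableT_comp (@measurable_cosR R)); apply: measurable_funD => //.
by apply: measurable_funM => //; exact: measurable_coord.
Qed.

Lemma two_rays_prob k1 k2 c1 c2 : k2 != k1 ->
  \int[prob S]_w (@hY S w * (signal1 S k1 w < c1)%R%:R
     * (signal1 S k2 w < c2)%R%:R) =
  \int[prob S0]_w (@hY S0 w * (signal1 S0 k1 w < c1)%R%:R
     * (signal1 S0 k2 w < c2)%R%:R).
Proof.
move=> k12; apply: two_rays => // a b a' b'.
apply: (obs_expect SS0 (phi := fun x => hobs x * cos (a' * x (obs_lat k2 ord0) + b')
  * cos (a * x (obs_lat k1 ord0) + b))).
  by apply: measurable_funM => //; exact: measurable_funM.
by apply: L1_osc; [apply: L1_osc => //|]; exact: measurable_obs.
Qed.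

Lemma one_ray_prob k c :
  \int[prob S]_w (@hY S w * (signal1 S k w < c)%R%:R) =
  \int[prob S0]_w (@hY S0 w * (signal1 S0 k w < c)%R%:R).
Proof.
apply: (ray_signal hS hS0 SS0) => // a b.
apply: (obs_expect SS0 (phi := fun x => hobs x * cos (a * x (obs_lat k ord0) + b))).
  exact: measurable_funM.
by apply: L1_osc => //; exact: measurable_obs.
Qed.

(* The error of the first measurement of the target averages out against
   quantities that do not involve it. *)
Let target (S' : structure R T) (h' : valid S') j (V : Defs.space S' -> R) :
  measurable_fun setT V -> (forall w, `|V w| <= 1) ->
  (exists2 V' : Defs.space S' -> R, measurable_fun setT V' &
    measurable_wrt (err_rest1 S' j) V' /\
    \forall w \ae prob S', V w = V' w) ->
  \int[prob S']_w (signal1 S' j w * V w) =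
  \int[prob S']_w (obs1 S' j w * V w).
Proof.
move=> mV V1 [V' mV' [rV' VV']].
have LV : L1 (prob S') V by exact: (@L1_bounded _ _ _ _ _ 1).
have LV' : L1 (prob S') V' by exact: (L1_ae LV).
have [Le Ee] := err_orthogonal h' rV' LV'.
have LeV : L1 (prob S') (fun w => err1 S' j w * V w).
  by apply: (@L1M _ _ _ _ _ _ 1) => //; exact: L1_err.
have LsV : L1 (prob S') (fun w => signal1 S' j w * V w).
  by apply: (@L1M _ _ _ _ _ _ 1) => //; exact: L1_signal.
have -> : \int[prob S']_w (obs1 S' j w * V w) =
    \int[prob S']_w (signal1 S' j w * V w + err1 S' j w * V w).
  apply: expect_ae.
  - by apply: measurable_funM => //; exact: measurable_obs.
  - by apply: measurable_funD; [exact: L1_measurable LsV|exact: L1_measurable LeV].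
  - by apply: filterS (obs_signal h' j) => w ->; rewrite mulrDl.
rewrite expectD//.
have -> : \int[prob S']_w (err1 S' j w * V w) = 0.
  rewrite -Ee; apply: expect_ae; [exact: L1_measurable LeV|exact: L1_measurable Le|].
  by apply: filterS VV' => w ->.
by rewrite addr0.
Qed.

(** The target enters linearly, so replacing its signal by the noisy measurement leaves the mean
    unchanged; only the conditioning variable has to be deconvolved. *)
Lemma one_ray_target k j c : j != k ->
  \int[prob S]_w (signal1 S j w * @hY S w * (signal1 S k w < c)%R%:R) =
  \int[prob S0]_w (signal1 S0 j w * @hY S0 w * (signal1 S0 k w < c)%R%:R).
Proof.
move=> jk.
have LsV (S' : structure R T) : valid S' -> L1 (prob S') (fun w => signal1 S' j w * @hY S' w).
  by move=> h'; apply: (@L1M _ _ _ _ _ _ 1) => //; exact: L1_signal.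
apply: (ray_signal hS hS0 SS0); [exact: LsV|exact: LsV| | |].
- by apply: measurable_funM => //; exact: err_rest_signal.
- by apply: measurable_funM => //; exact: err_rest_signal.
move=> a b.
have swap (S' : structure R T) : valid S' ->
    \int[prob S']_w (signal1 S' j w * @hY S' w * cos (a * obs1 S' k w + b)) =
    \int[prob S']_w (obs1 S' j w *
      (@hY S' w * cos (a * obs1 S' k w + b))).
  move=> h'; rewrite -target//.
  - by apply: eq_Rintegral => w _; rewrite mulrA.
  - by apply: measurable_funM => //; apply: measurable_cos_affine; exact: measurable_obs.
  - by move=> w; apply: normrM_le1; [exact: hY1|exact: cos_le1].
  - exists (fun w => @hY S' w * cos (a * (signal1 S' k w + err1 S' k w) + b)).
      apply: measurable_funM => //; apply: measurable_cos_affine.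
      by apply: measurable_funD; [exact: measurable_signal|exact: measurable_err].
    split.
      apply: measurable_funM => //; apply: (measurableT_comp (@measurable_cosR R)).
      apply: measurable_funD => //; apply: measurable_funM => //; apply: measurable_funD.
        exact: err_rest_signal.
      by apply: err_rest_err; apply/eqP => /err_lat_inj[kE _]; move: jk; rewrite kE eqxx.
    by apply: filterS (obs_signal h' k) => w ->.
rewrite !swap//.
apply: (obs_expect SS0 (phi := fun x => x (obs_lat j ord0) * (hobs x * cos (a * x (obs_lat k ord0) + b)))).
  by apply: measurable_funM; [exact: measurable_coord|exact: measurable_funM].
apply: (@L1M _ _ _ _ _ _ 1); first exact: L1_obs.
  by apply: measurable_funM => //; apply: measurable_cos_affine; exact: measurable_obs.
by move=> w; apply: normrM_le1; [exact: hY1|exact: cos_le1].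
Qed.

Lemma two_rays_target k1 k2 j c1 c2 : k2 != k1 -> j != k1 -> j != k2 ->
  \int[prob S]_w (signal1 S j w * @hY S w * (signal1 S k1 w < c1)%R%:R
     * (signal1 S k2 w < c2)%R%:R) =
  \int[prob S0]_w (signal1 S0 j w * @hY S0 w * (signal1 S0 k1 w < c1)%R%:R
     * (signal1 S0 k2 w < c2)%R%:R).
Proof.
move=> k12 jk1 jk2.
have LsV (S' : structure R T) : valid S' -> L1 (prob S') (fun w => signal1 S' j w * @hY S' w).
  by move=> h'; apply: (@L1M _ _ _ _ _ _ 1) => //; exact: L1_signal.
have rV (S' : structure R T) i : measurable_fun setT ((fun w => signal1 S' j w * @hY S' w)
     : g_sigma_algebraType (err_rest (vars S') i) -> R).
  by apply: measurable_funM => //; exact: err_rest_signal.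
apply: two_rays => //; [exact: LsV|exact: LsV|move=> a b a' b'].
have mC (S' : structure R T) k c e : measurable_fun setT (fun w => cos (c * obs1 S' k w + e)).
  by apply: measurable_cos_affine; exact: measurable_obs.
have swap (S' : structure R T) : valid S' ->
    \int[prob S']_w (signal1 S' j w * @hY S' w * cos (a' * obs1 S' k2 w + b')
      * cos (a * obs1 S' k1 w + b)) =
    \int[prob S']_w (obs1 S' j w *
      (@hY S' w * cos (a' * obs1 S' k2 w + b')
       * cos (a * obs1 S' k1 w + b))).
  move=> h'; rewrite -target//.
  - by apply: eq_Rintegral => w _; rewrite !mulrA.
  - by apply: measurable_funM => //; exact: measurable_funM.
  - move=> w; apply: normrM_le1; last exact: cos_le1.
    by apply: normrM_le1; [exact: hY1|exact: cos_le1].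
  - exists (fun w => @hY S' w *
      cos (a' * (signal1 S' k2 w + err1 S' k2 w) + b') *
      cos (a * (signal1 S' k1 w + err1 S' k1 w) + b)).
      apply: measurable_funM; first apply: measurable_funM => //;
        by apply: measurable_cos_affine; apply: measurable_funD; [exact: measurable_signal|exact: measurable_err].
    split.
      have mcr k c e : j != k -> measurable_fun setT
          ((fun w => cos (c * (signal1 S' k w + err1 S' k w) + e))
            : g_sigma_algebraType (err_rest1 S' j) -> R).
        move=> jk; apply: (measurableT_comp (@measurable_cosR R)).
        apply: measurable_funD => //; apply: measurable_funM => //; apply: measurable_funD.
          exact: err_rest_signal.
        by apply: err_rest_err; apply/eqP => /err_lat_inj[kE _]; move: jk; rewrite kE eqxx.
      by apply: measurable_funM; [apply: measurable_funM => //|]; exact: mcr.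
    by apply: filterS2 (obs_signal h' k1) (obs_signal h' k2) => w -> ->.
rewrite !swap//.
apply: (obs_expect SS0 (phi := fun x => x (obs_lat j ord0) * (hobs x *
  cos (a' * x (obs_lat k2 ord0) + b') * cos (a * x (obs_lat k1 ord0) + b)))).
  by apply: measurable_funM; [exact: measurable_coord|apply: measurable_funM => //; exact: measurable_funM].
apply: (@L1M _ _ _ _ _ _ 1); first exact: L1_obs.
  by apply: measurable_funM => //; exact: measurable_funM.
move=> w; apply: normrM_le1; last exact: cos_le1.
by apply: normrM_le1; [exact: hY1|exact: cos_le1].
Qed.

End Targets.

End Boxes.

Lemma derive_locally_eq (R : realType) (f g : R -> R) (x a b : R) :
  (\forall t \near x, f t = g t) -> is_derive x 1 f a -> is_derive x 1 g b -> a = b.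
Proof.
move=> fg [_ <-] [_ <-]; apply: near_eq_derive => //.
Qed.

(** * Parameters of a log CES function from its values on an open box *)

Section CES.
Context (R : realType).

(** The CES aggregate in logarithmic coordinates, where powers become exponentials. *)
Definition ces_log (A B al be x w : R) : R := A * expR (al * x) + B * expR (be * w).

Variables (A B al be c A0 B0 al0 be0 c0 : R).
Hypotheses (An0 : A != 0) (Bn0 : B != 0) (aln0 : al != 0) (ben0 : be != 0) (cn0 : c != 0).
Hypotheses (A0n0 : A0 != 0) (B0n0 : B0 != 0) (al0n0 : al0 != 0) (be0n0 : be0 != 0) (c0n0 : c0 != 0).
Variables (x0 w0 e : R).
Hypothesis e0 : 0 < e.

Let box x w := `|x - x0| < e /\ `|w - w0| < e.

Hypothesis G0 : forall x w, box x w -> 0 < ces_log A B al be x w.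
Hypothesis G00 : forall x w, box x w -> 0 < ces_log A0 B0 al0 be0 x w.
Hypothesis E : forall x w, box x w ->
  c * ln (ces_log A B al be x w) = c0 * ln (ces_log A0 B0 al0 be0 x w).

Let near_ball (x y : R) : `|x - y| < e -> \forall t \near x, `|t - y| < e.
Proof.
move=> xy; have : open (ball y e) by exact: ball_open.
rewrite openE => /(_ x); rewrite /ball/= distrC => /(_ xy).
by apply: filterS => t; rewrite /ball/= distrC.
Qed.

Let derive_exp (al' x : R) : is_derive x 1 (fun t => expR (al' * t)) (al' * expR (al' * x)).
Proof.
have D : is_derive x 1 (fun t => al' * t) al'.
  apply: (is_derive_eq (is_deriveM (is_derive_cst al' x (1 : R)) (is_derive_id x (1 : R)))).
  by rewrite /GRing.scale/=; ring.
apply: (is_derive_eq (is_derive1_comp (is_derive_expR (al' * x)) D)); ring.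
Qed.

Let derive_ln (f : R -> R) (x a k : R) : is_derive x 1 f a -> 0 < f x ->
  is_derive x 1 (fun t => k * ln (f t)) (k * (a / f x)).
Proof.
move=> fD fx; have D := is_derive1_comp (is_derive1_ln fx) fD.
apply: (is_derive_eq (is_deriveM (is_derive_cst k x (1 : R)) D)).
by rewrite /GRing.scale/=; ring.
Qed.

Let dx A' B' al' be' c' x w : 0 < ces_log A' B' al' be' x w ->
  is_derive x 1 (fun t => c' * ln (ces_log A' B' al' be' t w))
    (c' * (A' * (al' * expR (al' * x)) / ces_log A' B' al' be' x w)).
Proof.
move=> g0; apply: (@derive_ln (fun t => ces_log A' B' al' be' t w) x (A' * (al' * expR (al' * x))) c' _ g0).
apply: (is_derive_eq (is_deriveD (is_deriveM (is_derive_cst A' x (1 : R)) (derive_exp al' x))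
  (is_derive_cst (B' * expR (be' * w)) x (1 : R)))).
by rewrite /GRing.scale/=; ring.
Qed.

Let partial_eq A' B' al' be' c' A1 B1 al1 be1 c1 x w :
  0 < ces_log A' B' al' be' x w -> 0 < ces_log A1 B1 al1 be1 x w ->
  (\forall t \near x, c' * ln (ces_log A' B' al' be' t w) = c1 * ln (ces_log A1 B1 al1 be1 t w)) ->
  c' * A' * al' * expR (al' * x) * ces_log A1 B1 al1 be1 x w =
  c1 * A1 * al1 * expR (al1 * x) * ces_log A' B' al' be' x w.
Proof.
move=> gt0 gt1 H; have := derive_locally_eq H (dx c' gt0) (dx c1 gt1).
move: (lt0r_neq0 gt0) (lt0r_neq0 gt1).
set g := ces_log A' _ _ _ _ _; set g' := ces_log A1 _ _ _ _ _ => g1 g2 H1.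
have -> : c' * A' * al' * expR (al' * x) * g' = c' * (A' * (al' * expR (al' * x)) / g) * (g * g') by field.
by rewrite H1; field.
Qed.

Let ces_logC A' B' al' be' x w : ces_log A' B' al' be' x w = ces_log B' A' be' al' w x.
Proof. exact: addrC. Qed.

Let Ew x w : box x w ->
  c * B * be * expR (be * w) * ces_log A0 B0 al0 be0 x w =
  c0 * B0 * be0 * expR (be0 * w) * ces_log A B al be x w.
Proof.
move=> xw; have [bx bw] := xw.
rewrite (ces_logC A) (ces_logC A0); apply: partial_eq.
- by rewrite ces_logC; exact: G0.
- by rewrite ces_logC; exact: G00.
- by apply: filterS (near_ball bw) => t tw; rewrite (ces_logC B) (ces_logC B0); exact: E.
Qed.

Let Ex x w : box x w ->
  c * A * al * expR (al * x) * ces_log A0 B0 al0 be0 x w =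
  c0 * A0 * al0 * expR (al0 * x) * ces_log A B al be x w.
Proof.
move=> xw; have [bx bw] := xw; apply: partial_eq; [exact: G0|exact: G00|].
by apply: filterS (near_ball bx) => t tx; exact: E.
Qed.

(* Dividing one partial derivative by the other separates x from w. *)
Let ratio x w : box x w ->
  A * al * B0 * be0 * expR ((al - al0) * x) = A0 * al0 * B * be * expR ((be - be0) * w).
Proof.
move=> xw; have gt0 := G0 xw; have gt00 := G00 xw; have e1 := Ex xw; have e2 := Ew xw.
have H : A * al * B0 * be0 * expR (al * x) * expR (be0 * w) =
   A0 * al0 * B * be * expR (al0 * x) * expR (be * w).
  apply: (mulIf (x := c * c0 * ces_log A B al be x w * ces_log A0 B0 al0 be0 x w)).
    by rewrite !mulf_neq0// gt_eqF.
  transitivity ((c * A * al * expR (al * x) * ces_log A0 B0 al0 be0 x w) *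
     (c0 * B0 * be0 * expR (be0 * w) * ces_log A B al be x w)); first by ring.
  by rewrite e1 -e2; ring.
rewrite !mulrBl !expRD !expRN.
have n1 : expR (al0 * x) != 0 by rewrite gt_eqF// expR_gt0.
have n2 : expR (be0 * w) != 0 by rewrite gt_eqF// expR_gt0.
have -> : A * al * B0 * be0 * (expR (al * x) / expR (al0 * x)) =
  A * al * B0 * be0 * expR (al * x) * expR (be0 * w) / (expR (al0 * x) * expR (be0 * w)) by field; rewrite n1 n2.
by rewrite H; field; rewrite n1 n2.
Qed.

(** Moving one coordinate at a time in [ratio] equates the exponents. The ratio then says that (A,
    B) and (A0, B0) are proportional, a partial derivative gives [c], and the value of the function
    itself fixes the factor of proportionality. *)
Lemma ces_log_unique : [/\ A = A0, B = B0, al = al0, be = be0 & c = c0].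
Proof.
have b00 : box x0 w0 by rewrite /box !subrr normr0.
have e2 : `|e / 2| < e by rewrite gtr0_norm ?divr_gt0// ltr_pdivrMr// ltr_pMr// ltr1n.
have e2n : e / 2 != 0 by rewrite gt_eqF// divr_gt0.
have bx : box (x0 + e / 2) w0 by rewrite /box (_ : x0 + e / 2 - x0 = e / 2) ?subrr ?normr0//; ring.
have bw : box x0 (w0 + e / 2) by rewrite /box (_ : w0 + e / 2 - w0 = e / 2) ?subrr ?normr0//; ring.
have K0 : A * al * B0 * be0 != 0 by rewrite !mulf_neq0.
have K1 : A0 * al0 * B * be != 0 by rewrite !mulf_neq0.
have alE : al = al0.
  have : expR ((al - al0) * x0) = expR ((al - al0) * (x0 + e / 2)).
    by apply: (mulfI K0); rewrite (ratio b00) (ratio bx).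
  move=> /expR_inj H.
  have : (al - al0) * (e / 2) = 0 by move: H; rewrite mulrDr; lra.
  by move=> /eqP; rewrite mulf_eq0 (negbTE e2n) orbF subr_eq0 => /eqP.
have beE : be = be0.
  have : expR ((be - be0) * w0) = expR ((be - be0) * (w0 + e / 2)).
    by apply: (mulfI K1); rewrite -(ratio b00) -(ratio bw).
  move=> /expR_inj H.
  have : (be - be0) * (e / 2) = 0 by move: H; rewrite mulrDr; lra.
  by move=> /eqP; rewrite mulf_eq0 (negbTE e2n) orbF subr_eq0 => /eqP.
have AB : A * B0 = A0 * B.
  have := ratio b00; rewrite alE beE !subrr !mul0r expR0 !mulr1 => H.
  apply: (mulIf (x := al0 * be0)); first by rewrite mulf_neq0.
  transitivity (A * al0 * B0 * be0); first by ring.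
  by rewrite H; ring.
have cE : c = c0.
  have := Ex b00; rewrite alE beE.
  have := G00 b00; rewrite /ces_log; set X := expR _; set W := expR _ => g0 H.
  have X0 : X != 0 by rewrite gt_eqF// expR_gt0.
  apply: (mulIf (x := A * al0 * X * (A0 * X + B0 * W))); first by rewrite !mulf_neq0// gt_eqF.
  transitivity (c * A * al0 * X * (A0 * X + B0 * W)); first by ring.
  rewrite H (_ : c0 * A0 * al0 * X * (A * X + B * W) =
    c0 * al0 * X * (A * A0 * X + A0 * B * W)); first by rewrite -AB; ring.
  by ring.
have := E b00; rewrite cE => /(mulfI c0n0) /(@ln_inj R); rewrite !posrE.
move=> /(_ (G0 b00) (G00 b00)); rewrite /ces_log alE beE => H.
have AA0 : A = A0.
  have := G0 b00; rewrite /ces_log alE beE => g0.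
  apply/eqP; rewrite -subr_eq0; apply/eqP; apply: (mulIf (x := A * expR (al0 * x0) + B * expR (be0 * w0))).
    by rewrite gt_eqF.
  rewrite mul0r (_ : (A - A0) * _ = A * ((A * expR (al0 * x0) + B * expR (be0 * w0)) -
     A0 * expR (al0 * x0)) - (A0 * B) * expR (be0 * w0)); last by ring.
  by rewrite H -AB; ring.
split => //; apply: (mulfI A0n0).
by rewrite -AB AA0.
Qed.

End CES.

(** * Balls and open sets in three coordinates *)

Lemma nbhs_box (R : realType) (z : R * R * R) (U : set (R * R * R)) : nbhs z U ->
  exists2 r, 0 < r & forall z', ball z r z' -> U z'.
Proof. by move=> /nbhs_ballP[r /= r0 rU]; exists r. Qed.

Lemma ball3E (R : realType) (z z' : R * R * R) (r : R) : ball z r z' <->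
  [/\ `|z'.1.1 - z.1.1| < r, `|z'.1.2 - z.1.2| < r & `|z'.2 - z.2| < r].
Proof.
rewrite /ball/= /prod_ball /ball/= /prod_ball/= /ball/= ![`|z'.1.1 - _|]distrC ![`|z'.1.2 - _|]distrC ![`|z'.2 - _|]distrC.
by split=> [[[]]|[]].
Qed.

Section OpenPreimage.
Context (R : realType) (d : measure_display) (Om : measurableType d).
Variables X1 X2 X3 : Om -> R.
Hypotheses (mX1 : measurable_fun setT X1) (mX2 : measurable_fun setT X2)
  (mX3 : measurable_fun setT X3).

(* The product sigma-algebra is not known to contain the open sets, hence the
   covering by rational balls. *)
Lemma measurable_open3 (U : set (R * R * R)) : open U ->
  measurable [set w | U (X1 w, X2 w, X3 w)].
Proof.
move=> oU.
pose B (i : rat * rat * rat * nat) : set (R * R * R) :=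
  ball ((ratr i.1.1.1, ratr i.1.1.2, ratr i.1.2) : R * R * R) i.2.+1%:R^-1.
pose F i : set Om := if `[< B i `<=` U >] then [set w | B i (X1 w, X2 w, X3 w)] else set0.
have -> : [set w | U (X1 w, X2 w, X3 w)] = \bigcup_i F i.
  apply/seteqP; split=> [w Uw|w [i _]]; last by rewrite /F; case: asboolP => // BU /BU.
  have /nbhs_box[r r0 rU] := open_nbhs_nbhs (conj oU Uw).
  have r2 : 0 < r / 2 by rewrite divr_gt0.
  have /ltr_add_invr[n] := r2; rewrite add0r => nr.
  have n0 : 0 < n.+1%:R^-1 :> R by rewrite invr_gt0.
  have near (x e : R) : 0 < e -> exists q : rat, `|x - ratr q| < e.
    move=> e0; have [|q] := @rat_in_itvoo R (x - e) (x + e); first lra.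
    by rewrite in_itv/= => /andP[h1 h2]; exists q; rewrite ltr_norml; apply/andP; split; lra.
  have [q1 h1] := near (X1 w) _ n0; have [q2 h2] := near (X2 w) _ n0; have [q3 h3] := near (X3 w) _ n0.
  exists (q1, q2, q3, n) => //; rewrite /F; case: asboolP => [_|[]]; first exact/ball3E.
  move=> z /ball3E/=[k1 k2 k3]; apply: rU; apply/ball3E => /=.
  move: h1 h2 h3 k1 k2 k3 nr; set e := _^-1; rewrite !ltr_norml => /andP[? ?] /andP[? ?] /andP[? ?].
  by move=> /andP[? ?] /andP[? ?] /andP[? ?] ?; split; apply/andP; split; lra.
apply: countable_bigcupT_measurable => [|i]; first exact: countableP.
rewrite /F; case: asboolP => // _.
have -> : [set w | B i (X1 w, X2 w, X3 w)] =
    (X1 @^-1` ball (ratr i.1.1.1 : R) i.2.+1%:R^-1 `&` X2 @^-1` ball (ratr i.1.1.2 : R) i.2.+1%:R^-1)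
    `&` X3 @^-1` ball (ratr i.1.2 : R) i.2.+1%:R^-1.
  by apply/seteqP; split.
have mb (X : Om -> R) x r : measurable_fun setT X -> measurable (X @^-1` ball x r).
  move=> mX; rewrite -[X in measurable X]setTI; apply: mX => //.
  by apply: open_measurable; exact: ball_open.
by apply: measurableI; [apply: measurableI|]; exact: mb.
Qed.

End OpenPreimage.

(** * Support of skills, investment and income in signal coordinates *)

Section LogAffine.
Context (R : realType).

(** Inverse of u -> mu + la ln u on the positive reals. Income uses mu = 0 and la = 1. *)
Definition inv_ln (mu la x : R) : R := expR ((x - mu) / la).

Lemma inv_lnK mu la x : la != 0 -> mu + la * ln (inv_ln mu la x) = x.
Proof. by move=> la0; rewrite /inv_ln expRK; field. Qed.

Lemma ln_affineK mu la u : la != 0 -> 0 < u -> inv_ln mu la (mu + la * ln u) = u.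
Proof. by move=> la0 u0; rewrite /inv_ln [X in expR X](_ : _ = ln u) ?lnK//; field. Qed.

Lemma inv_ln_continuous mu la : continuous (inv_ln mu la).
Proof.
move=> x; apply: continuous_comp; last exact: continuous_expR.
by apply: cvgM; [apply: cvgB; [exact: cvg_id|exact: cvg_cst]|exact: cvg_cst].
Qed.

Lemma ln_affine_continuous mu la (x : R) : 0 < x -> {for x, continuous (fun u => mu + la * ln u)}.
Proof.
move=> x0; apply: cvgD; first exact: cvg_cst.
by apply: cvgM; [exact: cvg_cst|exact: continuous_ln].
Qed.

Lemma continuous_ball (f : R -> R) (x eps : R) : {for x, continuous f} -> 0 < eps ->
  exists2 r, 0 < r & forall u, `|u - x| < r -> `|f u - f x| < eps.
Proof.
move=> /cvgrPdist_lt /(_ eps) fx e0; have /nbhs_ballP[r /= r0 rP] := fx e0.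
by exists r => // u ux; rewrite distrC; apply: rP; rewrite /ball/= distrC.
Qed.

End LogAffine.

Section Support.
Context (R : realType) (T : nat) (S : structure R T).
Hypothesis hS : valid S.

Local Notation P := (prob S).
Local Notation p := (par S).
Local Notation v := (vars S).

Definition coords d (Om : measurableType d) (q : params R T) (u : variables R T Om) (t : 'I_T) w
  : R * R * R := (signal q u (inl (cur t)) w, signal q u (inr t) w, ln_Y u t w).

Lemma measurable_ln_Y t : measurable_fun setT (ln_Y v t).
Proof. by apply: (measurableT_comp (@measurable_ln R)); exact: measurable_funP. Qed.

Lemma measurable_coords_ball t z r : measurable [set w | ball z r (coords p v t w)].
Proof.
apply: (measurable_open3 _ _ _ (ball_open z r)); last exact: measurable_ln_Y.
  exact: measurable_signal.
exact: measurable_signal.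
Qed.

(** Membership of [z] in the support of the law of the two signals and log income. *)
Definition charged t z := forall r, 0 < r -> (0 < P [set w | ball z r (coords p v t w)])%E.

Lemma charged_ae t z (Phi : R * R * R -> Prop) : charged t z ->
  (\forall w \ae P, Phi (coords p v t w)) -> forall r, 0 < r ->
  exists2 z', ball z r z' & Phi z'.
Proof.
move=> cz [N [mN N0 NPhi]] r r0; apply: contrapT => H.
have sub : [set w | ball z r (coords p v t w)] `<=` N.
  move=> w zw; apply: NPhi => Pw; apply: H; by exists (coords p v t w).
have := cz r r0; rewrite ltNge => /negP; apply.
by rewrite -N0 le_measure// inE//; exact: measurable_coords_ball.
Qed.

(** Condition (g) concerns levels. Taking logarithms requires a smaller ball on which all three
    coordinates are positive; there the change of coordinates is a homeomorphism and carries support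
    to support. *)
Lemma rich_point t : exists z0 e, 0 < e /\ forall z, ball z0 e z -> charged t z.
Proof.
have [c [r [r0 supp]]] := valid_support hS t.
have hm := valid_model hS.
(* A point with a negative coordinate has a neighborhood of probability zero, since the variables
   are positive almost surely. *)
have nn z : eball3 c r z -> [/\ 0 <= z.1.1, 0 <= z.1.2 & 0 <= z.2].
  have neg (g : R * R * R -> R) (X : {mfun Defs.space S >-> R}) :
      continuous g -> (forall w, g (theta v (cur t) w, invest v t w, Y v t w) = X w) ->
      (\forall w \ae P, 0 < X w) -> eball3 c r z -> 0 <= g z.
    move=> cg gX [N [mN N0 NX]] /supp zs; rewrite leNgt; apply/negP => gz.
    have oU : open [set z | g z < 0].
      by apply: (@open_comp _ _ g [set x | x < 0]); [move=> x _; exact: cg|exact: open_lt].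
    have := zs _ oU gz; rewrite ltNge => /negP; apply.
    rewrite -N0; apply: le_measure; rewrite ?inE//.
      rewrite (_ : [set w | _] = X @^-1` `]-oo, 0[%classic).
        by rewrite -[X in measurable X]setTI; exact: measurable_funP.
      by apply/seteqP; split => w /=; rewrite in_itv/= gX.
    by move=> w /=; rewrite gX => Xw; apply: NX => X0; move: (lt_trans Xw X0); rewrite ltxx.
  move=> zb; split.
  - apply: (neg (fun z => z.1.1) (theta v (cur t))) => //; last exact: (theta_pos hm).
    by move=> u; apply: (@continuous_comp _ _ _ fst fst); exact: cvg_fst.
  - apply: (neg (fun z => z.1.2) (invest v t)) => //; last exact: (inv_pos hm).
    by move=> u; apply: (@continuous_comp _ _ _ fst snd); [exact: cvg_fst|exact: cvg_snd].
  - apply: (neg (fun z => z.2) (Y v t)) => //; last exact: (Y_pos hm).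
    by move=> u; exact: cvg_snd.
have [c1 c2 c3] : [/\ 0 <= c.1.1, 0 <= c.1.2 & 0 <= c.2].
  by apply: nn; rewrite /eball3/= !subrr !expr0n/= !addr0 exprn_gt0.
have inb a1 a2 a3 : 0 < a1 - c.1.1 < r / 2 -> 0 < a2 - c.1.2 < r / 2 -> 0 < a3 - c.2 < r / 2 ->
    eball3 c r (a1, a2, a3).
  rewrite /eball3/=; move: (a1 - _) (a2 - _) (a3 - _) => x y z /andP[x0 xr] /andP[y0 yr] /andP[z0 zr].
  by nra.
pose mu1 := mu_lat p (inl (cur t)) ord0; pose la1 := la_lat p (inl (cur t)) ord0.
pose mu2 := mu_lat p (inr t) ord0; pose la2 := la_lat p (inr t) ord0.
have la10 : la1 != 0 := la_lat_neq0 hS _ _.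
have la20 : la2 != 0 := la_lat_neq0 hS _ _.
have r4 : 0 < r / 4 by rewrite divr_gt0.
(* The center may have zero coordinates. A shift by r / 4 makes them positive, and deviations below
   r / 4 keep each offset in (0, r / 2), hence inside the ball as 3 (r / 2)^2 < r^2. *)
pose u1 := c.1.1 + r / 4; pose u2 := c.1.2 + r / 4; pose u3 := c.2 + r / 4.
have u10 : 0 < u1 by rewrite /u1; lra.
have u20 : 0 < u2 by rewrite /u2; lra.
have u30 : 0 < u3 by rewrite /u3; lra.
pose x0 := mu1 + la1 * ln u1; pose w0 := mu2 + la2 * ln u2; pose y0 := 0 + 1 * ln u3.
have [e1 e10 e1P] := continuous_ball (@inv_ln_continuous R mu1 la1 x0) r4.
have [e2 e20 e2P] := continuous_ball (@inv_ln_continuous R mu2 la2 w0) r4.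
have [e3 e30 e3P] := continuous_ball (@inv_ln_continuous R 0 1 y0) r4.
exists (x0, w0, y0), (Num.min e1 (Num.min e2 e3)); split; first by rewrite !lt_min e10 e20 e30.
move=> [[x w] y] /ball3E/=; rewrite !lt_min => -[/and3P[xe _ _] /and3P[_ we _] /and3P[_ _ ye]] s s0.
set a1 := inv_ln mu1 la1 x; set a2 := inv_ln mu2 la2 w; set a3 := inv_ln 0 1 y.
have a10 : 0 < a1 by exact: expR_gt0.
have a20 : 0 < a2 by exact: expR_gt0.
have a30 : 0 < a3 by exact: expR_gt0.
have ab : eball3 c r (a1, a2, a3).
  have := e1P _ xe; have := e2P _ we; have := e3P _ ye.
  rewrite !ln_affineK ?oner_eq0// -/a1 -/a2 -/a3 /u1 /u2 /u3 !ltr_norml => /andP[? ?] /andP[? ?] /andP[? ?].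
  by apply: inb; apply/andP; split; lra.
have [d1 d10 d1P] := continuous_ball (@ln_affine_continuous R mu1 la1 a1 a10) s0.
have [d2 d20 d2P] := continuous_ball (@ln_affine_continuous R mu2 la2 a2 a20) s0.
have [d3 d30 d3P] := continuous_ball (@ln_affine_continuous R 0 1 a3 a30) s0.
pose dd := Num.min d1 (Num.min d2 d3).
have dd0 : 0 < dd by rewrite !lt_min d10 d20 d30.
have ob : open (ball (a1, a2, a3) dd) by exact: ball_open.
have := supp _ ab (ball (a1, a2, a3) dd) ob (ballxx _ dd0).
move=> /lt_le_trans; apply; apply: le_measure; rewrite ?inE.
- by apply: measurable_open3 => //; exact: measurable_funP.
- exact: measurable_coords_ball.
move=> om /= /ball3E/=; rewrite !lt_min => -[/and3P[b1 _ _] /and3P[_ b2 _] /and3P[_ _ b3]].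
apply/ball3E; split => /=.
- by have := d1P _ b1; rewrite inv_lnK.
- by have := d2P _ b2; rewrite inv_lnK.
- by have := d3P _ b3; rewrite inv_lnK ?oner_eq0// add0r mul1r.
Qed.

End Support.

(** * Local averages and indicators of intervals *)

Section Comparison.
Context (R : realType).

Lemma local_mean (d : measure_display) (Om : measurableType d) (P : probability Om R)
    (F b : Om -> R) (a eps : R) : L1 P F -> measurable_fun setT b ->
  (forall w, b w = 0 \/ b w = 1) -> (\forall w \ae P, b w = 1 -> `|F w - a| <= eps) ->
  `|\int[P]_w (F w * b w) - a * \int[P]_w b w| <= eps * \int[P]_w b w.
Proof.
move=> LF mb b01 Fa.
have b1 w : `|b w| <= 1 by case: (b01 w) => ->; rewrite ?normr0 ?normr1.
have Lb : L1 P b by exact: (@L1_bounded _ _ _ _ _ 1).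
have LFb : L1 P (fun w => F w * b w) by exact: (@L1M _ _ _ _ _ _ 1).
rewrite ler_norml; apply/andP; split.
  rewrite lerBrDl -mulrBl -expectZ//; apply: expect_le => //; first exact: L1Z.
  apply: filterS Fa => w; case: (b01 w) => -> Fa; first by rewrite !mulr0.
  by move: (Fa erefl); rewrite ler_norml !mulr1 => /andP[]; lra.
rewrite lerBlDl -mulrDl -expectZ//; apply: expect_le => //; first exact: L1Z.
apply: filterS Fa => w; case: (b01 w) => -> Fa; first by rewrite !mulr0.
by move: (Fa erefl); rewrite ler_norml !mulr1 => /andP[]; lra.
Qed.

(** Indicator of a half-open interval, written as the difference of two rays because deconvolution
    delivers rays. *)
Definition itv_ind (r x z : R) : R := (z < x + r)%R%:R - (z < x - r)%R%:R.

Lemma itv_ind01 r x z : 0 < r -> itv_ind r x z = (x - r <= z < x + r)%R%:R.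
Proof.
move=> r0; rewrite /itv_ind; case: (ltP z (x - r)) => zx.
  by rewrite (lt_trans zx) ?subrr//; lra.
by rewrite subr0; case: (_ < _).
Qed.

Lemma measurable_itv_ind r x : measurable_fun setT (itv_ind r x).
Proof. by apply: measurable_funB; exact: measurable_ray. Qed.

Lemma expect_two_itv (d : measure_display) (Om : measurableType d) (P : probability Om R)
    (V X W : Om -> R) r x r' x' : L1 P V -> measurable_fun setT X -> measurable_fun setT W ->
  \int[P]_w (V w * itv_ind r x (X w) * itv_ind r' x' (W w)) =
  \int[P]_w (V w * (X w < x + r)%R%:R * (W w < x' + r')%R%:R)
  - \int[P]_w (V w * (X w < x + r)%R%:R * (W w < x' - r')%R%:R)
  - (\int[P]_w (V w * (X w < x - r)%R%:R * (W w < x' + r')%R%:R)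
  - \int[P]_w (V w * (X w < x - r)%R%:R * (W w < x' - r')%R%:R)).
Proof.
move=> LV mX mW.
have mr (Z : Om -> R) c : measurable_fun setT Z -> measurable_fun setT (fun w => (Z w < c)%R%:R : R).
  by move=> mZ; exact: (measurableT_comp (measurable_ray c) mZ).
have L c c' : L1 P (fun w => V w * (X w < c)%R%:R * (W w < c')%R%:R).
  apply: (@L1M _ _ _ _ _ _ 1); [|exact: mr|by move=> w; exact: norm_indicator_le1].
  by apply: (@L1M _ _ _ _ _ _ 1); [|exact: mr|move=> w; exact: norm_indicator_le1].
rewrite -!expectB//; [|exact: L1B|exact: L1B].
by apply: eq_Rintegral => w _; rewrite /itv_ind; ring.
Qed.

Lemma expect_one_itv (d : measure_display) (Om : measurableType d) (P : probability Om R)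
    (V X : Om -> R) r x : L1 P V -> measurable_fun setT X ->
  \int[P]_w (V w * itv_ind r x (X w)) =
  \int[P]_w (V w * (X w < x + r)%R%:R) - \int[P]_w (V w * (X w < x - r)%R%:R).
Proof.
move=> LV mX.
have L c : L1 P (fun w => V w * (X w < c)%R%:R).
  apply: (@L1M _ _ _ _ _ _ 1) => //; last by move=> w; exact: norm_indicator_le1.
  exact: (measurableT_comp (measurable_ray c) mX).
rewrite -!expectB//.
by apply: eq_Rintegral => w _; rewrite /itv_ind; ring.
Qed.

Definition sigma_gen (Om : Type) (S : set (Om -> R)) : set (set Om) :=
  \bigcup_(X in S) preimage_set_system setT X measurable.

Lemma measurable_sigma_gen (Om : pointedType) (S : set (Om -> R)) (X : Om -> R) : S X ->
  measurable_wrt (sigma_gen S) X.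
Proof. by move=> SX _ B mB; rewrite setTI; exact: sigma_of_preimage. Qed.

Lemma cond_exp_test (d : measure_display) (Om : measurableType d) (P : probability Om R)
    (S : set (Om -> R)) (X f b : Om -> R) : sigma_of S `<=` measurable ->
  is_cond_exp P X (sigma_of S) f ->
  measurable_wrt (sigma_gen S) b ->
  (forall w, b w = 0 \/ b w = 1) ->
  \int[P]_w (X w * b w) = \int[P]_w (f w * b w).
Proof.
move=> SM [_ _ _ XE] mb b01.
have sA : sigma_of S (b @^-1` [set 1]) by have := mb measurableT [set 1] (measurable_set1 1); rewrite setTI.
have bE : b = \1_(b @^-1` [set 1]).
  apply/funext => w; rewrite indicE; case: (b01 w) => bw.
    by rewrite memNset ?bw//= bw => /esym/eqP; rewrite oner_eq0.
  by rewrite mem_set.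
have mA := SM _ sA.
rewrite bE !expect_restrict//.
by congr fine; rewrite XE.
Qed.

End Comparison.

(** * The investment and production equations in terms of signals *)

Section CESSignal.
Context (R : realType) (T : nat) (d : measure_display) (Om : measurableType d).
Variables (q : params R T) (v : variables R T Om).

Lemma ces_signal t w : admissible q -> 0 < theta v (cur t) w -> 0 < invest v t w ->
  ces_log (gamma1_t q t) (gamma2_t q t) (sigma q t / la_th q (cur t) ord0)
    (sigma q t / la_I q t ord0) (signal q v (inl (cur t)) w) (signal q v (inr t) w) =
  expR (sigma q t * (mu_th q (nxt t) ord0 / (la_th q (nxt t) ord0 * psi q t))) * ces q v t w.
Proof.
move=> [/(_ _ ord0) lth /(_ t ord0) l3 _ _ /(_ t)[s0 psi0]] th0 i0.
have l1 := lth (cur t); have l2 := lth (nxt t).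
rewrite /ces_log /ces /gamma1_t /gamma2_t /signal/= /powR !gt_eqF// [RHS]mulrDr; congr (_ + _).
  rewrite mulrCA -mulrA -!expRD; congr (_ * expR _).
  by rewrite /ln_th; field; rewrite l1 l2 psi0.
rewrite mulrCA -mulrA -!expRD; congr (_ * expR _).
by rewrite /ln_I; field; rewrite l2 l3 psi0.
Qed.

End CESSignal.

Section Equations.
Context (R : realType) (T : nat) (S : structure R T).
Hypothesis hS : valid S.

Local Notation P := (prob S).
Local Notation p := (par S).
Local Notation v := (vars S).

Definition scale_t (q : params R T) (t : 'I_T) : R :=
  la_th q (nxt t) ord0 * psi q t / sigma q t.

Lemma investment_signal t : \forall w \ae P, signal p v (inr t) w =
  beta0_t p t + beta1_t p t * signal p v (inl (cur t)) w + beta2_t p t * ln_Y v t w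
  + la_I p t ord0 * eta_I v t w.
Proof.
have lth : la_th p (cur t) ord0 != 0 := la_lat_neq0 hS (inl (cur t)) ord0.
apply: filterS (investment (valid_model hS) t) => w; rewrite /signal/= => ->.
by rewrite /beta0_t /beta1_t /beta2_t; field.
Qed.

Lemma production_signal t : \forall w \ae P,
  let G := ces_log (gamma1_t p t) (gamma2_t p t) (sigma p t / la_th p (cur t) ord0)
    (sigma p t / la_I p t ord0) (signal p v (inl (cur t)) w) (signal p v (inr t) w) in
  0 < G /\ signal p v (inl (nxt t)) w = scale_t p t * ln G + la_th p (nxt t) ord0 * eta_th v t w.
Proof.
have l2 : la_th p (nxt t) ord0 != 0 := la_lat_neq0 hS (inl (nxt t)) ord0.
have [_ _ _ _ /(_ t)[s0 psi0]] := valid_params hS.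
have hm := valid_model hS.
have H1 : \forall w \ae P, 0 < theta v (cur t) w /\ 0 < invest v t w.
  by apply: filterS2 (theta_pos hm (cur t)) (inv_pos hm t) => w.
have H2 : \forall w \ae P, 0 < ces p v t w /\ theta v (nxt t) w =
    ces p v t w `^ (psi p t / sigma p t) * expR (eta_th v t w).
  by apply: filterS2 (ces_pos hm t) (production hm t) => w.
apply: filterS2 H1 H2 => w [th0 i0] [c0 prodE]; set G := ces_log _ _ _ _ _ _; cbv zeta.
pose K := expR (sigma p t * (mu_th p (nxt t) ord0 / (la_th p (nxt t) ord0 * psi p t))).
have K0 : 0 < K by exact: expR_gt0.
have GE : G = K * ces p v t w := ces_signal (valid_params hS) th0 i0.
have G0 : 0 < G by rewrite GE mulr_gt0.
split=> //.
have lnth : ln (theta v (nxt t) w) = psi p t / sigma p t * ln (ces p v t w) + eta_th v t w.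
  by rewrite prodE lnM ?posrE ?powR_gt0 ?expR_gt0// ln_powR expRK.
rewrite GE lnM ?posrE// expRK /signal/= /ln_th lnth /scale_t.
by field; rewrite l2 s0 psi0.
Qed.

End Equations.

Lemma compare_means (R : realType) (I a a' e e' p : R) : 0 < p ->
  `|I - a * p| <= e * p -> `|I - a' * p| <= e' * p -> `|a - a'| <= e + e'.
Proof.
move=> p0 h h'; rewrite -(ler_pM2r p0) mulrDl.
have -> : `|a - a'| * p = `|(I - a' * p) - (I - a * p)|.
  rewrite (_ : (I - a' * p) - (I - a * p) = (a - a') * p); last by ring.
  by rewrite normrM (gtr0_norm p0).
by rewrite [leRHS]addrC (le_trans (ler_normB _ _))// lerD.
Qed.

Lemma le_eps_eq (R : realType) (a b : R) : (forall e, 0 < e -> `|a - b| <= e) -> a = b.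
Proof.
move=> H; apply/eqP; rewrite -subr_eq0 -normr_le0; apply/ler_addgt0Pr => e e0.
by rewrite add0r; exact: H.
Qed.

Lemma nxt_neq_cur T (t : 'I_T) : nxt t != cur t.
Proof. by apply/eqP => /(congr1 val) /= /eqP; rewrite /bump /= add1n gtn_eqF. Qed.

(** * Boxes around support points and their probabilities *)

Section IndicatorBoxes.
Context (R : realType) (T : nat) (t : 'I_T).
Variable S : structure R T.

Local Notation P := (prob S).
Local Notation v := (vars S).
Local Notation X := (signal1 S (inl (cur t))).
Local Notation W := (signal1 S (inr t)).
Local Notation L := (ln_Y (vars S) t).

(** The investment shock is centered given skills and income only, so its box leaves investment
    free; [full_box] adds investment for the production equation. *)
Definition half_box (z : R * R * R) (r : R) w : R :=
  \1_(ball z.2 r) (L w) * itv_ind r z.1.1 (X w).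
Definition full_box (z : R * R * R) (r : R) w : R :=
  half_box z r w * itv_ind r z.1.2 (W w).

Lemma measurable_ball_ind (y r : R) : measurable_fun setT (\1_(ball y r) : R -> R).
Proof. by apply: measurable_indic; apply: open_measurable; exact: ball_open. Qed.

Lemma measurable_half_box z r : measurable_fun setT (half_box z r).
Proof.
apply: measurable_funM; first exact: (measurableT_comp (@measurable_ball_ind _ _) (@measurable_ln_Y _ _ S t)).
exact: (measurableT_comp (measurable_itv_ind _ _) (@measurable_signal _ _ S _)).
Qed.

Lemma measurable_full_box z r : measurable_fun setT (full_box z r).
Proof.
apply: measurable_funM; first exact: measurable_half_box.
exact: (measurableT_comp (measurable_itv_ind _ _) (@measurable_signal _ _ S _)).
Qed.

Lemma half_boxE z r w : 0 < r -> half_box z r w =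
  ((`|L w - z.2| < r) && (z.1.1 - r <= X w < z.1.1 + r))%R%:R.
Proof.
move=> r0; rewrite /half_box itv_ind01// -[in RHS]mulnb [in RHS]natrM indicE; congr (_%:R * _).
by congr nat_of_bool; apply/idP/idP; rewrite inE /ball/= distrC.
Qed.

Lemma full_boxE z r w : 0 < r -> full_box z r w = ([&& `|L w - z.2| < r,
  z.1.1 - r <= X w < z.1.1 + r & z.1.2 - r <= W w < z.1.2 + r])%R%:R.
Proof.
by move=> r0; rewrite /full_box half_boxE// itv_ind01// -natrM mulnb -andbA.
Qed.

Lemma half_box01 z r w : 0 < r -> half_box z r w = 0 \/ half_box z r w = 1.
Proof. by move=> r0; rewrite half_boxE//; case: (_ && _); [right|left]. Qed.

Lemma full_box01 z r w : 0 < r -> full_box z r w = 0 \/ full_box z r w = 1.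
Proof. by move=> r0; rewrite full_boxE//; case: [&& _, _ & _]; [right|left]. Qed.

Let L1ind (b : Defs.space S -> R) : measurable_fun setT b -> (forall w, b w = 0 \/ b w = 1) -> L1 P b.
Proof.
move=> mb b01; apply: (@L1_bounded _ _ _ _ _ 1) => // w.
by case: (b01 w) => ->; rewrite ?normr0 ?normr1.
Qed.

Lemma L1_half_box z r : 0 < r -> L1 P (half_box z r).
Proof. by move=> r0; apply: L1ind => [|w]; [exact: measurable_half_box|exact: half_box01]. Qed.

Lemma L1_full_box z r : 0 < r -> L1 P (full_box z r).
Proof. by move=> r0; apply: L1ind => [|w]; [exact: measurable_full_box|exact: full_box01]. Qed.

Let charged_gt0 z r (b : Defs.space S -> R) : charged S t z -> 0 < r -> L1 P b ->
  (forall w, ball z r (coords (par S) v t w) -> b w = 1) -> (forall w, b w = 0 \/ b w = 1) ->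
  0 < \int[P]_w b w.
Proof.
move=> cz r0 Lb b1 b01.
have mB := @measurable_coords_ball _ _ S t z r.
have := cz r r0; set B := [set w | _] => PB.
have : 0 < fine (P B) by rewrite fine_gt0// PB/= (le_lt_trans (probability_le1 P mB))// ltry.
move=> /lt_le_trans; apply; rewrite -expect_indic//; apply: expect_le => //; first exact: L1_indic.
apply: aeW => w; rewrite indicE; case: (boolP (w \in B)) => wB.
  by rewrite b1//; rewrite inE in wB.
by case: (b01 w) => ->; rewrite ?ler01.
Qed.

Lemma half_box_gt0 z r : charged S t z -> 0 < r -> 0 < \int[P]_w half_box z r w.
Proof.
move=> cz r0; apply: (charged_gt0 cz r0); [exact: L1_half_box| |by move=> w; exact: half_box01].
move=> w /ball3E[/= hX hW hL].
have hx : z.1.1 - r <= X w < z.1.1 + r.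
  by move: hX; rewrite ltr_norml => /andP[? ?]; apply/andP; split; lra.
by rewrite half_boxE// hL hx.
Qed.

Lemma full_box_gt0 z r : charged S t z -> 0 < r -> 0 < \int[P]_w full_box z r w.
Proof.
move=> cz r0; apply: (charged_gt0 cz r0); [exact: L1_full_box| |by move=> w; exact: full_box01].
move=> w /ball3E[/= hX hW hL].
have hx : z.1.1 - r <= X w < z.1.1 + r.
  by move: hX; rewrite ltr_norml => /andP[? ?]; apply/andP; split; lra.
have hw : z.1.2 - r <= W w < z.1.2 + r.
  by move: hW; rewrite ltr_norml => /andP[? ?]; apply/andP; split; lra.
by rewrite full_boxE// hL hx hw.
Qed.

Lemma full_box_ball z r s w : 0 < r -> r < s -> full_box z r w = 1 ->
  ball z s (coords (par S) v t w).
Proof.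
move=> r0 rs; rewrite full_boxE//; case: (boolP [&& _, _ & _]); last first.
  by move=> _ /eqP; rewrite eq_sym oner_eq0.
move=> /and3P[hL /andP[h1 h2] /andP[h3 h4]] _; apply/ball3E; split => /=.
- by rewrite ltr_norml; apply/andP; split; lra.
- by rewrite ltr_norml; apply/andP; split; lra.
- exact: lt_trans rs.
Qed.

(** With [full_box_gt0], this expresses support points through probabilities of full boxes, which
    the observables determine. *)
Lemma charged_full_box z : (forall r, 0 < r -> 0 < \int[P]_w full_box z r w) -> charged S t z.
Proof.
move=> H r r0; have mB := @measurable_coords_ball _ _ S t z r.
have r2 : 0 < r / 2 by rewrite divr_gt0.
have r2r : r / 2 < r by lra.
suff : 0 < fine (P [set w | ball z r (coords (par S) v t w)]).
  by move=> h; have := h; rewrite -lte_fin fineK// fin_num_measure.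
apply: lt_le_trans (H _ r2) _; rewrite -expect_indic//; apply: expect_le.
- exact: L1_full_box.
- exact: L1_indic.
apply: aeW => w; case: (full_box01 z w r2) => b; rewrite b indicE.
  by case: (_ \in _); rewrite ?ler01.
by rewrite mem_set//; exact: full_box_ball b.
Qed.

End IndicatorBoxes.

(** * Conditional mean restrictions evaluated on boxes *)

Section Shocks.
Context (R : realType) (T : nat) (S : structure R T).
Hypothesis hS : valid S.
Variable t : 'I_T.

Local Notation P := (prob S).
Local Notation p := (par S).
Local Notation v := (vars S).
Local Notation X := (signal1 S (inl (cur t))).
Local Notation W := (signal1 S (inr t)).
Local Notation L := (ln_Y (vars S) t).

Lemma L1_eta_th : L1 P (eta_th v t).
Proof. by have [_ _ _ _ [_ [H _]]] := valid_moments hS; exact: finite_momentsP (H t). Qed.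

Lemma L1_eta_I : L1 P (eta_I v t).
Proof. by have [_ _ _ _ [_ [_ H]]] := valid_moments hS; exact: finite_momentsP (H t). Qed.

Let sub_signal (Z : set (Defs.space S -> R)) : Z (theta v (cur t) : Defs.space S -> R) ->
  measurable_wrt (sigma_gen Z) X.
Proof.
move=> Zt; apply: measurable_funD => //; apply: measurable_funM => //.
by apply: (measurableT_comp (@measurable_ln R)); exact: measurable_sigma_gen.
Qed.

Let sub_ln_Y (Z : set (Defs.space S -> R)) : Z (Y v t : Defs.space S -> R) ->
  measurable_wrt (sigma_gen Z) L.
Proof. by move=> Zt; apply: (measurableT_comp (@measurable_ln R)); exact: measurable_sigma_gen. Qed.

Let sub_half_box (Z : set (Defs.space S -> R)) z r : Z (theta v (cur t) : Defs.space S -> R) ->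
  Z (Y v t : Defs.space S -> R) ->
  measurable_fun setT (half_box t (S := S) z r : g_sigma_algebraType (sigma_gen Z) -> R).
Proof.
move=> Zt ZY; apply: measurable_funM.
  by apply: (measurableT_comp (@measurable_ball_ind _ _ _)); exact: sub_ln_Y.
by apply: (measurableT_comp (measurable_itv_ind _ _)); exact: sub_signal.
Qed.

Lemma eta_I_half_box z r : 0 < r -> \int[P]_w (eta_I v t w * half_box t z r w) = 0.
Proof.
move=> r0; have [H _] := valid_shocks hS.
rewrite (cond_exp_test _ (H t)).
- by under eq_Rintegral do rewrite mul0r; exact: expect_cst.
- by apply: sigma_of_sub_measurable => Z [] ->; exact: measurable_funP.
- by apply: sub_half_box; [left|right].
- by move=> w; exact: half_box01.
Qed.

Lemma eta_th_full_box : exists kappa : R, forall z r, 0 < r ->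
  \int[P]_w (eta_th v t w * full_box t z r w) = kappa * \int[P]_w (eta_I v t w * full_box t z r w).
Proof.
have [_ [kappa H]] := valid_shocks hS.
exists (kappa t) => z r r0.
(* The investment signal expressed by skills, income and the investment shock, hence measurable for
   the conditioning sigma-algebra; it equals the signal almost surely. *)
pose W' w := beta0_t p t + beta1_t p t * X w + beta2_t p t * L w + la_I p t ord0 * eta_I v t w.
pose b w := half_box t z r w * itv_ind r z.1.2 (W' w).
have mW' : measurable_fun setT W'.
  apply: measurable_funD; last by apply: measurable_funM => //; exact: measurable_funP.
  apply: measurable_funD; last by apply: measurable_funM => //; exact: measurable_ln_Y.
  by apply: measurable_funD => //; apply: measurable_funM => //; exact: measurable_signal.
have mb : measurable_fun setT b.
  apply: measurable_funM; first exact: measurable_half_box.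
  exact: (measurableT_comp (measurable_itv_ind _ _) mW').
have fb : \forall w \ae P, full_box t z r w = b w.
  by apply: filterS (investment_signal hS t) => w; rewrite /full_box /b /W' => ->.
have b01 w : b w = 0 \/ b w = 1.
  rewrite /b; case: (half_box01 t (S := S) z w r0) => ->; first by left; rewrite mul0r.
  by rewrite mul1r itv_ind01//; case: (_ && _); [right|left].
have swap (F : Defs.space S -> R) : measurable_fun setT F ->
    \int[P]_w (F w * full_box t z r w) = \int[P]_w (F w * b w).
  move=> mF; apply: expect_ae.
  - by apply: measurable_funM => //; exact: measurable_full_box.
  - exact: measurable_funM.
  - by apply: filterS fb => w ->.
rewrite !swap; [|exact: measurable_funP|exact: measurable_funP].
rewrite (cond_exp_test _ (H t)).
- rewrite -expectZ.
    by apply: eq_Rintegral => w _; rewrite mulrA.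
  apply: (@L1M _ _ _ _ _ _ 1) => //; first exact: L1_eta_I.
  by move=> w; case: (b01 w) => ->; rewrite ?normr0 ?normr1.
- by apply: sigma_of_sub_measurable => Z [[]|] ->; exact: measurable_funP.
- apply: measurable_funM; first by apply: sub_half_box; [left; left|right].
  apply: (measurableT_comp (measurable_itv_ind _ _)).
  apply: measurable_funD; last first.
    by apply: measurable_funM => //; apply: measurable_sigma_gen; left; right.
  apply: measurable_funD; last by apply: measurable_funM => //; apply: sub_ln_Y; right.
  by apply: measurable_funD => //; apply: measurable_funM => //; apply: sub_signal; left; left.
- exact: b01.
Qed.

Definition reg_I (z : R * R * R) : R :=
  beta0_t p t + beta1_t p t * z.1.1 + beta2_t p t * z.2.

Definition ces_t (z : R * R * R) : R := ces_log (gamma1_t p t) (gamma2_t p t)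
  (sigma p t / la_th p (cur t) ord0) (sigma p t / la_I p t ord0) z.1.1 z.1.2.

(** The second term is a control function: the investment residual stands for the investment shock,
    with which the production shock is correlated. *)
Definition reg_th (k : R) (z : R * R * R) : R :=
  scale_t p t * ln (ces_t z) + k * (z.1.2 - reg_I z).

(** The shock integrates to zero over the box. What remains of the signal is affine in the two boxed
    coordinates, which yields the Lipschitz bound. *)
Lemma mean_I z r : 0 < r ->
  `|\int[P]_w (W w * half_box t z r w) - reg_I z * \int[P]_w half_box t z r w| <=
  (`|beta1_t p t| + `|beta2_t p t|) * r * \int[P]_w half_box t z r w.
Proof.
move=> r0; have LW := L1_signal hS (inr t); have Le := L1_eta_I.
have mb := @measurable_half_box _ _ t S z r.
have b1 w : `|half_box t (S := S) z r w| <= 1.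
  by case: (half_box01 t (S := S) z w r0) => ->; rewrite ?normr0 ?normr1.
have LF : L1 P (fun w => W w - la_I p t ord0 * eta_I v t w) by apply: L1B => //; exact: L1Z.
have -> : \int[P]_w (W w * half_box t z r w) =
    \int[P]_w ((W w - la_I p t ord0 * eta_I v t w) * half_box t z r w).
  have LWb : L1 P (fun w => W w * half_box t z r w) by exact: (@L1M _ _ _ _ _ _ 1).
  have Leb : L1 P (fun w => eta_I v t w * half_box t z r w) by exact: (@L1M _ _ _ _ _ _ 1).
  rewrite -[LHS]subr0 -(mulr0 (la_I p t ord0)) -(eta_I_half_box z r0) -expectZ// -expectB//.
    by apply: eq_Rintegral => w _; ring.
  exact: L1Z.
apply: local_mean => //; first by move=> w; exact: half_box01.
apply: filterS (investment_signal hS t) => w WE.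
rewrite half_boxE//; case: (boolP (_ && _)) => [/andP[hL /andP[h1 h2]] _|_ /eqP]; last first.
  by rewrite eq_sym oner_eq0.
rewrite WE /reg_I.
rewrite (_ : _ - _ = beta1_t p t * (X w - z.1.1) + beta2_t p t * (L w - z.2)); last by ring.
apply: (le_trans (ler_normD _ _)); rewrite !normrM mulrDl; apply: lerD.
  by apply: ler_wpM2l => //; rewrite ler_norml; apply/andP; split; lra.
by apply: ler_wpM2l => //; exact: ltW.
Qed.

Lemma mean_th : exists k : R, forall z r eps, 0 < r ->
  (forall z', ball z (2 * r) z' -> `|reg_th k z' - reg_th k z| <= eps) ->
  `|\int[P]_w (signal p v (inl (nxt t)) w * full_box t z r w)
    - reg_th k z * \int[P]_w full_box t z r w| <= eps * \int[P]_w full_box t z r w.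
Proof.
have [kappa K] := eta_th_full_box.
set lt := la_th p (nxt t) ord0; set li := la_I p t ord0.
have li0 : li != 0 := la_lat_neq0 hS (inr t) ord0.
(* The production shock enters with factor [lt] and has mean [kappa * eta_I], while the investment
   residual is [li * eta_I]. *)
exists (lt * kappa / li) => z r eps r0 near.
have LN := L1_signal hS (inl (nxt t)); have Lh := L1_eta_th; have Le := L1_eta_I.
have mb := @measurable_full_box _ _ t S z r.
have b1 w : `|full_box t (S := S) z r w| <= 1.
  by case: (full_box01 t (S := S) z w r0) => ->; rewrite ?normr0 ?normr1.
pose F w := signal p v (inl (nxt t)) w - lt * eta_th v t w + lt * kappa * eta_I v t w.
have LF : L1 P F by apply: L1D; [apply: L1B => //|]; exact: L1Z.
have -> : \int[P]_w (signal p v (inl (nxt t)) w * full_box t z r w) =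
    \int[P]_w (F w * full_box t z r w).
  have Lb (Z : Defs.space S -> R) : L1 P Z -> L1 P (fun w => Z w * full_box t z r w).
    by move=> LZ; exact: (@L1M _ _ _ _ _ _ 1).
  have -> : \int[P]_w (F w * full_box t z r w) =
      \int[P]_w (signal p v (inl (nxt t)) w * full_box t z r w
       - lt * (eta_th v t w * full_box t z r w) + lt * kappa * (eta_I v t w * full_box t z r w)).
    by apply: eq_Rintegral => w _; rewrite /F; ring.
  rewrite expectD; [|by apply: L1B; [exact: Lb|apply/L1Z/Lb]|by apply/L1Z/Lb].
  rewrite expectB; [|exact: Lb|by apply/L1Z/Lb].
  by rewrite !expectZ; [|exact: Lb|exact: Lb]; rewrite K//; ring.
apply: local_mean => //; first by move=> w; exact: full_box01.
apply: filterS2 (investment_signal hS t) (production_signal hS t) => w WE [G0 NE] b_1.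
(* The box is closed on one side of two coordinates, so a radius larger than [r] is needed for an
   open ball. *)
have bz : ball z (2 * r) (coords p v t w).
  by apply: full_box_ball b_1 => //; lra.
have := near _ bz; rewrite (_ : F w = reg_th (lt * kappa / li) (coords p v t w))//.
rewrite /F NE /reg_th /ces_t /reg_I /= WE -/lt -/li.
by field.
Qed.

Let cont_x z : {for z, continuous (fun z : R * R * R => z.1.1)}.
Proof. by apply: (@continuous_comp _ _ _ fst fst); exact: cvg_fst. Qed.

Let cont_w z : {for z, continuous (fun z : R * R * R => z.1.2)}.
Proof. by apply: (@continuous_comp _ _ _ fst snd); [exact: cvg_fst|exact: cvg_snd]. Qed.

Let cont_exp (f : R * R * R -> R) a b z : {for z, continuous f} ->
  {for z, continuous (fun z => a * expR (b * f z))}.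
Proof.
move=> cf; apply: cvgM; first exact: cvg_cst.
have cbf : {for z, continuous (fun z => b * f z)} by apply: cvgM; [exact: cvg_cst|exact: cf].
exact: (continuous_comp cbf (@continuous_expR R _)).
Qed.

Lemma ces_t_continuous : continuous ces_t.
Proof. by move=> z; apply: cvgD; apply: cont_exp; [exact: cont_x|exact: cont_w]. Qed.

Lemma reg_th_continuous k z : 0 < ces_t z -> {for z, continuous (reg_th k)}.
Proof.
move=> G0; apply: cvgD.
  apply: cvgM; first exact: cvg_cst.
  exact: (continuous_comp (@ces_t_continuous z) (continuous_ln G0)).
apply: cvgM; first exact: cvg_cst.
apply: cvgB; first exact: cont_w.
apply: cvgD; last by apply: cvgM; [exact: cvg_cst|exact: cvg_snd].
by apply: cvgD; [exact: cvg_cst|apply: cvgM; [exact: cvg_cst|exact: cont_x]].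
Qed.

End Shocks.

(** * Equality of the transformed parameters of equivalent structures *)

Section Identification.
Context (R : realType) (T : nat) (S S0 : structure R T).
Hypotheses (hS : valid S) (hS0 : valid S0) (SS0 : obs_equiv S S0).
Variable t : 'I_T.

Let mball (y r : R) : measurable_fun setT (\1_(ball y r) : R -> R) := @measurable_ball_ind R y r.

Let ball_le1 (y r x : R) : `|\1_(ball y r) x : R| <= 1.
Proof. by rewrite indicE; exact: norm_indicator_le1. Qed.

Let mL (S' : structure R T) y r : measurable_fun setT (fun w => \1_(ball y r) (ln_Y (vars S') t w) : R).
Proof. exact: (measurableT_comp (mball y r) (@measurable_ln_Y _ _ S' t)). Qed.

Let LL (S' : structure R T) y r : L1 (prob S') (fun w => \1_(ball y r) (ln_Y (vars S') t w) : R).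
Proof. by apply: (@L1_bounded _ _ _ _ _ 1) => // w; exact: ball_le1. Qed.

Let LLs (S' : structure R T) (h' : valid S') k y r :
  L1 (prob S') (fun w => signal1 S' k w * \1_(ball y r) (ln_Y (vars S') t w) : R).
Proof. by apply: (@L1M _ _ _ _ _ _ 1) => //; exact: L1_signal. Qed.

Lemma half_box_eq z r : \int[prob S]_w half_box t z r w = \int[prob S0]_w half_box t z r w.
Proof.
rewrite /half_box !expect_one_itv//; try exact: measurable_signal.
by congr (_ - _); exact: (one_ray_prob hS hS0 SS0 t (mball _ _) (@ball_le1 _ _)).
Qed.

Lemma full_box_eq z r : \int[prob S]_w full_box t z r w = \int[prob S0]_w full_box t z r w.
Proof.
rewrite /full_box /half_box !expect_two_itv//; try exact: measurable_signal.
by congr (_ - _ - (_ - _)); exact: (two_rays_prob hS hS0 SS0 t (mball _ _) (@ball_le1 _ _)).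
Qed.

Lemma half_box_target_eq z r :
  \int[prob S]_w (signal1 S (inr t) w * half_box t z r w) =
  \int[prob S0]_w (signal1 S0 (inr t) w * half_box t z r w).
Proof.
have E (S' : structure R T) :
    (fun w => signal1 S' (inr t) w * half_box t z r w) =
    (fun w => signal1 S' (inr t) w * \1_(ball z.2 r) (ln_Y (vars S') t w) *
       itv_ind r z.1.1 (signal1 S' (inl (cur t)) w)).
  by apply/funext => w; rewrite /half_box mulrA.
rewrite !E !expect_one_itv//; try exact: measurable_signal; try exact: LLs.
by congr (_ - _); exact: (one_ray_target hS hS0 SS0 t (mball _ _) (@ball_le1 _ _)).
Qed.

Lemma full_box_target_eq z r :
  \int[prob S]_w (signal1 S (inl (nxt t)) w * full_box t z r w) =
  \int[prob S0]_w (signal1 S0 (inl (nxt t)) w * full_box t z r w).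
Proof.
have E (S' : structure R T) :
    (fun w => signal1 S' (inl (nxt t)) w * full_box t z r w) =
    (fun w => signal1 S' (inl (nxt t)) w * \1_(ball z.2 r) (ln_Y (vars S') t w) *
       itv_ind r z.1.1 (signal1 S' (inl (cur t)) w) *
       itv_ind r z.1.2 (signal1 S' (inr t) w)).
  by apply/funext => w; rewrite /full_box /half_box !mulrA.
rewrite !E !expect_two_itv//; try exact: measurable_signal; try exact: LLs.
have nc : (inl (nxt t) : lat_index T) != inl (cur t).
  exact: nxt_neq_cur.
by congr (_ - _ - (_ - _)); exact: (two_rays_target hS hS0 SS0 t (mball _ _) (@ball_le1 _ _)).
Qed.

Lemma charged_transfer z : charged S t z -> charged S0 t z.
Proof.
move=> cz; apply: charged_full_box => r r0.
by rewrite -full_box_eq; exact: full_box_gt0.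
Qed.

(** The same two box integrals are approximated by both regression functions up to a multiple of r;
    dividing by the positive probability of the box and letting r shrink gives equality. *)
Lemma reg_I_eq z : charged S t z -> reg_I S t z = reg_I S0 t z.
Proof.
move=> cz; apply: le_eps_eq => e e0.
set K := (`|beta1_t (par S) t| + `|beta2_t (par S) t|) + (`|beta1_t (par S0) t| + `|beta2_t (par S0) t|).
have K0 : 0 <= K by rewrite !addr_ge0.
(* Adding 1 keeps the denominator positive when [K] is zero. *)
pose r := e / (K + 1).
have K1 : 0 < K + 1 by lra.
have r0 : 0 < r by rewrite divr_gt0.
have m := mean_I hS t z r0; have m0 := mean_I hS0 t z r0.
have p0 := half_box_gt0 cz r0.
rewrite -half_box_target_eq -half_box_eq in m0.
apply: (le_trans (compare_means p0 m m0)); rewrite -mulrDl -/K /r mulrCA ger_pMr//.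
by rewrite ler_pdivrMr//; lra.
Qed.

(** The control coefficients of the two structures may still differ here; [production_unique]
    equates them. *)
Lemma reg_th_eq : exists k k0 : R, forall z, charged S t z ->
  0 < ces_t S t z -> 0 < ces_t S0 t z -> reg_th S t k z = reg_th S0 t k0 z.
Proof.
have [k m] := mean_th hS t; have [k0 m0] := mean_th hS0 t.
exists k, k0 => z cz G G0; apply: le_eps_eq => e e0.
have e2 : 0 < e / 2 by rewrite divr_gt0.
have near (f : R * R * R -> R) : {for z, continuous f} ->
    exists2 r, 0 < r & forall z', ball z r z' -> `|f z' - f z| <= e / 2.
  move=> /cvgrPdist_lt /(_ _ e2) /nbhs_box[r r0 rP]; exists r => // z' /rP.
  by rewrite distrC => /ltW.
have [r1 r10 n1] := near _ (reg_th_continuous (k := k) G).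
have [r2 r20 n2] := near _ (reg_th_continuous (k := k0) G0).
pose r := Num.min r1 r2 / 2.
have mr0 : 0 < Num.min r1 r2 by rewrite lt_min r10 r20.
have r0 : 0 < r by rewrite divr_gt0.
have rE : 2 * r = Num.min r1 r2 by rewrite /r mulrC divfK.
have sub s z' : 2 * r <= s -> ball z (2 * r) z' -> ball z s z'.
  by move=> rs; exact: le_ball.
have r1' : 2 * r <= r1 by rewrite rE ge_min lexx.
have r2' : 2 * r <= r2 by rewrite rE ge_min lexx orbT.
have M := m z r (e / 2) r0 (fun z' b => n1 z' (sub _ _ r1' b)).
have M0 := m0 z r (e / 2) r0 (fun z' b => n2 z' (sub _ _ r2' b)).
rewrite -full_box_target_eq -full_box_eq in M0.
by apply: (le_trans (compare_means (full_box_gt0 cz r0) M M0)); lra.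
Qed.

(** Positivity of the aggregate holds almost surely, hence at some point of any ball of support
    points, and then on a smaller ball by continuity. The argument is run for one structure and
    then, inside the new ball, for the other. *)
Lemma rich_region : exists z0 e, 0 < e /\ forall z, ball z0 e z ->
  [/\ charged S t z, 0 < ces_t S t z & 0 < ces_t S0 t z].
Proof.
have [z0 [e [e0 ch]]] := rich_point hS t.
have pos (S' : structure R T) z1 r1 : valid S' -> (forall z, ball z1 r1 z -> charged S' t z) -> 0 < r1 ->
    exists z2 r2, [/\ 0 < r2, forall z, ball z2 r2 z -> ball z1 r1 z &
      forall z, ball z2 r2 z -> 0 < ces_t S' t z].
  move=> h' ch' r10.
  have G0 : \forall w \ae prob S', 0 < ces_t S' t (coords (par S') (vars S') t w).
    by apply: filterS (production_signal h' t) => w [].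
  have [z2 b2 G2] := charged_ae (Phi := fun z => 0 < ces_t S' t z) (ch' z1 (ballxx _ r10)) G0 r10.
  have ob : open (ball z1 r1) by exact: ball_open.
  have N : nbhs z2 (ball z1 r1 `&` [set z | 0 < ces_t S' t z]).
    apply: filterI; first exact: open_nbhs_nbhs.
    exact: (cvgr_gt (ces_t S' t z2) (@ces_t_continuous R T S' t z2) 0 G2).
  have [r2 r20 sub] := nbhs_box N.
  by exists z2, r2; split => // z /sub[].
have [z1 [r1 [r10 sub1 G1]]] := pos S z0 e hS ch e0.
have ch0 z : ball z1 r1 z -> charged S0 t z by move=> /sub1/ch; exact: charged_transfer.
have [z2 [r2 [r20 sub2 G2]]] := pos S0 z1 r1 hS0 ch0 r10.
exists z2, r2; split => // z zb; split; [exact/ch/sub1/sub2|exact/G1/sub2|exact: G2].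
Qed.

Let move_coord (z : R * R * R) e d : 0 < e -> `|d| < e ->
  [/\ ball z e (z.1.1 + d, z.1.2, z.2), ball z e (z.1.1, z.1.2 + d, z.2) & ball z e (z.1.1, z.1.2, z.2 + d)].
Proof.
move=> e0 de; have dE x : x + d - x = d by ring.
by split; apply/ball3E; split; rewrite /= ?dE ?subrr ?normr0.
Qed.

Lemma beta_unique : [/\ beta0_t (par S) t = beta0_t (par S0) t,
  beta1_t (par S) t = beta1_t (par S0) t & beta2_t (par S) t = beta2_t (par S0) t].
Proof.
have [z [e [e0 reg]]] := rich_region.
have d0 : 0 < e / 2 by rewrite divr_gt0.
have de : `|e / 2| < e by rewrite gtr0_norm// ltr_pdivrMr// ltr_pMr// ltr1n.
have [b1 b2 b3] := move_coord z e0 de.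
have [cz _ _] := reg _ (ballxx z e0).
have [c1 _ _] := reg _ b1; have [c3 _ _] := reg _ b3.
have E := reg_I_eq cz; have E1 := reg_I_eq c1; have E3 := reg_I_eq c3.
move: E E1 E3; rewrite /reg_I /= => E E1 E3.
have B1 : beta1_t (par S) t = beta1_t (par S0) t.
  by apply: (mulIf (lt0r_neq0 d0)); move: E E1; rewrite !mulrDr; lra.
have B2 : beta2_t (par S) t = beta2_t (par S0) t.
  by apply: (mulIf (lt0r_neq0 d0)); move: E E3; rewrite !mulrDr; lra.
by split=> //; move: E; rewrite B1 B2 => /addIr/addIr.
Qed.

(** Once the control coefficients agree, the control terms cancel because the investment regressions
    coincide, leaving an identity between two log CES functions on an open box. *)
Lemma production_unique : [/\ gamma1_t (par S) t = gamma1_t (par S0) t,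
  gamma2_t (par S) t = gamma2_t (par S0) t,
  sigma (par S) t / la_th (par S) (cur t) ord0 = sigma (par S0) t / la_th (par S0) (cur t) ord0,
  sigma (par S) t / la_I (par S) t ord0 = sigma (par S0) t / la_I (par S0) t ord0 &
  scale_t (par S) t = scale_t (par S0) t].
Proof.
have [z [e [e0 reg]]] := rich_region; have [k [k0 E]] := reg_th_eq.
have [B0 B1 B2] := beta_unique.
have IE z' : reg_I S t z' = reg_I S0 t z' by rewrite /reg_I B0 B1 B2.
have {}E z' : ball z e z' -> reg_th S t k z' = reg_th S0 t k0 z'.
  by move=> /reg[]; exact: E.
have d0 : 0 < e / 2 by rewrite divr_gt0.
have de : `|e / 2| < e by rewrite gtr0_norm// ltr_pdivrMr// ltr_pMr// ltr1n.
have [_ _ b3] := move_coord z e0 de.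
have [_ _ beta2n0 _ _] := valid_params hS0.
have l3 : la_I (par S0) t ord0 != 0 := la_lat_neq0 hS0 (inr t) ord0.
(* Two points that differ in income alone have the same CES value, and their investment residuals
   differ by a nonzero multiple of [beta2_t]. *)
have kk0 : k = k0.
  have := E _ (ballxx z e0); have := E _ b3; rewrite /reg_th !IE.
  have -> : ces_t S t (z.1.1, z.1.2, z.2 + e / 2) = ces_t S t z by [].
  have -> : ces_t S0 t (z.1.1, z.1.2, z.2 + e / 2) = ces_t S0 t z by [].
  rewrite /reg_I /= => E3 E1.
  have n0 : beta2_t (par S0) t * (e / 2) != 0.
    by rewrite mulf_neq0 ?(lt0r_neq0 d0)// /beta2_t mulf_neq0.
  apply: (mulIf n0); move: E1 E3.
  set s := scale_t _ _ * _; set s' := scale_t _ _ * _; rewrite !mulrDr !mulrN !mulrDr.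
  by rewrite !mulrA; lra.
have CE x w : `|x - z.1.1| < e -> `|w - z.1.2| < e ->
    [/\ 0 < ces_t S t (x, w, z.2), 0 < ces_t S0 t (x, w, z.2) &
     scale_t (par S) t * ln (ces_t S t (x, w, z.2)) = scale_t (par S0) t * ln (ces_t S0 t (x, w, z.2))].
  move=> hx hw.
  have b : ball z e (x, w, z.2) by apply/ball3E; rewrite /= subrr normr0.
  have [_ G G0] := reg _ b; split => //.
  by have := E _ b; rewrite /reg_th kk0 IE => /addIr.
have nz (S' : structure R T) : valid S' -> [/\ gamma1_t (par S') t != 0, gamma2_t (par S') t != 0,
   sigma (par S') t / la_th (par S') (cur t) ord0 != 0, sigma (par S') t / la_I (par S') t ord0 != 0 &
   scale_t (par S') t != 0].
  move=> h'; have [_ _ _ /(_ t)[g1 g2] /(_ t)[s p]] := valid_params h'.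
  have l1 := la_lat_neq0 h' (inl (cur t)) ord0; have l2 := la_lat_neq0 h' (inl (nxt t)) ord0.
  have l3' := la_lat_neq0 h' (inr t) ord0.
  split; rewrite /gamma1_t /gamma2_t /scale_t !mulf_neq0 ?invr_eq0//; exact/lt0r_neq0/expR_gt0.
have [g1 g2 s1 s2 sc] := nz S hS; have [g1' g2' s1' s2' sc'] := nz S0 hS0.
apply: (@ces_log_unique R _ _ _ _ _ _ _ _ _ _ g1 g2 s1 s2 sc g1' g2' s1' s2' sc' z.1.1 z.1.2 e e0).
- by move=> x w [hx hw]; have [] := CE x w hx hw.
- by move=> x w [hx hw]; have [] := CE x w hx hw.
- by move=> x w [hx hw]; have [] := CE x w hx hw.
Qed.

End Identification.

Lemma identified_same_transformed (R : realType) (T : nat) (S S0 : structure R T) :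
  valid S -> valid S0 -> obs_equiv S S0 -> same_transformed (par S) (par S0).
Proof.
move=> hS hS0 SS0; split.
- by move=> t m; exact: (measurement_unique hS hS0 SS0 (inl t) m).
- by move=> t m; exact: (measurement_unique hS hS0 SS0 (inr t) m).
- exact: outcome_unique.
- by move=> t; have [] := production_unique hS hS0 SS0 t.
- by move=> t; have [] := production_unique hS hS0 SS0 t.
- by move=> t; have [] := production_unique hS hS0 SS0 t.
- by move=> t; exact: beta_unique.
Qed.

(** * Conditional expectations and moments under affine maps *)

Section CondExp.
Context (R : realType) (d : measure_display) (Om : measurableType d) (P : probability Om R).

(** A version that is already measurable for a smaller sigma-algebra remains a version there. This
    covers rescaled shocks conditioned on transformed latents. *)
Lemma cond_exp_scale (X f : Om -> R) (G G' : set (set Om)) (c : R) :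
  G `<=` measurable -> G' `<=` G ->
  (forall B, measurable B -> G' ((fun w => c * f w) @^-1` B)) ->
  is_cond_exp P X G f -> is_cond_exp P (fun w => c * X w) G' (fun w => c * f w).
Proof.
move=> GM G'G mf [LX Lf _ E]; split => //; [exact: L1Z|exact: L1Z|move=> A G'A].
have GA := G'G _ G'A; have mA := GM _ GA.
have EZ (g : Om -> R) : L1 P g ->
    (\int[P]_(w in A) (c * g w)%:E = c%:E * \int[P]_(w in A) (g w)%:E)%E.
  move=> Lg; under eq_integral do rewrite EFinM.
  by rewrite integralZl//; exact: (integrableS measurableT).
by rewrite !EZ// E.
Qed.

Lemma cond_indep2_sub (F1 F2 F2' G : set (set Om)) : F2' `<=` F2 ->
  cond_indep2 P F1 F2 G -> cond_indep2 P F1 F2' G.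
Proof.
move=> F2F H A q FA qA; apply: H => // j; have := FA j.
by case: j => //; exact: F2F.
Qed.

Lemma finite_moments_affine (X : Om -> R) a b : finite_moments P X ->
  finite_moments P (fun w => a + b * X w).
Proof.
suff H (r : R) : 1 <= r -> X \in Lfun P r%:E -> (fun w => a + b * X w) \in Lfun P r%:E.
  by move=> [X1 X2]; split; apply: H; rewrite ?lexx ?ler1n.
move=> r1 Xr; have r1' : (1 <= r%:E)%E by rewrite lee_fin.
rewrite (_ : (fun _ => _) = cst a \+ b \o* X); last by apply/funext => w /=; rewrite mulrC.
by have [_ H] := Lfun_addr_closed P r1'; apply: H; [exact: Lfun_cst|exact: Lfun_scale].
Qed.

Lemma covariance_affine (X Z : Om -> R) a b c e : finite_moments P X -> finite_moments P Z ->
  covariance P (fun w => a + b * X w) (fun w => c + e * Z w) = ((b * e)%:E * covariance P X Z)%E.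
Proof.
have E (V : Om -> R) k l : (fun w => k + l * V w) = cst k \+ l \o* V.
  by apply/funext => w /=; rewrite mulrC.
have scale (V : Om -> R) l : finite_moments P V -> finite_moments P (l \o* V).
  move=> /(finite_moments_affine 0 l); congr finite_moments.
  by apply/funext => w /=; rewrite add0r mulrC.
have C k : finite_moments P (cst k) by split; exact: Lfun_cst.
move=> mX mZ; have [bX1 bX2] := scale _ b mX; have [eZ1 eZ2] := scale _ e mZ.
have [X1 X2] := mX; have [Z1 Z2] := mZ.
rewrite !E covarianceDl//; [|by have [] := C a|].
  rewrite covariance_cst_l add0e covarianceDr//; last by have [] := C c.
  rewrite covariance_cst_r add0e covarianceZl//; last exact: Lfun2_mul_Lfun1.
  by rewrite covarianceZr ?muleA//; exact: Lfun2_mul_Lfun1.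
by have := finite_moments_affine c e mZ; rewrite E => -[].
Qed.

End CondExp.

(** * An observationally equivalent structure with prescribed parameters *)

Section Reparametrization.
Context (R : realType) (T : nat) (S0 : structure R T) (q : params R T).
Hypotheses (hS0 : valid S0) (hq : admissible q) (hT : same_transformed q (par S0)).

Local Notation P := (prob S0).
Local Notation p0 := (par S0).
Local Notation v0 := (vars S0).

(* Latent variables chosen so that every signal is unchanged. *)
Definition reparam_lat (k : lat_index T) (w : Defs.space S0) : R :=
  inv_ln (mu_lat q k ord0) (la_lat q k ord0) (signal p0 v0 k w).

Lemma measurable_reparam_lat k : measurable_fun setT (reparam_lat k).
Proof.
apply: (measurableT_comp (@measurable_expR R)); apply: measurable_funM => //.
by apply: measurable_funB => //; exact: measurable_signal.
Qed.

Definition reparam_eta_th t (w : Defs.space S0) : R :=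
  la_th p0 (nxt t) ord0 / la_th q (nxt t) ord0 * eta_th v0 t w.

Lemma measurable_reparam_eta_th t : measurable_fun setT (reparam_eta_th t).
Proof. by apply: measurable_funM => //; exact: measurable_funP. Qed.

Definition reparam_eta_I t (w : Defs.space S0) : R :=
  la_I p0 t ord0 / la_I q t ord0 * eta_I v0 t w.

Lemma measurable_reparam_eta_I t : measurable_fun setT (reparam_eta_I t).
Proof. by apply: measurable_funM => //; exact: measurable_funP. Qed.

Definition reparam_vars : variables R T (Defs.space S0) := {|
  theta := fun t => mfun_Sub (mem_set (measurable_reparam_lat (inl t)));
  invest := fun t => mfun_Sub (mem_set (measurable_reparam_lat (inr t)));
  Y := Y v0; Z_th := Z_th v0; Z_I := Z_I v0; Q := Q v0;
  eps_th := eps_th v0; eps_I := eps_I v0;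
  eta_th := fun t => mfun_Sub (mem_set (measurable_reparam_eta_th t));
  eta_I := fun t => mfun_Sub (mem_set (measurable_reparam_eta_I t));
  eta_Q := eta_Q v0 |}.

Local Notation v := reparam_vars.

Definition reparam : structure R T := Structure q P reparam_vars.

Let la_q k m : la_lat q k m != 0.
Proof. by have [Hth HI _ _ _] := hq; case: k => t /=. Qed.

Let la_0 k m : la_lat p0 k m != 0 := la_lat_neq0 hS0 k m.

Lemma reparam_signal k : signal q v k = signal p0 v0 k.
Proof. by apply/funext => w; case: k => t; exact: inv_lnK (la_q _ ord0). Qed.

Lemma reparam_ln_lat k : ln_lat v k = fun w =>
  (mu_lat p0 k ord0 - mu_lat q k ord0) / la_lat q k ord0
  + la_lat p0 k ord0 / la_lat q k ord0 * ln_lat v0 k w.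
Proof.
apply/funext => w; apply: (mulfI (la_q k ord0)); apply: (addrI (mu_lat q k ord0)).
transitivity (signal q v k w) => //; rewrite reparam_signal /signal.
by field; exact: la_q.
Qed.

Lemma reparam_err : err v = err v0.
Proof. by apply/funext; case=> [[[t m]|[t m]]|[]]. Qed.

(** The new latent is a Borel function of the old latent alone, so it generates no new events;
    conditional independence and conditional means are inherited. *)
Lemma reparam_lat_sigma k (Z : set (Defs.space S0 -> R)) B :
  Z (match k with inl t => theta v0 t | inr t => invest v0 t end : Defs.space S0 -> R) ->
  measurable B -> sigma_of Z (reparam_lat k @^-1` B).
Proof.
move=> Zk mB; pose f x := inv_ln (mu_lat q k ord0) (la_lat q k ord0)
  (mu_lat p0 k ord0 + la_lat p0 k ord0 * ln x).
have mf : measurable_fun setT f.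
  apply: (measurableT_comp (@measurable_expR R)); apply: measurable_funM => //.
  by apply: measurable_funB => //; apply: measurable_funD => //; exact: measurable_funM.
have mfB : measurable (f @^-1` B) by rewrite -[X in measurable X]setTI; exact: mf.
by have := sigma_of_preimage Zk mfB; case: k @f mf mfB {Zk}.
Qed.

Lemma reparam_measurement k m : \forall w \ae P,
  obs v0 (obs_lat k m) w = mu_lat q k m + la_lat q k m * ln_lat v k w + err v0 (err_lat k m) w.
Proof.
have [muE laE] : mu_lat q k m - la_lat q k m / la_lat q k ord0 * mu_lat q k ord0 =
    mu_lat p0 k m - la_lat p0 k m / la_lat p0 k ord0 * mu_lat p0 k ord0 /\
    la_lat q k m / la_lat q k ord0 = la_lat p0 k m / la_lat p0 k ord0.
  by case: k => t; [exact: (same_th hT t m)|exact: (same_I hT t m)].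
apply: filterS (measurement_signal hS0 k m) => w ->.
rewrite -muE -laE -reparam_signal /signal.
by field; exact: la_q.
Qed.

(** In terms of signals, the systematic part of the production equation depends on the transformed
    parameters only, and the signals are unchanged; the new shock compensates the change of
    loading. *)
Lemma reparam_production t : \forall w \ae P, 0 < ces q v t w /\
  theta v (nxt t) w = ces q v t w `^ (psi q t / sigma q t) * expR (eta_th v t w).
Proof.
have l2 : la_th q (nxt t) ord0 != 0 := la_q (inl (nxt t)) ord0.
have [_ _ _ _ /(_ t)[s0 psi0]] := hq.
have [g1 g2] := same_gamma hT t; have [s1 s2] := same_sigma hT t.
apply: filterS (production_signal hS0 t) => w [].
rewrite -g1 -g2 -s1 -s2 -!reparam_signal ces_signal//; [|exact: expR_gt0|exact: expR_gt0].
rewrite pmulr_rgt0 ?expR_gt0// => c0 E; split => //.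
rewrite [LHS]/= /reparam_lat -reparam_signal E /scale_t -(same_psi hT).
rewrite lnM ?posrE ?expR_gt0// expRK /powR gt_eqF// -expRD; congr expR.
by rewrite /= /reparam_eta_th; field; rewrite l2 s0 psi0.
Qed.

Lemma reparam_model : model P q v.
Proof.
have hm := valid_model hS0; split.
- by move=> t; apply: aeW => w; exact: expR_gt0.
- by move=> t; apply: aeW => w; exact: expR_gt0.
- exact: Y_pos hm.
- by move=> t; apply: filterS (reparam_production t) => w [].
- by move=> t; apply: filterS (reparam_production t) => w [].
- by move=> t m; exact: reparam_measurement (inl t) m.
- by move=> t m; exact: reparam_measurement (inr t) m.
- move=> t; have lI : la_I q t ord0 != 0 := la_q (inr t) ord0.
  have lth : la_th q (cur t) ord0 != 0 := la_q (inl (cur t)) ord0.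
  have [b0 b1 b2] := same_beta hT t.
  apply: filterS (investment_signal hS0 t) => w.
  rewrite -b0 -b1 -b2 -!reparam_signal => E.
  have -> : ln_I v t w = (signal q v (inr t) w - mu_I q t ord0) / la_I q t ord0.
    by rewrite /signal/=; field.
  rewrite E /signal/= /reparam_eta_I /beta0_t /beta1_t /beta2_t.
  rewrite -[ln_Y v t]/(ln_Y v0 t).
  by field; rewrite lI lth.
- have lth : la_th q ord_max ord0 != 0 := la_q (inl ord_max) ord0.
  have [r0 r1] := same_rho hT.
  apply: filterS (outcome_signal hS0) => w /= ->.
  rewrite -r0 -r1 -reparam_signal /signal/= /rho0_t /rho1_t.
  by field.
Qed.

Let mM (c : R) : measurable_fun setT ( *%R c).
Proof. exact: (measurable_funM (@measurable_cst _ _ _ _ _ c) (@measurable_id _ _ _)). Qed.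

Lemma reparam_cond_indep : errors_cond_indep P v.
Proof.
have [H1 H2] := valid_indep hS0.
split; first by rewrite reparam_err.
rewrite /sigma_err reparam_err; apply: cond_indep2_sub H2.
apply: sigma_of_sub => X [] [t _ <-] B mB.
- by apply: (@reparam_lat_sigma (inl t)) => //; left; exists t.
- by apply: (@reparam_lat_sigma (inr t)) => //; right; exists t.
Qed.

Lemma reparam_moments : all_finite_moments P v.
Proof.
have [_ _ HY HZ [Hn [Hth HI]]] := valid_moments hS0.
have H k : finite_moments P (ln_lat v k).
  by rewrite reparam_ln_lat//; apply: finite_moments_affine; exact: finite_moments_ln_lat.
have scale (X : Defs.space S0 -> R) c : finite_moments P X -> finite_moments P (fun w => c * X w).
  move=> /(finite_moments_affine 0 c); congr finite_moments.
  by apply/funext => w; rewrite add0r.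
split => //.
- by move=> t; exact: H (inl t).
- by move=> t; exact: H (inr t).
- split; first by move=> j; rewrite reparam_err.
  by split=> t; exact: scale.
Qed.

Lemma reparam_covariance k k' : covariance P (ln_lat v0 k) (ln_lat v0 k') != 0%E ->
  covariance P (ln_lat v k) (ln_lat v k') != 0%E.
Proof.
rewrite !reparam_ln_lat// covariance_affine; [|exact: finite_moments_ln_lat|exact: finite_moments_ln_lat].
move=> c0; rewrite mule_eq0 negb_or c0 andbT eqe.
by rewrite !mulf_neq0// invr_eq0.
Qed.

Lemma reparam_corr : latent_correlated P v.
Proof.
have [Hth HI] := valid_corr hS0; split => t.
- have [[s cs]|[s [st cs]]] := Hth t; [left; exists s|right; exists s; split => //].
    exact: (@reparam_covariance (inl t) (inr s)).
  exact: (@reparam_covariance (inl t) (inl s)).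
- have [[s cs]|[s [st cs]]] := HI t; [left; exists s|right; exists s; split => //].
    exact: (@reparam_covariance (inr t) (inl s)).
  exact: (@reparam_covariance (inr t) (inr s)).
Qed.

Lemma reparam_shocks : shocks_cond_mean P v.
Proof.
have [HI [kappa Hth]] := valid_shocks hS0.
have etaI t (Z' : set (Defs.space S0 -> R)) : Z' (eta_I v0 t : Defs.space S0 -> R) ->
    forall B, measurable B -> sigma_of Z' (eta_I v t @^-1` B).
  move=> Zt B mB.
  have -> : eta_I v t @^-1` B = eta_I v0 t @^-1` ( *%R (la_I p0 t ord0 / la_I q t ord0) @^-1` B).
    by [].
  apply: sigma_of_preimage => //; rewrite -[X in measurable X]setTI.
  exact: mM.
split.
- move=> t.
  have := @cond_exp_scale _ _ _ P _ _ _
    (sigma_of [set (theta v (cur t) : Defs.space S0 -> R); (Y v0 t : Defs.space S0 -> R)])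
    (la_I p0 t ord0 / la_I q t ord0) _ _ _ (HI t).
  rewrite mulr0; apply.
  + by apply: sigma_of_sub_measurable => _ [] ->; exact: measurable_funP.
  + apply: sigma_of_sub => _ [] -> B mB; first by apply: (@reparam_lat_sigma (inl (cur t))) => //; left.
    by apply: sigma_of_preimage => //; right.
  + move=> B mB.
    have := @measurable_cst _ _ (g_sigma_algebraType (sigma_gen [set (theta v (cur t) : Defs.space S0 -> R); (Y v0 t : Defs.space S0 -> R)])) R setT 0 measurableT B mB.
    by rewrite setTI.
(* Rescaling the production shock by a and the investment shock by b turns [kappa] into a kappa /
   b. *)
exists (fun t => la_th p0 (nxt t) ord0 / la_th q (nxt t) ord0 * kappa t
  / (la_I p0 t ord0 / la_I q t ord0)) => t.
set k := _ / (la_I _ _ _ / _).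
have kE : (fun w => k * eta_I v t w) =
    (fun w => la_th p0 (nxt t) ord0 / la_th q (nxt t) ord0 * (kappa t * eta_I v0 t w)).
  apply/funext => w; rewrite /= /reparam_eta_I /k.
  have l1 : la_th q (nxt t) ord0 != 0 := la_q (inl (nxt t)) ord0.
  have l2 : la_I q t ord0 != 0 := la_q (inr t) ord0.
  have l3 : la_I p0 t ord0 != 0 := la_0 (inr t) ord0.
  by field; rewrite l1 l2 l3.
rewrite kE; apply: (cond_exp_scale _ _ _ (Hth t)).
- by apply: sigma_of_sub_measurable => _ [[]|] ->; exact: measurable_funP.
- apply: sigma_of_sub => _ [[]|] -> B mB.
  + by apply: (@reparam_lat_sigma (inl (cur t))) => //; left; left.
  + by apply: etaI => //; left; right.
  + by apply: sigma_of_preimage => //; right.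
- move=> B mB; rewrite -kE.
  have -> : (fun w => k * eta_I v t w) @^-1` B = eta_I v t @^-1` ( *%R k @^-1` B) by [].
  apply: sigma_of_preimage; first by left; right.
  rewrite -[X in measurable X]setTI.
  exact: mM.
Qed.

Lemma reparam_support : rich_support P v.
Proof.
move=> t; have [z0 [e [e0 ch]]] := rich_point hS0 t.
pose mu1 := mu_lat q (inl (cur t)) ord0; pose la1 := la_lat q (inl (cur t)) ord0.
pose mu2 := mu_lat q (inr t) ord0; pose la2 := la_lat q (inr t) ord0.
have la10 : la1 != 0 by exact: la_q.
have la20 : la2 != 0 by exact: la_q.
pose c1 := inv_ln mu1 la1 z0.1.1; pose c2 := inv_ln mu2 la2 z0.1.2; pose c3 := inv_ln 0 1 z0.2.
have c10 : 0 < c1 by exact: expR_gt0.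
have c20 : 0 < c2 by exact: expR_gt0.
have c30 : 0 < c3 by exact: expR_gt0.
have [r1 r10 h1] := continuous_ball (@ln_affine_continuous R mu1 la1 c1 c10) e0.
have [r2 r20 h2] := continuous_ball (@ln_affine_continuous R mu2 la2 c2 c20) e0.
have [r3 r30 h3] := continuous_ball (@ln_affine_continuous R 0 1 c3 c30) e0.
(* The bounds by the center keep the whole ball in the positive orthant; the others keep its image
   among the support points of the original structure. *)
pose r := Num.min (Num.min c1 (Num.min c2 c3)) (Num.min r1 (Num.min r2 r3)).
have r0 : 0 < r by rewrite !lt_min c10 c20 c30 r10 r20 r30.
exists (c1, c2, c3), r; split => // u.
rewrite /eball3/= => ub U oU Uu.
have near x a b : 0 <= a -> 0 <= b -> x ^+ 2 + a + b < r ^+ 2 -> `|x| < r.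
  move=> a0 b0 H; rewrite -(ltr_pXn2r (n := 2)) ?nnegrE//; last exact: ltW.
  by rewrite real_normK ?num_real//; lra.
have n1 : `|u.1.1 - c1| < r by apply: (near _ _ _ _ _ ub); exact: sqr_ge0.
have n2 : `|u.1.2 - c2| < r.
  by apply: (near _ ((u.1.1 - c1) ^+ 2) ((u.2 - c3) ^+ 2)); rewrite ?sqr_ge0//; move: ub; lra.
have n3 : `|u.2 - c3| < r.
  by apply: (near _ ((u.1.1 - c1) ^+ 2) ((u.1.2 - c2) ^+ 2)); rewrite ?sqr_ge0//; move: ub; lra.
have pos x c : `|x - c| < r -> r <= c -> 0 < x.
  by rewrite ltr_norml => /andP[? _] ?; lra.
have u10 : 0 < u.1.1 by apply: pos n1 _; rewrite !ge_min lexx.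
have u20 : 0 < u.1.2 by apply: pos n2 _; rewrite !ge_min lexx !orbT.
have u30 : 0 < u.2 by apply: pos n3 _; rewrite !ge_min lexx !orbT.
pose z : R * R * R := (mu1 + la1 * ln u.1.1, mu2 + la2 * ln u.1.2, 0 + 1 * ln u.2).
have bz : ball z0 e z.
  have le_r1 : r <= r1 by rewrite !ge_min lexx !orbT.
  have le_r2 : r <= r2 by rewrite !ge_min lexx !orbT.
  have le_r3 : r <= r3 by rewrite !ge_min lexx !orbT.
  apply/ball3E; split => /=.
  - by have := h1 _ (lt_le_trans n1 le_r1); rewrite inv_lnK.
  - by have := h2 _ (lt_le_trans n2 le_r2); rewrite inv_lnK.
  - by have := h3 _ (lt_le_trans n3 le_r3); rewrite inv_lnK// oner_eq0.
have [s s0 sU] := nbhs_box (open_nbhs_nbhs (conj oU Uu)).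
have [d1 d10 k1] := continuous_ball (@inv_ln_continuous R mu1 la1 z.1.1) s0.
have [d2 d20 k2] := continuous_ball (@inv_ln_continuous R mu2 la2 z.1.2) s0.
have [d3 d30 k3] := continuous_ball (@inv_ln_continuous R 0 1 z.2) s0.
pose dl := Num.min d1 (Num.min d2 d3).
have dl0 : 0 < dl by rewrite !lt_min d10 d20 d30.
(* Income is itself unchanged and recovered from its logarithm only where positive; the exceptional
   null set is added to the event. *)
have [N [mN N0 NY]] := Y_pos (valid_model hS0) t.
have mU : measurable [set w | U (theta v (cur t) w, invest v t w, Y v t w)].
  by apply: measurable_open3 => //; exact: measurable_funP.
apply: (lt_le_trans (ch _ bz _ dl0)).
rewrite -(measureU0 mU mN N0); apply: le_measure; rewrite ?inE.
- exact: measurable_coords_ball.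
- exact: measurableU.
move=> w /ball3E/=; rewrite !lt_min => -[/and3P[b1 _ _] /and3P[_ b2 _] /and3P[_ _ b3]].
have [Y0|nY0] := pselect (0 < Y v0 t w); last by right; exact: NY.
left; apply: sU; apply/ball3E; split => /=.
- by have := k1 _ b1; rewrite ln_affineK.
- by have := k2 _ b2; rewrite ln_affineK.
- have := k3 _ b3; rewrite ln_affineK ?oner_eq0// /inv_ln subr0 divr1.
  by rewrite /ln_Y lnK.
Qed.

Lemma reparam_valid : valid reparam.
Proof.
split => //=.
- exact: reparam_model.
- by rewrite /exogenous_Y /sigma_err reparam_err; exact: valid_exo hS0.
- exact: reparam_cond_indep.
- exact: reparam_moments.
- by move=> j; rewrite reparam_err; exact: valid_centered hS0 j.
- exact: reparam_corr.
- by move=> j; rewrite reparam_err; exact: valid_char_fun hS0 j.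
- exact: reparam_support.
- exact: reparam_shocks.
Qed.

End Reparametrization.

(** * Solving for the primitive parameters under the normalization *)

Section Normalization.
Context (R : realType) (T : nat).
Variables (mu_b : 'I_T.+1 -> R) (mI_b : 'I_T -> R) (la_b : 'I_T.+1 -> R).
Hypothesis la_b0 : forall t, la_b t != 0.

(** The order of solution matters: the prescribed skill loading gives [sigma], and [sigma / la_I]
    then gives the loading of investment, whose scale is not prescribed. The remaining parameters
    follow from these. *)
Definition normal_sigma (q : params R T) (t : 'I_T) : R :=
  sigma q t / la_th q (cur t) ord0 * la_b (cur t).
Definition normal_la_I (q : params R T) (t : 'I_T) : R :=
  normal_sigma q t / (sigma q t / la_I q t ord0).
Definition normal_psi (q : params R T) (t : 'I_T) : R :=
  scale_t q t * normal_sigma q t / la_b (nxt t).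
Definition normal_beta1 (q : params R T) (t : 'I_T) : R :=
  beta1_t q t * la_b (cur t) / normal_la_I q t.
Definition normal_rho1 (q : params R T) : R := rho1_t q * la_b ord_max.

(* The transformed parameters of [q], solved for the primitive parameters
   under the normalization. *)
Definition normalize (q : params R T) : params R T := {|
  mu_th := fun t m => mu_th_t q t m + la_th_t q t m * mu_b t;
  la_th := fun t m => la_th_t q t m * la_b t;
  mu_I := fun t m => mu_I_t q t m + la_I_t q t m * mI_b t;
  la_I := fun t m => la_I_t q t m * normal_la_I q t;
  rho0 := rho0_t q + normal_rho1 q * mu_b ord_max / la_b ord_max;
  rho1 := normal_rho1 q;
  beta0 := fun t => (beta0_t q t - mI_b t
    + normal_la_I q t / la_b (cur t) * mu_b (cur t) * normal_beta1 q t) / normal_la_I q t;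
  beta1 := normal_beta1 q;
  beta2 := fun t => beta2_t q t / normal_la_I q t;
  gamma1 := fun t => gamma1_t q t / expR (normal_sigma q t *
    (mu_b (nxt t) / (la_b (nxt t) * normal_psi q t) - mu_b (cur t) / la_b (cur t)));
  gamma2 := fun t => gamma2_t q t / expR (normal_sigma q t *
    (mu_b (nxt t) / (la_b (nxt t) * normal_psi q t) - mI_b t / normal_la_I q t));
  sigma := normal_sigma q;
  psi := normal_psi q |}.

Definition normalized (q : params R T) : Prop :=
  [/\ forall t, mu_th q t ord0 = mu_b t, forall t, mu_I q t ord0 = mI_b t &
      forall t, la_th q t ord0 = la_b t].

(** [normalize] depends on its argument through the transformed parameters only. As it also fixes
    normalized vectors, a normalized vector is determined by its transformed values. *)
Lemma normalize_same p q : same_transformed p q -> normalize p = normalize q.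
Proof.
move=> H.
have th t m : mu_th_t p t m = mu_th_t q t m /\ la_th_t p t m = la_th_t q t m := same_th H t m.
have sg : normal_sigma p = normal_sigma q.
  by apply/funext => t; rewrite /normal_sigma; have [-> _] := same_sigma H t.
have lI : normal_la_I p = normal_la_I q.
  by apply/funext => t; rewrite /normal_la_I sg; have [_ ->] := same_sigma H t.
have ps : normal_psi p = normal_psi q.
  by apply/funext => t; rewrite /normal_psi sg /scale_t (same_psi H).
have b1 : normal_beta1 p = normal_beta1 q.
  by apply/funext => t; rewrite /normal_beta1 lI; have [_ -> _] := same_beta H t.
have [r0 r1] := same_rho H.
have r1' : normal_rho1 p = normal_rho1 q by rewrite /normal_rho1 r1.
rewrite /normalize sg lI ps b1 r0 r1'; congr Params.
- by apply/funext => t; apply/funext => m; have [-> ->] := same_th H t m.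
- by apply/funext => t; apply/funext => m; have [_ ->] := same_th H t m.
- by apply/funext => t; apply/funext => m; have [-> ->] := same_I H t m.
- by apply/funext => t; apply/funext => m; have [_ ->] := same_I H t m.
- by apply/funext => t; have [-> _ _] := same_beta H t.
- by apply/funext => t; have [_ _ ->] := same_beta H t.
- by apply/funext => t; have [-> _] := same_gamma H t.
- by apply/funext => t; have [_ ->] := same_gamma H t.
Qed.

Lemma normalize_id q : admissible q -> normalized q -> normalize q = q.
Proof.
move=> [lth0 lI0 b20 g0 sp0] [Emu EmI Ela].
have sg : normal_sigma q = sigma q.
  by apply/funext => t; rewrite /normal_sigma -Ela divfK.
have lI : normal_la_I q = fun t => la_I q t ord0.
  apply/funext => t; rewrite /normal_la_I sg; have [s0 _] := sp0 t.
  by field; rewrite s0 lI0.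
have ps : normal_psi q = psi q.
  apply/funext => t; rewrite /normal_psi sg /scale_t -Ela; have [s0 _] := sp0 t.
  by field; rewrite s0 lth0.
have b1 : normal_beta1 q = beta1 q.
  apply/funext => t; rewrite /normal_beta1 lI /beta1_t -Ela.
  by field; rewrite lI0 lth0.
have r1 : normal_rho1 q = rho1 q by rewrite /normal_rho1 /rho1_t -Ela divfK.
rewrite /normalize sg lI ps b1 r1.
have n0 (x : R) : expR x != 0 by rewrite gt_eqF// expR_gt0.
case: q lth0 lI0 b20 g0 sp0 Emu EmI Ela {sg lI ps b1 r1} => mu la muI laI r0 r1 b0 b1 b2 g1 g2 sg ps.
move=> /= lth0 lI0 b20 g0 sp0 Emu EmI Ela; congr Params.
- by apply/funext => t; apply/funext => m; rewrite /mu_th_t /la_th_t/= -Emu; ring.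
- by apply/funext => t; apply/funext => m; rewrite /la_th_t/= -Ela divfK.
- by apply/funext => t; apply/funext => m; rewrite /mu_I_t /la_I_t/= -EmI; ring.
- by apply/funext => t; apply/funext => m; rewrite /la_I_t/= divfK.
- by rewrite /rho0_t/= -Emu -Ela; ring.
- by apply/funext => t; rewrite /beta0_t/= -Emu -Ela -EmI; field; rewrite lth0 lI0.
- by apply/funext => t; rewrite /beta2_t/= mulrC mulKf.
- by apply/funext => t; rewrite /gamma1_t/= -!Emu -!Ela mulfK.
- by apply/funext => t; rewrite /gamma2_t/= -!Emu -!Ela -EmI mulfK.
Qed.

Section Normalize.
Variable q : params R T.
Hypothesis hq : admissible q.

Let lth0 t m : la_th q t m != 0. Proof. by have [H _ _ _ _] := hq. Qed.
Let lI0 t m : la_I q t m != 0. Proof. by have [_ H _ _ _] := hq. Qed.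
Let s0 t : sigma q t != 0. Proof. by have [_ _ _ _ /(_ t)[]] := hq. Qed.
Let psi0 t : psi q t != 0. Proof. by have [_ _ _ _ /(_ t)[]] := hq. Qed.

Let nsigma0 t : normal_sigma q t != 0.
Proof. by rewrite /normal_sigma !mulf_neq0// invr_eq0. Qed.

Let nlaI0 t : normal_la_I q t != 0.
Proof. by rewrite /normal_la_I !(mulf_neq0, invr_neq0). Qed.

Let npsi0 t : normal_psi q t != 0.
Proof. by rewrite /normal_psi /scale_t !(mulf_neq0, invr_neq0). Qed.

Let expR_neq0 (x : R) : expR x != 0. Proof. by rewrite gt_eqF// expR_gt0. Qed.

Lemma normalize_normalized : normalized (normalize q).
Proof.
split=> t /=; rewrite /mu_th_t /mu_I_t /la_th_t /la_I_t !divff//; first by ring.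
  by ring.
by rewrite mul1r.
Qed.

Lemma normalize_admissible : admissible (normalize q).
Proof.
have [_ _ b20 g0 _] := hq; split => /=.
- by move=> t m; rewrite /la_th_t !(mulf_neq0, invr_neq0).
- by move=> t m; rewrite /la_I_t !(mulf_neq0, invr_neq0).
- by move=> t; rewrite /beta2_t !(mulf_neq0, invr_neq0).
- by move=> t; have [? ?] := g0 t; rewrite /gamma1_t /gamma2_t !(mulf_neq0, invr_neq0).
- by [].
Qed.

Lemma normalize_transformed : same_transformed (normalize q) q.
Proof.
have [Emu EmI Ela] := normalize_normalized.
have ElI t : la_I (normalize q) t ord0 = normal_la_I q t by rewrite /= /la_I_t divff ?mul1r.
have ratio t m : la_th_t (normalize q) t m = la_th_t q t m.
  by rewrite {1}/la_th_t Ela/= mulfK.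
have ratioI t m : la_I_t (normalize q) t m = la_I_t q t m.
  by rewrite {1}/la_I_t ElI/= mulfK.
have sE t : normal_sigma q t / la_b (cur t) = sigma q t / la_th q (cur t) ord0.
  by rewrite /normal_sigma mulfK.
split.
- move=> t m; split => //; rewrite {1}/mu_th_t -/(la_th_t (normalize q) t m) ratio Emu/=; ring.
- move=> t m; split => //; rewrite {1}/mu_I_t -/(la_I_t (normalize q) t m) ratioI EmI/=; ring.
- split; first by rewrite {1}/rho0_t Emu Ela/=; ring.
  by rewrite {1}/rho1_t Ela/= /normal_rho1 mulfK.
- move=> t; split.
    by rewrite {1}/gamma1_t !Emu !Ela/= divfK.
  by rewrite {1}/gamma2_t !Emu !Ela EmI ElI/= divfK.
- move=> t; rewrite Ela ElI; split; first exact: sE.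
  rewrite /= /normal_la_I; field; rewrite ?s0 ?lI0 ?nsigma0//.
- by move=> t; rewrite Ela/= /normal_psi /scale_t; field; rewrite ?s0 ?la_b0 ?nsigma0.
- move=> t; split.
  + rewrite {1}/beta0_t ElI EmI Ela Emu [beta0 _ _]/= [beta1 _ _]/=.
    by field; rewrite ?la_b0 ?nlaI0.
  + by rewrite {1}/beta1_t ElI Ela/= /normal_beta1; field; rewrite ?la_b0 ?nlaI0.
  + by rewrite {1}/beta2_t ElI/= mulrC divfK.
Qed.

End Normalize.

End Normalization.

Theorem theorem3 (R : realType) (T : nat) (S0 : structure R T)
    (hS0 : valid S0) :
  identified_set S0 =
    [set p | admissible p /\ same_transformed p (par S0)]
  /\
  (forall (mu_th_bar : 'I_T.+1 -> R) (mu_I_bar : 'I_T -> R)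
          (la_th_bar : 'I_T.+1 -> R),
     (forall t, la_th_bar t != 0) ->
     exists p1 : params R T,
       identified_set S0 `&`
         [set p | [/\ forall t, mu_th p t ord0 = mu_th_bar t,
                      forall t, mu_I p t ord0 = mu_I_bar t &
                      forall t, la_th p t ord0 = la_th_bar t]]
       = [set p1]).
Proof.
have E : identified_set S0 = [set p | admissible p /\ same_transformed p (par S0)].
  apply/seteqP; split=> [p [S [hS <- SS0]]|p [hp pS0]].
    by split; [exact: valid_params hS|exact: identified_same_transformed].
  by exists (reparam S0 p); split => //; exact: reparam_valid.
split=> // mu mI la la0; have h0 := valid_params hS0.
exists (normalize mu mI la (par S0)); rewrite E; apply/seteqP; split.
  move=> p [[hp pS0] np].
  (* A normalized [p] is its own normalization, which equals that of the true parameters. *)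
  by rewrite -(normalize_same mu mI la pS0) normalize_id.
move=> _ ->; split; last exact: normalize_normalized.
by split; [exact: normalize_admissible|exact: normalize_transformed].
Qed.
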